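(* Assume that at least one of the following two conditions holds. (S) There exist $\rho_1,\rho_2\in(0,+\infty)$ with $\rho_1<\rho_2$ such that: (a) there exist $\tilde\delta_i,\delta_{i1},\delta_{i2}\in[0,+\infty)$ ($i=1,\ldots,n$) such that for every $i\in\{1,\ldots,n\}$ we have $f_i(t,x_1,\ldots,x_{2n},w)\ge\tilde\delta_i x_i$ for all $(t,x_1,\ldots,x_{2n},w)\in J_{i,\rho_1}$, and $h_{ij}[u]\ge\delta_{ij}\|u_i\|_\infty$ for every $u\in\partial K_{\rho_1}$ and $j=1,2$, and moreover $$\min_{i=1,\ldots,n}\Bigl\{\lambda_i\tilde\delta_i\tilde c_i\frac1{M_i}+\sum_{j=1,2}\eta_{ij}c_{ij}\delta_{ij}\|\gamma_{ij}\|_\infty\Bigr\}\ge 1;$$ (b) $$\max_{i=1,\ldots,n;\ l=0,1}\Bigl\{\frac{\lambda_i\overline f_{i,\rho_2}}{m_{il}}+\sum_{j=1,2}\eta_{ij}\|\gamma_{ij}^{(l)}\|_\infty\overline h_{ij,\rho_2}\Bigr\}\le\rho_2.$$ (S)$^\star$ There exist $\rho_1,\rho_2\in(0,+\infty)$ with $\rho_1<\rho_2$ such that: (a) there exists $i_0\in\{1,\ldots,n\}$ such that $$\frac{\lambda_{i_0}\underline f_{i_0,\rho_1}}{M_{i_0}}+\sum_{j=1,2}\eta_{i_0j}c_{i_0j}\|\gamma_{i_0j}\|_\infty\underline h_{i_0j,\rho_1}\ge\rho_1;$$ (b) $$\max_{i=1,\ldots,n;\ l=0,1}\Bigl\{\frac{\lambda_i\overline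 f_{i,\rho_2}}{m_{il}}+\sum_{j=1,2}\eta_{ij}\|\gamma_{ij}^{(l)}\|_\infty\overline h_{ij,\rho_2}\Bigr\}\le\rho_2.$$ Then the system $$u_i(t)=\lambda_i\int_0^1k_i(t,s)f_i(s,u(s),u'(s),w_i[u])\,ds+\sum_{j=1,2}\eta_{ij}\gamma_{ij}(t)h_{ij}[u],\quad t\in[0,1],\ i=1,\ldots,n,$$ has at least one solution $u\in K$ with $\rho_1\le\|u\|\le\rho_2$.
   Context: Let $n\ge1$ be an integer. Write $u=(u_1,\ldots,u_n)$, $u'=(u_1',\ldots,u_n')$, and $\|w\|_\infty=\sup_{t\in[0,1]}|w(t)|$. In $f_i(t,x_1,\ldots,x_{2n},w)$ the variables $x_1,\ldots,x_n$ stand for the values of $u_1,\ldots,u_n$ and $x_{n+1},\ldots,x_{2n}$ for those of $u_1',\ldots,u_n'$. Standing assumptions: (C1) For every $i=1,\ldots,n$, $k_i:[0,1]\times[0,1]\to\mathbb{R}$ is measurable in $s$ for every $t$ and continuous in $t$ for almost every (a.e.) $s$, that is, for every $\tau\in[0,1]$, $\lim_{t\to\tau}|k_i(t,s)-k_i(\tau,s)|=0$ for a.e. $s\in[0,1]$. (C2) For every $i=1,\ldots,n$ there exist a subinterval $[a_i,b_i]\subseteq[0,1]$, a constant $\tilde c_i\in(0,1]$ and a function $\Phi_{i0}\in L^1(0,1)$ such that $|k_i(t,s)|\le\Phi_{i0}(s)$ for $t\in[0,1]$ and a.e. $s\in[0,1]$, and $k_i(t,s)\ge\tilde c_i\Phi_{i0}(s)$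 for $t\in[a_i,b_i]$ and a.e. $s\in[0,1]$. (C3) For every $i$, $\frac{\partial k_i}{\partial t}$ is measurable in $s$ for every $t$, continuous in $t$ except possibly at the point $t=s$ where there can be a jump discontinuity (right and left limits both exist), and there exists $\Phi_{i1}\in L^1(0,1)$ such that $|\frac{\partial k_i}{\partial t}(t,s)|\le\Phi_{i1}(s)$ for $t\in[0,1]$ and a.e. $s\in[0,1]$. (C4) For every $i$, $f_i:[0,1]\times\mathbb{R}^{2n}\times[0,+\infty)\to[0,+\infty)$ is continuous. (C5) For every $i$ and $j=1,2$, $\gamma_{ij}\in C^1[0,1]$ and there is a constant $c_{ij}\in(0,1]$ such that $\gamma_{ij}(t)\ge c_{ij}\|\gamma_{ij}\|_\infty$ for every $t\in[a_i,b_i]$. (C6) For every $i$ and $j=1,2$, $\lambda_i,\eta_{ij}\in[0,+\infty)$. The constants and intervals in (C2), (C5) are fixed. The space $\prod_{i=1}^nC^1[0,1]$ has norm $\|u\|:=\max_i\|u_i\|_{C^1}$, where $\|u_i\|_{C^1}:=\max\{\|u_i\|_\infty,\|u_i'\|_\infty\}$. Let $c_i=\min\{\tilde c_i,c_{i1},c_{i2}\}$, $\tilde K_i:=\{w\in C^1[0,1]:\min_{t\in[a_i,b_i]}w(t)\ge c_i\|w\|_\infty\}$, and let $K:=\prod_{i=1}^n\tilde K_i$ (a cone). (C7) For every $i$ and $j=1,2$, $h_{ij}:K\to[0,+\infty)$ is continuous and maps bounded sets into bounded sets. (C8) For every $i$, $w_i:K\to[0,+\infty)$ is continuous and maps bounded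 sets into bounded sets. For $\rho\in(0,\infty)$ let $K_\rho:=\{u\in K:\|u\|<\rho\}$; closure and boundary $\partial K_\rho$ are relative to $K$. Put $\underline w_{i,\rho}:=\inf_{u\in\partial K_\rho}w_i[u]$, $\overline w_{i,\rho}:=\sup_{u\in\partial K_\rho}w_i[u]$, $\underline h_{ij,\rho}:=\inf_{u\in\partial K_\rho}h_{ij}[u]$, $\overline h_{ij,\rho}:=\sup_{u\in\partial K_\rho}h_{ij}[u]$. $I_{i,\rho}:=[0,1]\times[-\rho,\rho]^{2n}\times[\underline w_{i,\rho},\overline w_{i,\rho}]$ and $\overline f_{i,\rho}:=\max_{I_{i,\rho}}f_i$. $J_{i,\rho}:=[a_i,b_i]\times\prod_{j=1}^{2n}[\theta_j\rho,\rho]\times[\underline w_{i,\rho},\overline w_{i,\rho}]$, where $\theta_j=0$ if $j=i$ and $\theta_j=-1$ if $j\ne i$; $\underline f_{i,\rho}:=\min_{J_{i,\rho}}f_i$. $\frac1{m_{i0}}:=\sup_{t\in[0,1]}\int_0^1|k_i(t,s)|\,ds$, $\frac1{m_{i1}}:=\sup_{t\in[0,1]}\int_0^1|\frac{\partial k_i}{\partial t}(t,s)|\,ds$, $\frac1{M_i}:=\inf_{t\in[a_i,b_i]}\int_{a_i}^{b_i}k_i(t,s)\,ds$. Also $\gamma_{ij}^{(0)}=\gamma_{ij}$, $\gamma_{ij}^{(1)}=\gamma_{ij}'$.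
   Formalization: (C1) is taken with one null set: for a.e. s, k_i(·,s) is continuous on all of [0,1]. If the null set may depend on τ, the claim fails, e.g. for k(t,s)=1+1_{s≤t} with f=g(t,u') and an S-shaped fixed-point set. *)

(* Defs.v *)
From mathcomp Require Import all_boot all_order all_algebra.
From mathcomp Require Import all_classical all_reals all_analysis.

Set Implicit Arguments.
Unset Strict Implicit.
Unset Printing Implicit Defensive.
Import Order.TTheory GRing.Theory Num.Theory.
Import numFieldNormedType.Exports.
Local Open Scope classical_set_scope.
Local Open Scope ring_scope.

(* Real functions on [0,1] are represented by total functions R -> R of which
   only the values on [0,1] are constrained or used; likewise for kernels and
   nonlinearities. The indices 1, ..., n are 'I_n, and j = 1, 2 is 'I_2. *)

(* Lebesgue measure on the Lebesgue (not merely Borel) sigma-algebra. *)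
Notation leb := completed_lebesgue_measure.

Section Interval.
Context {R : realType}.
Implicit Types (w g : R -> R) (t a b c : R).

Definition I01 : set R := `[0, 1].

Definition lebesgue_measurable g : Prop :=
  @measurable_fun _ _
    (caratheodory_type (R := R) (wlength idfun)^*%mu) R I01 g.

Definition L1 g : Prop := leb.-integrable I01 (EFin \o g).

(* Derivative relative to [0,1]: two-sided inside, one-sided at 0 and 1. *)
Definition diffquot01 w t : R -> R := fun x => (w x - w t) / (x - t).
Definition derivable01 w t : Prop := cvg (diffquot01 w t @ within I01 t^').
Definition derive01 w : R -> R := fun t => lim (diffquot01 w t @ within I01 t^').

Definition C1 : set (R -> R) := [set w |
  (forall t, I01 t -> derivable01 w t) /\
  {within I01, continuous (derive01 w)}].

Definition normoo w : R := sup [set `|w t| | t in I01].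

Definition normC1 w : R := Num.max (normoo w) (normoo (derive01 w)).

Definition Ktilde a b c : set (R -> R) :=
  [set w | C1 w /\ forall t, `[a, b]%classic t -> c * normoo w <= w t].

End Interval.

Section Families.
Context {R : realType} {n : nat}.
Implicit Types (u v : 'I_n -> R -> R) (K A : set ('I_n -> R -> R)).

(* This is only a seminorm on total functions: it vanishes on families that are
   zero on [0,1]. A functional continuous for it on K, in the sense of
   [continuous_on], takes equal values at families that agree on [0,1], hence is
   the same thing as a continuous functional on the cone of C^1([0,1])^n. *)
Definition normC1n u : R := \big[Num.max/0]_(i < n) normC1 (u i).

Definition distC1n u v : R := normC1n (fun i t => u i t - v i t).

Definition coneK (a b c : 'I_n -> R) : set ('I_n -> R -> R) :=
  [set u | forall i, Ktilde (a i) (b i) (c i) (u i)].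

Definition continuous_on K (h : ('I_n -> R -> R) -> R) : Prop :=
  forall u, K u -> forall e, 0 < e -> exists2 d, 0 < d &
    forall v, K v -> distC1n v u < d -> `|h v - h u| < e.

Definition bounded_family A : Prop := exists M, forall u, A u -> normC1n u <= M.

Definition maps_bounded K (h : ('I_n -> R -> R) -> R) : Prop :=
  forall A, A `<=` K -> bounded_family A ->
    exists M, forall u, A u -> `|h u| <= M.

Definition admissible_functional K (h : ('I_n -> R -> R) -> R) : Prop :=
  [/\ forall u, K u -> 0 <= h u, continuous_on K h & maps_bounded K h].

Definition rel_closure K A : set ('I_n -> R -> R) :=
  [set u | K u /\ forall e, 0 < e -> exists2 v, A v & distC1n v u < e].

Definition rel_boundary K A : set ('I_n -> R -> R) :=
  rel_closure K A `&` rel_closure K (K `\` A).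

Definition Kball K (rho : R) : set ('I_n -> R -> R) :=
  [set u | K u /\ normC1n u < rho].

Definition bdK K (rho : R) : set ('I_n -> R -> R) :=
  rel_boundary K (Kball K rho).

Definition inf_bdK K (h : ('I_n -> R -> R) -> R) (rho : R) : R :=
  inf [set h u | u in bdK K rho].

Definition sup_bdK K (h : ('I_n -> R -> R) -> R) (rho : R) : R :=
  sup [set h u | u in bdK K rho].

(* (u(t), u'(t)) as an element of R^{2n} *)
Definition jet u (t : R) : 'rV[R]_(n + n) :=
  row_mx (\row_j u j t) (\row_j derive01 (u j) t).

End Families.

Section Kernel.
Context {R : realType}.
Implicit Types (k : R -> R -> R) (Phi : R -> R) (a b ct : R).

Definition dkernel k (t s : R) : R := derive01 (k ^~ s) t.

(* Outside one null set of values s, the section k(.,s) is continuous at every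
   tau in [0,1]. *)
Definition kernel_continuous k : Prop :=
  (forall t, I01 t -> lebesgue_measurable (k t)) /\
  {ae leb, forall s, I01 s -> {within I01, continuous (k ^~ s)}}.

Definition kernel_bounds k Phi a b ct : Prop :=
  [/\ L1 Phi,
      forall t, I01 t -> {ae leb, forall s, I01 s -> `|k t s| <= Phi s}
    & forall t, `[a, b]%classic t ->
        {ae leb, forall s, I01 s -> ct * Phi s <= k t s}].

(* At t = s the partial derivative need not exist; [dkernel k s s] is then
   arbitrary, which affects none of the measurability, a.e. or integral
   conditions below since they ignore a single value of s. *)
Definition kernel_derivative k Phi : Prop :=
  [/\ forall s, I01 s -> forall t, I01 t -> t != s ->
        derivable01 (k ^~ s) t /\
        dkernel k ^~ s @ within I01 (nbhs t) --> dkernel k t s,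
      forall s, I01 s ->
        (0 < s -> cvg (dkernel k ^~ s @ s^'-)) /\
        (s < 1 -> cvg (dkernel k ^~ s @ s^'+)),
      forall t, I01 t -> lebesgue_measurable (dkernel k t),
      L1 Phi
    & forall t, I01 t -> {ae leb, forall s, I01 s -> `|dkernel k t s| <= Phi s}].

(* 1/m_{il}, l = 0, 1, and 1/M_i; these may be 0, so the reciprocals themselves
   are taken as the primitive quantities. *)
Definition inv_m k (l : nat) : R :=
  sup [set \int[leb]_(s in I01) `|iter l derive01 (k ^~ s) t| | t in I01].

Definition inv_M k a b : R :=
  inf [set \int[leb]_(s in `[a, b]) k t s | t in `[a, b]].

End Kernel.

Section Nonlinearity.
Context {R : realType} {n : nat}.
Implicit Types (f : R -> 'rV[R]_(n + n) -> R -> R) (rho wlo whi a b : R).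

Definition nonlinearity f : Prop :=
  {within [set p : R * 'rV[R]_(n + n) * R | I01 p.1.1 /\ 0 <= p.2],
     continuous (fun p => f p.1.1 p.1.2 p.2)} /\
  (forall t x w, I01 t -> 0 <= w -> 0 <= f t x w).

Definition boxI rho wlo whi : set (R * 'rV[R]_(n + n) * R) :=
  [set p : R * 'rV[R]_(n + n) * R | [/\ I01 p.1.1, forall j, - rho <= p.1.2 0 j <= rho
             & wlo <= p.2 <= whi]].

(* The coordinate x_i of R^{2n} has index [lshift n i] in 'I_(n + n). *)
Definition theta (i : 'I_n) (j : 'I_(n + n)) : R :=
  if j == lshift n i then 0 else -1.

Definition boxJ (i : 'I_n) a b rho wlo whi : set (R * 'rV[R]_(n + n) * R) :=
  [set p : R * 'rV[R]_(n + n) * R | [/\ `[a, b]%classic p.1.1,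
               forall j, theta i j * rho <= p.1.2 0 j <= rho
             & wlo <= p.2 <= whi]].

(* maximum and minimum over compact boxes *)
Definition fover f rho wlo whi : R :=
  sup [set f p.1.1 p.1.2 p.2 | p in boxI rho wlo whi].

Definition funder f (i : 'I_n) a b rho wlo whi : R :=
  inf [set f p.1.1 p.1.2 p.2 | p in boxJ i a b rho wlo whi].

End Nonlinearity.

(* Main.v *)
Require Import Defs.
From mathcomp Require Import all_boot all_order all_algebra.
From mathcomp Require Import all_classical all_reals all_analysis.
From mathcomp Require Import measurable_realfun zify ring lra.

Set Implicit Arguments.
Unset Strict Implicit.
Unset Printing Implicit Defensive.

(** A solution of the system is a fixed point of the integral operator [hamm] on
    the cone [K]. The conditions say that [hamm] compresses the shell between the
    spheres of radii [rho1] and [rho2]: on the outer sphere it does not increase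
    the norm ([hamm_upper]), and on the inner sphere [u = hamm u + m] is
    impossible for a constant [m > 0] ([hamm_lower_slope], [hamm_lower_value]).

    The compression theorem [cone_compression] follows from Schauder's theorem.
    Inside the small ball the operator is
    replaced by a radial interpolation between its values on the inner sphere and
    the constant [rho1] at the centre. A fixed point there could be rescaled to a
    solution of [u = hamm u + m] on the inner sphere, so there is none. The
    modified operator, cut off radially at the outer sphere, maps a convex set
    into itself, and its fixed point lies in the shell, where nothing has been
    modified.

    Schauder's theorem ([schauder]) is reduced to Brouwer's on a simplex
    ([simplex_eigenvector]) by Schauder projections onto finite nets. Brouwer's
    theorem comes from Scarf's lemma ([colorful_exists]), a parity argument for a
    finite set with several linear orders: for the coordinate orders of a fine
    simplex grid it yields nearby grid points that together carry all the colours
    that matter ([grid_colorful]), as Sperner's lemma does for a triangulation.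

    On the analytic side, the bound [Phi1] on the derivative makes the kernel
    Lipschitz in [t] for almost every [s] ([kernel_lipschitz]), which allows
    differentiation under the integral sign ([kint_has_der]). The map from [t] to
    the derivative of the kernel at [t] is uniformly continuous into L^1
    ([dk_modulus]). Hence the derivatives of [hamm u], for [u] in a ball, have a
    common modulus of continuity ([dhamm_osc]), and the Ascoli theorem
    ([C1n_ascoli]) gives compactness in the C^1 norm. The cone is preserved
    ([hamm_K]) because the kernel and the functions [gamma] satisfy the inequality
    that defines it. *)

(** * Scarf's combinatorial lemma *)

Section Scarf.
Variables (I Y : finType) (r : I -> Y -> nat).
Hypothesis r_inj : forall i, injective (r i).
Implicit Types (B D : {set Y}) (i j l : I) (y z b d : Y).

(** Scarf's dominance: no [y] lies above the minimum of [B] in every order at once.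
    When the orders are the coordinates of a simplex grid, dominant sets play the
    part of the cells of a triangulation. *)
Definition dominant B := [forall y, exists i, forall b in B, r i y <= r i b].

Lemma dominantP B :
  reflect (forall y, exists i, forall b, b \in B -> r i y <= r i b)
          (dominant B).
Proof.
apply: (iffP forallP) => [H y|H y].
  by have /existsP[i /forall_inP Hi] := H y; exists i.
by have [i Hi] := H y; apply/existsP; exists i; apply/forall_inP.
Qed.

Definition least B i b := (b \in B) && [forall b' in B, r i b <= r i b'].

Lemma leastP B i b :
  reflect (b \in B /\ forall b', b' \in B -> r i b <= r i b') (least B i b).
Proof.
by apply: (iffP andP) => -[Bb H]; split=> //; [exact/forall_inP|exact/forall_inP].
Qed.

Lemma least_uniq B i b b' : least B i b -> least B i b' -> b = b'.
Proof.
move=> /leastP[Bb H] /leastP[Bb' H']; apply: (@r_inj i); apply/eqP.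
by rewrite eqn_leq H // H'.
Qed.

Lemma least_exists B i b0 : b0 \in B -> exists b, least B i b.
Proof.
move=> Bb0; case: (arg_minnP (fun b => r i b) Bb0) => b Bb Hb.
by exists b; apply/leastP.
Qed.

Lemma dominant_least B b : dominant B -> b \in B -> exists i, least B i b.
Proof. by move=> /dominantP/(_ b)[i Hi] Bb; exists i; apply/leastP. Qed.

Lemma dominantS B D : D \subset B -> dominant B -> dominant D.
Proof.
move=> /fintype.subsetP sDB /dominantP H; apply/dominantP => y.
by have [i Hi] := H y; exists i => b /sDB; apply: Hi.
Qed.

(** In a dominant set with as many elements as there are orders, sending an
    order to the element it minimises is onto, hence one-to-one. *)
Lemma dominant_least_inj B (J : {set I}) i j b :
  (forall d, d \in B -> exists2 l, l \in J & least B l d) ->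
  #|J| = #|B| -> i \in J -> j \in J -> least B i b -> least B j b -> i = j.
Proof.
move=> surj cardJ Ji Jj li lj; have Bb : b \in B by case/leastP: li.
pose m l := odflt b [pick d | least B l d].
have mE l : least B l (m l).
  rewrite /m; case: pickP => //= H.
  by have [d Hd] := least_exists l Bb; rewrite H in Hd.
have mJ : m @: J = B.
  apply/setP => d; apply/imsetP/idP => [[l _ ->]|/surj[l Jl ld]].
    by case/leastP: (mE l).
  by exists l => //; apply: least_uniq ld (mE l).
have /imset_injP minj : #|m @: J| == #|J| by rewrite mJ cardJ.
apply: minj => //.
by rewrite -(least_uniq li (mE i)) -(least_uniq lj (mE j)).
Qed.

Section Door.
Variable D : {set Y}.
Hypothesis domD : dominant D.
Hypothesis cardD : #|D|.+1 = #|I|.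

Definition spare i := forall d, d \in D -> exists2 l, l != i & least D l d.

(** The candidates for completing [D] to a room in which [i] is minimised by the
    new element. *)
Definition above i y := forall l, l != i -> exists2 b, b \in D & r l b < r l y.

Definition top_above i y := above i y /\ forall z, above i z -> r i z <= r i y.

Lemma top_above_exists i y0 : above i y0 -> exists y, top_above i y.
Proof.
pose P y := [forall l, (l != i) ==> [exists b in D, r l b < r l y]].
have PP y : reflect (above i y) (P y).
  apply: (iffP forallP) => H l.
    by move=> li; have /implyP/(_ li)/exists_inP[b Db Hb] := H l; exists b.
  by apply/implyP => /H[b Db Hb]; apply/exists_inP; exists b.
move=> /PP Py0; case: (arg_maxnP (fun y => r i y) Py0) => y /PP Py Hy.
by exists y; split=> // z /PP /Hy.
Qed.

Lemma above_le i y : above i y -> forall b, b \in D -> r i y <= r i b.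
Proof.
move=> aby; have /dominantP/(_ y)[l Hl] := domD.
case: (eqVneq l i) => [<- //|/aby[b Db]].
by rewrite ltnNge Hl.
Qed.

Lemma above_notin i y : spare i -> above i y -> y \notin D.
Proof.
move=> spi aby; apply/negP => /spi[l li /leastP[_ Hl]].
by have [b Db] := aby l li; rewrite ltnNge Hl.
Qed.

Lemma top_above_least i y : top_above i y -> least (y |: D) i y.
Proof.
move=> [aby _]; apply/leastP; split; first by rewrite setU11.
by move=> b /finset.setU1P[-> //|]; apply: above_le.
Qed.

(** An element [z] beating the new minimum in every order would be a better
    candidate than [y], against its maximality. *)
Lemma top_above_room i y : top_above i y -> dominant (y |: D).
Proof.
move=> [aby topy]; apply/dominantP => z.
have [/forallP abz|] := boolP [forall l, (l != i) ==> [exists b in D, r l b < r l z]].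
  have {}abz : above i z.
    by move=> l li; have /implyP/(_ li)/exists_inP[b Db Hb] := abz l; exists b.
  exists i => b /finset.setU1P[->|Db]; first exact: topy.
  exact: leq_trans (topy _ abz) (above_le aby Db).
rewrite negb_forall => /existsP[l]; rewrite negb_imply negb_exists_in.
move=> /andP[li /forall_inP H]; exists l => b /finset.setU1P[->|/H]; last by rewrite -leqNgt.
have [d Dd rd] := aby l li; apply: ltnW; apply: leq_ltn_trans rd.
by rewrite leqNgt H.
Qed.

(** In the room [y |: D] each element is minimal for exactly one order; the order
    belonging to [y] is then spare for [D], and dominance makes [y] maximal. *)
Lemma room_top_above y : y \notin D -> dominant (y |: D) ->
  exists i, [/\ spare i, top_above i y & least (y |: D) i y].
Proof.
move=> yD domB; have cardB : #|y |: D| = #|I| by rewrite cardsU1 yD.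
have [i li] := dominant_least domB (setU11 y D).
have only_i l : least (y |: D) l y -> l = i.
  move=> ll; apply: (@dominant_least_inj _ finset.setT) ll li; rewrite ?finset.inE ?cardsT //.
  by move=> d /(dominant_least domB)[m lm]; exists m; rewrite ?finset.inE.
exists i; split=> //.
  move=> d Dd; have dB : d \in y |: D by rewrite setU1r.
  have [l ll] := dominant_least domB dB; exists l.
    apply/eqP => e; rewrite e in ll; have e' := least_uniq ll li.
    by rewrite -e' Dd in yD.
  by case/leastP: ll => _ Hl; apply/leastP; split=> // b Db; apply: Hl; rewrite setU1r.
split=> [l lNi|z abz].
  have [b lb] := least_exists l (setU11 y D).
  have [bB Hb] := leastP _ _ _ lb; have nby : b != y.
    by apply/eqP => e; rewrite e in lb; rewrite (only_i _ lb) eqxx in lNi.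
  exists b; first by case/finset.setU1P: bB => // e; rewrite e eqxx in nby.
  by rewrite ltn_neqAle (inj_eq (@r_inj l)) nby Hb ?setU11.
have /dominantP/(_ z)[l Hl] := domB.
case: (eqVneq l i) => [<-|/abz[b Db]]; first by rewrite Hl ?setU11.
by rewrite ltnNge Hl // setU1r.
Qed.

Lemma room_of_door B : D \subset B -> #|B| = #|I| ->
  exists2 y, y \notin D & B = y |: D.
Proof.
move=> sDB cB.
have /eqP/cards1P[y yE] : #|B :\: D| = 1 by rewrite cardsD (finset.setIidPr sDB) cB -cardD subSnn.
exists y; first by have := set11 y; rewrite -yE finset.inE => /andP[].
by rewrite -yE finset.setDE finset.setUC finset.setUIr finset.setUCr finset.setIT (finset.setUidPr sDB).
Qed.

Definition rooms := [set B | [&& dominant B, #|B| == #|I| & D \subset B]].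

Lemma roomsP B : B \in rooms -> exists i y,
  [/\ spare i, top_above i y & B = y |: D].
Proof.
rewrite finset.inE => /and3P[dB /eqP cB sDB].
have [y yD BE] := room_of_door sDB cB; rewrite BE in dB.
by have [i [si ti _]] := room_top_above yD dB; exists i, y.
Qed.

Lemma rooms_top_above i y : spare i -> top_above i y -> y |: D \in rooms.
Proof.
move=> si ti; rewrite finset.inE (top_above_room ti) finset.subsetUr andbT /=.
by rewrite cardsU1 (above_notin si ti.1) add1n cardD.
Qed.

Lemma top_above_uniq i y z : top_above i y -> top_above i z -> y = z.
Proof.
move=> [ay my] [az mz]; apply: (@r_inj i); apply/eqP.
by rewrite eqn_leq my // mz.
Qed.

(** There is one order more than there are elements of [D], and every element is
    a minimum, so exactly two orders share theirs; either of them can be spared. *)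
Lemma two_spare d : d \in D -> exists i j,
  [/\ i != j, spare i, spare j & forall l, spare l -> l = i \/ l = j].
Proof.
move=> Dd; pose m l := odflt d [pick b | least D l b].
have mE l : least D l (m l).
  rewrite /m; case: pickP => //= H.
  by have [b Hb] := least_exists l Dd; rewrite H in Hb.
have mI : m @: finset.setT = D.
  apply/setP => b; apply/imsetP/idP => [[l _ ->]|Db].
    by case/leastP: (mE l).
  have [l ll] := dominant_least domD Db.
  by exists l; rewrite ?finset.inE //; apply: least_uniq ll (mE l).
have : ~~ injectiveb m.
  apply/negP => /injectiveP minj; have := card_imset finset.setT minj.
  by rewrite mI cardsT -cardD => /eqP; rewrite -[X in X == _]addn0 -addn1 eqn_add2l.
move=> /injectivePn[i [j ij mij]].
exists i, j; split=> //.
- move=> b Db; have [l ll] := dominant_least domD Db.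
  case: (eqVneq l i) => [li|li]; last by exists l.
  exists j; first by rewrite eq_sym.
  by rewrite (least_uniq ll (mE l)) li mij.
- move=> b Db; have [l ll] := dominant_least domD Db.
  case: (eqVneq l j) => [lj|lj]; last by exists l.
  by exists i => //; rewrite (least_uniq ll (mE l)) lj -mij.
move=> l sl; case: (eqVneq l i) => [|li]; first by left.
case: (eqVneq l j) => [|lj]; first by right.
case/eqP: ij; apply: (@dominant_least_inj D [set~ l] i j (m i)) => //.
- by move=> b /sl[l' l'l ll']; exists l' => //; rewrite !finset.inE.
- by rewrite cardsC1 -cardD.
- by rewrite !finset.inE eq_sym.
- by rewrite !finset.inE eq_sym.
- by rewrite mij.
Qed.

Lemma card_rooms2 d : d \in D -> (forall i, spare i -> exists y, above i y) ->
  #|rooms| = 2.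
Proof.
move=> Dd ex; have [i [j [ij si sj only]]] := two_spare Dd.
have [y0 /top_above_exists[y ty]] := ex _ si.
have [z0 /top_above_exists[z tz]] := ex _ sj.
have yNz : y |: D != z |: D.
  apply/eqP => e; have yD := above_notin si ty.1; have zD := above_notin sj tz.1.
  have yz : y = z.
    by have := setU11 y D; rewrite e => /finset.setU1P[//|yD']; rewrite yD' in yD.
  have dB := top_above_room ty.
  case/eqP: ij; apply: (@dominant_least_inj (y |: D) finset.setT i j y); rewrite ?finset.inE //.
  - by move=> b /(dominant_least dB)[l ll]; exists l; rewrite ?finset.inE.
  - by rewrite cardsU1 yD cardsT -cardD.
  - exact: top_above_least.
  - by rewrite yz; exact: top_above_least.
have -> : rooms = [set y |: D; z |: D].
  apply/setP => B; apply/idP/set2P.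
    move=> /roomsP[l [x [sl tl ->]]].
    case: (only l sl) => e; rewrite e in tl; [left|right].
      by rewrite (top_above_uniq tl ty).
    by rewrite (top_above_uniq tl tz).
  by case=> ->; apply: rooms_top_above; [exact: si|exact: ty|exact: sj|exact: tz].
by rewrite cards2 yNz.
Qed.

Lemma card_rooms1 i y0 : spare i -> above i y0 ->
  (forall j y, spare j -> above j y -> j = i) -> #|rooms| = 1.
Proof.
move=> si /top_above_exists[y ty] only; apply/eqP/cards1P; exists (y |: D).
apply/setP => B; apply/idP/set1P => [/roomsP[j [z [sj tj ->]]]|->].
  by have ji := only _ _ sj tj.1; rewrite ji in tj; rewrite (top_above_uniq tj ty).
exact: rooms_top_above ty.
Qed.

End Door.

Variables (s : I -> Y) (c : Y -> I) (i0 : I).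
Hypothesis s_least : forall i y, r i (s i) <= r i y.
Hypothesis s_big : forall i j y, i != j -> (forall l, y != s l) ->
  r i y < r i (s j).
Hypothesis c_s : forall i, c (s i) = i.

Lemma s_inj : injective s.
Proof. exact: can_inj c_s. Qed.

(** The doors through which a Sperner-type parity argument passes. *)
Definition doors := [set D : {set Y} |
  [&& dominant D, #|D|.+1 == #|I| & c @: D == [set~ i0]]].

Lemma color_inj D x y : #|D|.+1 = #|I| -> c @: D = [set~ i0] ->
  x \in D -> y \in D -> c x = c y -> x = y.
Proof.
move=> cardD cD; have /imset_injP : #|c @: D| == #|D|.
  by rewrite cD cardsC1 -cardD.
exact.
Qed.

(** This is the door on the outer boundary: [i0] is its only spare index that has a
    candidate. *)
Lemma card_rooms_slack D : D \in doors -> (forall d, d \in D -> exists l, d = s l) ->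
  #|rooms D| = 1.
Proof.
rewrite finset.inE => /and3P[domD /eqP cardD /eqP cD] sD.
have Ds l : l != i0 -> s l \in D.
  move=> li; have : l \in c @: D by rewrite cD !finset.inE.
  by case/imsetP => b Db ->; have [l' bE] := sD _ Db; rewrite bE c_s -bE.
have sDN l : s l \in D -> l != i0.
  by move=> Dl; have := imset_f c Dl; rewrite cD c_s !finset.inE.
have ls l : l != i0 -> least D l (s l) by move=> /Ds Dl; apply/leastP.
have spi0 : spare D i0.
  by move=> d Dd; have [l dE] := sD _ Dd; exists l; rewrite ?dE ?ls // sDN // -dE.
apply: (card_rooms1 domD cardD spi0 (y0 := s i0)).
  move=> l li; exists (s l); first exact: Ds.
  rewrite ltn_neqAle s_least andbT (inj_eq (@r_inj l)) (inj_eq s_inj).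
  exact: li.
move=> j y sj aj; case: (eqVneq j i0) => // jNi.
have [b Db ryb] : exists2 b, b \in D & r i0 b < r i0 y by apply: aj; rewrite eq_sym.
have [l yE] : exists l, y = s l.
  case: (pickP (fun l => y == s l)) => [l /eqP ->|H]; first by exists l.
  have [l bE] := sD _ Db; move: ryb; rewrite ltnNge bE ltnW // s_big //.
    by rewrite eq_sym sDN // -bE.
  by move=> l'; rewrite H.
case: (eqVneq l i0) => li; first by move: ryb; rewrite yE li ltnNge s_least.
case: (eqVneq l j) => lj; last first.
  by have [d _] := aj _ lj; rewrite yE ltnNge s_least.
(* Since [j] is spare, an order [l' != j] is minimised at [s j]; it must be [i0],
   for otherwise [s l'] is in [D] and comes before [s j]. *)
have [l' l'j /leastP[_ Hl']] := sj _ (Ds _ jNi).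
case: (eqVneq l' i0) => l'i.
  by move: ryb; rewrite ltnNge yE lj -l'i Hl'.
have := Hl' _ (Ds _ l'i); rewrite leqNgt ltn_neqAle s_least andbT.
by rewrite (inj_eq (@r_inj l')) (inj_eq s_inj) l'j.
Qed.

(** A non-slack element of [D] lies below the slack [s i] in every order but [i],
    so both spare indices have a candidate. *)
Lemma card_rooms_inner D x : D \in doors -> x \in D -> (forall l, x != s l) ->
  #|rooms D| = 2.
Proof.
rewrite finset.inE => /and3P[domD /eqP cardD _] Dx xs.
apply: (card_rooms2 domD cardD Dx) => i _; exists (s i) => l li.
by exists x => //; apply: s_big.
Qed.

Definition roomset := [set B : {set Y} | dominant B & #|B| == #|I|].

(** If a room has such a door but misses a colour, its extra element repeats the
    colour of exactly one element of the door, and exchanging the two gives the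
    only other door. *)
Lemma doors_of_room B : B \in roomset -> c @: B != finset.setT ->
  ~~ odd #|[set D in doors | D \subset B]|.
Proof.
rewrite finset.inE => /andP[domB /eqP cardB] cB.
have [->|[D]] := set_0Vmem [set D in doors | D \subset B]; first by rewrite cards0.
rewrite !finset.inE => /andP[/and3P[domD /eqP cardD /eqP cD] sDB].
have [x xD BE] := room_of_door cardD sDB cardB.
have cxi : c x != i0.
  apply: contra cB => /eqP cx; apply/eqP/setP => l; rewrite BE imsetU1 cx cD.
  by rewrite !finset.inE; case: eqP.
have : c x \in c @: D by rewrite cD !finset.inE.
case/imsetP => z Dz cxz; have xz : x != z by apply: contraNneq xD => ->.
suff -> : [set D in doors | D \subset B] = [set D; B :\ z].
  rewrite cards2; suff -> : D != B :\ z by [].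
  by apply: contraTneq Dz => ->; rewrite !finset.inE eqxx.
have zB : z \in B by rewrite BE setU1r.
have xB : x \in B by rewrite BE setU11.
apply/setP => E; rewrite !finset.inE; apply/idP/idP.
  move=> /andP[/and3P[domE /eqP cardE /eqP cE] sEB].
  have [y yE BE'] := room_of_door cardE sEB cardB.
  have yB : y \in B by rewrite BE' setU11.
  have EE : E = B :\ y by rewrite BE' setU1K.
  have [yx|yx] := eqVneq y x.
    by rewrite EE BE yx setU1K // eqxx.
  have [yz|yz] := eqVneq y z; first by rewrite EE yz eqxx orbT.
  case/eqP: xz; apply: (color_inj cardE cE) => //.
    by rewrite EE !finset.inE eq_sym yx.
  by rewrite EE !finset.inE eq_sym yz.
case/orP => /eqP ->.
  by rewrite domD cardD eqxx cD eqxx sDB.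
rewrite (dominantS _ domB) ?subsetDl // andbT /=.
apply/andP; split; first by move: (cardsD1 z B); rewrite zB cardB add1n => ->.
apply/eqP; rewrite -cD; apply/setP => l; apply/imsetP/imsetP => -[y].
  rewrite BE !finset.inE => /andP[yz /orP[/eqP->|yD]] ->; first by exists z.
  by exists y.
move=> yD ->; have [->|yz] := eqVneq y z.
  by exists x => //; rewrite !finset.inE xz xB.
by exists y => //; rewrite !finset.inE yz BE setU1r.
Qed.

Lemma slack_door : [set s l | l in [set~ i0]] \in doors.
Proof.
rewrite finset.inE; apply/and3P; split.
- apply/dominantP => y; case: (pickP (fun l => y == s l)) => [l /eqP ->|H].
    by exists l => b _; apply: s_least.
  exists i0 => b /imsetP[l li ->]; apply/ltnW/s_big => [|l']; last by rewrite H.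
  by rewrite eq_sym; move: li; rewrite !finset.inE.
- rewrite (card_imset _ s_inj) cardsC1 prednK //.
  by apply/card_gt0P; exists i0.
- apply/eqP/setP => l; rewrite -imset_comp; apply/imsetP/idP => [[m mi ->]|li].
    by rewrite /= c_s.
  by exists l => //=; rewrite c_s.
Qed.

(** Parity count of the incident pairs (door, room): summed over doors it is
    odd, because only the door made of slack elements lies in a single room;
    summed over rooms it would be even if no room saw every colour. *)
Lemma colorful_exists : exists B, [/\ dominant B, #|B| = #|I| & c @: B = finset.setT].
Proof.
suff : exists2 B, B \in roomset & c @: B == finset.setT.
  by case=> B; rewrite finset.inE => /andP[dB /eqP cB] /eqP eB; exists B.
apply/exists_inP; apply: contraT; rewrite negb_exists_in => /forall_inP no.
pose inc (D B : {set Y}) := D \subset B.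
have E : \sum_(D in doors) #|rooms D| =
         \sum_(B in roomset) #|[set D in doors | D \subset B]|.
  under eq_bigr => D _.
    have -> : #|rooms D| = \sum_(B in roomset) (D \subset B).
      rewrite -sum1_card big_mkcond [RHS]big_mkcond /=; apply: eq_bigr => B _.
      by rewrite !finset.inE; case: dominant; case: eqP; case: (D \subset B).
    over.
  rewrite exchange_big; apply: eq_bigr => B _ /=.
  rewrite -sum1_card big_mkcond [RHS]big_mkcond /=; apply: eq_bigr => D _.
  by rewrite [in RHS]finset.inE; case: (D \in doors); case: (D \subset B).
have : odd (\sum_(D in doors) #|rooms D|).
  rewrite (bigD1 _ slack_door) /= oddD.
  rewrite (card_rooms_slack slack_door); last by move=> d /imsetP[l _ ->]; exists l.
  rewrite addTb; elim/big_ind: _ => // [m n /negbTE om /negbTE on|D /andP[dD0 DN]]; last have dD : D \in doors := dD0.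
    by rewrite oddD om on.
  have [/existsP[x /andP[Dx /forallP xs]]|] := boolP [exists x, (x \in D) && [forall l, x != s l]].
    by rewrite (card_rooms_inner dD Dx xs).
  rewrite negb_exists => /forallP H; case/eqP: DN.
  have sD d : d \in D -> exists l, d = s l.
    move=> Dd; have := H d; rewrite Dd /= negb_forall => /existsP[l].
    by rewrite negbK => /eqP ->; exists l.
  have := dD; rewrite finset.inE => /and3P[_ _ /eqP cD].
  apply/setP => d; apply/idP/imsetP => [Dd|[l li ->]].
    have [l dE] := sD _ Dd; exists l => //.
    by rewrite -cD -(c_s l) -dE; apply: imset_f.
  move: li; rewrite -cD => /imsetP[b Db ->]; have [m bE] := sD _ Db.
  by rewrite bE c_s -bE.
rewrite E => /negPn/negP; case.
elim/big_ind: _ => // [m n /negbTE om /negbTE on|B RB]; first by rewrite oddD om on.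
exact: doors_of_room RB (no _ RB).
Qed.

End Scarf.

(** * Colourings of the simplex grid *)

Section Grid.
Variables (m N : nat).
Hypothesis m_gt0 : 0 < m.

Definition gridpt := {x : {ffun 'I_m -> 'I_N.+1} | \sum_i (x i : nat) == N}.

Definition gcoord (x : gridpt) (i : 'I_m) : nat := val x i.

Lemma sum_gcoord x : \sum_i gcoord x i = N.
Proof. by apply/eqP; exact: (valP x). Qed.

(** The deficit is added to the first coordinate. *)
Lemma gridpt_exists (y : 'I_m -> nat) : \sum_i y i <= N ->
  exists x : gridpt, forall i, y i <= gcoord x i.
Proof.
move=> yN; pose i0 := Ordinal m_gt0.
pose z i := y i + (i == i0) * (N - \sum_i y i).
have zN : \sum_i z i = N.
  rewrite big_split (bigD1 (P := predT) (F := fun i => (i == i0) * _) i0) // eqxx mul1n.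
  rewrite -[RHS](subnKC yN) -[X in _ = _ + X]addn0; congr (_ + (_ + _)).
  by rewrite big1 // => i /negbTE ->.
have z_lt i : z i < N.+1 by rewrite ltnS -[leqRHS]zN (bigD1 i) //= leq_addr.
pose x := [ffun i => Ordinal (z_lt i)] : {ffun 'I_m -> 'I_N.+1}.
have xP : \sum_i (x i : nat) == N.
  by rewrite -[eqbRHS]zN; apply/eqP; apply: eq_bigr => i _; rewrite ffunE.
exists (exist _ x xP) => i; rewrite /gcoord /= ffunE /= /z; exact: leq_addr.
Qed.

(** The enumeration breaks ties between grid points, as Scarf's lemma works with
    linear orders. *)
Definition grank (i : 'I_m) (y : gridpt + 'I_m) : nat :=
  match y with
  | inl x => (gcoord x i * #|{: gridpt}| + enum_rank x).+1
  | inr j => if j == i then 0 else (N.+1 * #|{: gridpt}| + j).+1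
  end.

Lemma grank_lt i x : gcoord x i * #|{: gridpt}| + enum_rank x <
  N.+1 * #|{: gridpt}|.
Proof.
apply: (@leq_trans ((gcoord x i).+1 * #|{: gridpt}|)).
  by rewrite mulSn addnC ltn_add2r ltn_ord.
by rewrite leq_mul2r ltn_ord orbT.
Qed.

Lemma grank_inj i : injective (grank i).
Proof.
move=> [x|j] [y|l] //=.
- move=> [] e; congr inl; apply: (can_inj enum_rankK); apply: val_inj => /=.
  have h1 := ltn_ord (enum_rank x); have h2 := ltn_ord (enum_rank y).
  have/(congr1 (modn^~ #|{: gridpt}|)) := e.
  by rewrite !modnMDl !modn_small.
- case: ifP => // _ [] e; by have := grank_lt i x; rewrite e ltnNge leq_addr.
- case: ifP => // _ [] e; by have := grank_lt i y; rewrite -e ltnNge leq_addr.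
case: eqP => [->|_]; case: eqP => [->|_] //.
by move=> [] /addnI /val_inj ->.
Qed.

Lemma grank_coord i x y : grank i (inl x) <= grank i (inl y) ->
  gcoord x i <= gcoord y i.
Proof.
rewrite /= ltnS; move=> H; rewrite leqNgt; apply/negP => H2.
have : (gcoord y i).+1 * #|{: gridpt}| <= gcoord x i * #|{: gridpt}|.
  by rewrite leq_mul2r H2 orbT.
move/leq_trans => /(_ _ (leq_trans (leq_addr _ _) H)).
by rewrite mulSn addnC leq_add2l leqNgt ltn_ord.
Qed.

(** Let [C] be the indices whose slack is not in the colourful dominant set [B].
    No grid point exceeds the minima of [B] in all coordinates of [C], so these
    minima have sum larger than [N - m]; this leaves less than [m] units in any
    coordinate for the differences between the points of [B], and for the
    coordinates outside [C]. *)
Lemma grid_colorful (col : gridpt -> 'I_m) :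
  exists (C : {set 'I_m}) (x0 : gridpt),
    (forall i, i \in C -> exists2 y, col y = i &
       forall j, gcoord y j <= gcoord x0 j + m /\ gcoord x0 j <= gcoord y j + m)
    /\ (forall i, i \notin C -> gcoord x0 i <= m).
Proof.
pose i0 := Ordinal m_gt0.
pose c (y : gridpt + 'I_m) := match y with inl x => col x | inr i => i end.
have sl i y : grank i (inr i) <= grank i y by rewrite /= eqxx.
have sb i j y : i != j -> (forall l, y != inr l) -> grank i y < grank i (inr j).
  move=> ij; case: y => [x _|l /(_ l)]; last by rewrite eqxx.
  by rewrite [ltnRHS]/= eq_sym (negbTE ij) !ltnS /= (leq_trans (grank_lt i x)) ?leq_addr.
have cs i : c (inr i) = i by [].
have [B [domB cardB cB]] := @colorful_exists _ _ grank grank_inj _ c i0 sl sb cs.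
pose C := [set i | inr i \notin B].
have inC i : i \in C -> exists2 y, inl y \in B & col y = i.
  move=> iC; have : i \in c @: B by rewrite cB finset.inE.
  case/imsetP => -[y By ->|j Bj /= ij]; first by exists y.
  by move: iC; rewrite finset.inE ij Bj.
have dom x : exists2 i, i \in C & forall y, inl y \in B -> gcoord x i <= gcoord y i.
  have /dominantP/(_ (inl x))[i Hi] := domB; exists i.
    by rewrite finset.inE; apply/negP => /Hi; rewrite /= eqxx.
  by move=> y /Hi /grank_coord.
have [x00 _] : exists x : gridpt, forall i, 0 <= gcoord x i.
  by apply: (@gridpt_exists (fun=> 0)); rewrite big1.
have [j0 /inC[x0 Bx0 _] _] := dom x00.
have argm i := arg_minnP (fun y => gcoord y i) (Bx0 : [pred y | inl y \in B] x0).
pose mn i := gcoord [arg min_(y < x0 | [pred y | inl y \in B] y) gcoord y i] i.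
have mnle i y : inl y \in B -> mn i <= gcoord y i.
  by rewrite /mn; case: argm => z _ Hz By; apply: Hz.
have mnat i : exists2 y, inl y \in B & mn i = gcoord y i.
  by rewrite /mn; case: argm => z Bz _; exists z.
have big : N < \sum_(i in C) (mn i).+1.
  rewrite ltnNge; apply/negP => le.
  have [|x Hx] := @gridpt_exists (fun i => if i \in C then (mn i).+1 else 0).
    by rewrite -big_mkcond.
  have [i iC Hi] := dom x; have [y By my] := mnat i.
  by have := Hx i; rewrite iC ltnNge my Hi.
have bigm : N < \sum_(i in C) mn i + m.
  apply: leq_trans big _; rewrite -(eq_bigr _ (fun i _ => addn1 (mn i))) big_split /=.
  by rewrite leq_add2l sum1_card -[leqRHS]card_ord max_card.
have sumC y : \sum_(i in C) gcoord y i + \sum_(i | i \notin C) gcoord y i = N.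
  by rewrite -[RHS](sum_gcoord y) [RHS](bigID (mem C)).
have arith u v S S' Z : N < v + S + m -> u + S' + Z = N -> S <= S' -> u <= v + m.
  by clear; lia.
have near_mn y i : inl y \in B -> i \in C -> gcoord y i <= mn i + m.
  move=> By iC; have := sumC y; rewrite (bigD1 i) //=.
  move: bigm; rewrite (bigD1 i) //= => H1 H2.
  have : \sum_(j in C | j != i) mn j <= \sum_(j in C | j != i) gcoord y j.
    by apply: leq_sum => j _; apply: mnle.
  exact: arith H1 H2.
have small y i : inl y \in B -> i \notin C -> gcoord y i <= m.
  move=> By iC; have := sumC y; rewrite [X in _ + X](bigD1 i) //= addnCA addnA => H2.
  have : \sum_(j in C) mn j <= \sum_(j in C) gcoord y j.
    by apply: leq_sum => j _; apply: mnle.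
  by apply: (arith _ 0) H2; rewrite add0n.
exists C, x0; split=> [i /inC[y By cy]|i iC]; last exact: small.
exists y => // j; have [jC|jC] := boolP (j \in C).
  have := near_mn y j By jC; have := near_mn x0 j Bx0 jC.
  by have := mnle j y By; have := mnle j x0 Bx0; lia.
by have := small y j By jC; have := small x0 j Bx0 jC; lia.
Qed.
End Grid.

Import Order.TTheory GRing.Theory Num.Theory.
Import numFieldNormedType.Exports.
Local Open Scope classical_set_scope.
Local Open Scope ring_scope.

(** * Brouwer's theorem on a simplex *)

Section Simplex.
Context {R : realType} (m : nat).
Hypothesis m_gt0 : (0 < m)%N.
Implicit Types x y : 'rV[R]_m.

Definition simplex : set 'rV[R]_m :=
  [set x | (forall i, 0 <= x 0 i) /\ \sum_i x 0 i = 1].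

Lemma simplex_le1 x i : simplex x -> x 0 i <= 1.
Proof.
by case=> x0 <-; rewrite (bigD1 i) //= lerDl sumr_ge0.
Qed.

Lemma cvg_sumr (T : Type) (F : set_system T) {FF : Filter F} (I : finType)
    (f : I -> T -> R) (l : I -> R) : (forall i, f i x @[x --> F] --> l i) ->
  \sum_i f i x @[x --> F] --> \sum_i l i.
Proof.
move=> fl; apply: (cvg_big (op := +%R)) => // [p].
by apply: cvgD; [exact: cvg_fst|exact: cvg_snd].
Qed.

Lemma closed_simplex : closed simplex.
Proof.
have -> : simplex = (\bigcap_(i in [set: 'I_m]) ((fun x : 'rV[R]_m => x 0 i) @^-1` [set t : R | 0 <= t]))
     `&` ((fun x : 'rV[R]_m => \sum_i x 0 i) @^-1` [set 1]).
  apply/seteqP; split => x; first by case=> x0 x1; split => // i _ /=.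
  by case=> x0 x1; split => // i; apply: x0.
apply: closedI.
  apply: closed_bigI => i _; apply: preimage_closed; last exact: closed_ge.
  by move=> x _; apply: coord_continuous.
apply: preimage_closed; last exact: closed_eq.
move=> x _; apply: (@cvg_sumr _ (nbhs x)) => i; exact: coord_continuous.
Qed.

Lemma compact_simplex : compact simplex.
Proof.
apply: (subclosed_compact closed_simplex
  (@rV_compact R m (fun=> `[0, 1]%classic) (fun=> @segment_compact R 0 1))).
move=> x sx i /=; rewrite in_itv /= simplex_le1 // andbT.
by case: sx.
Qed.

Variable g : 'I_m -> 'rV[R]_m -> R.
Let S x := \sum_i g i x.

(** The colour of a grid point is a coordinate [i] with [S x * x_i <= g_i x];
    one exists because both sides have the same sum. *)
Lemma simplex_approx (N : nat) : (0 < N)%N -> exists2 x, simplex x &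
  forall i, x 0 i <= m%:R / N%:R \/ exists y, [/\ simplex y,
    S y * y 0 i <= g i y & forall j, `|x 0 j - y 0 j| <= m%:R / N%:R].
Proof.
move=> N_gt0; have N0 : 0 < N%:R :> R by rewrite ltr0n.
pose pt (z : gridpt m N) : 'rV[R]_m := \row_i ((gcoord z i)%:R / N%:R).
have ptE z i : pt z 0 i = (gcoord z i)%:R / N%:R by rewrite mxE.
have sp z : simplex (pt z).
  split=> [i|]; first by rewrite ptE divr_ge0.
  under eq_bigr do rewrite ptE.
  by rewrite -mulr_suml -natr_sum sum_gcoord divff // gt_eqF.
have ex x : simplex x -> exists i, S x * x 0 i <= g i x.
  move=> [x0 x1]; apply: contrapT => /forallNP no.
  have : \sum_i g i x < \sum_i S x * x 0 i.
    apply: ltr_sum => [|i _]; last by rewrite ltNge; apply/negP/no.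
    by apply/hasP; exists (Ordinal m_gt0); rewrite ?mem_index_enum.
  by rewrite -mulr_sumr x1 mulr1 ltxx.
have /choice[col colP] : forall z : gridpt m N, exists i, S (pt z) * pt z 0 i <= g i (pt z).
  by move=> z; apply: ex.
have [C [z0 [HC HNC]]] := grid_colorful m_gt0 col.
exists (pt z0) => // i; have [/HC[z cz Hz]|/HNC le] := boolP (i \in C).
  right; exists (pt z); split=> //; first by rewrite -cz.
  move=> j; rewrite !ptE -mulrBl normrM (@ger0_norm _ N%:R^-1) ?invr_ge0 ?ler0n //.
  rewrite ler_pM2r ?invr_gt0 // ler_norml; have [h1 h2] := Hz j.
  rewrite lerBlDl -natrD ler_nat h2 andbT.
  by rewrite lerNl opprB lerBlDl -natrD ler_nat.
by left; rewrite ptE ler_pM2r ?invr_gt0 // ler_nat.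
Qed.

Hypothesis g_ge0 : forall i x, simplex x -> 0 <= g i x.
Hypothesis g_cont : forall i x, simplex x ->
  g i y @[y --> within simplex (nbhs x)] --> g i x.

(** Brouwer's theorem for the map [x |-> g x / S x], in a division-free form
    that makes sense where [S] vanishes. At a cluster point of the approximate
    solutions every coordinate satisfies one and the same inequality, and both
    sides have the same sum. *)
Theorem simplex_eigenvector :
  exists2 x, simplex x & forall i, g i x = S x * x 0 i.
Proof.
have /choice[u uP] N : exists x, simplex x /\ forall i, x 0 i <= m%:R / N.+1%:R \/ exists y,
   [/\ simplex y, S y * y 0 i <= g i y & forall j, `|x 0 j - y 0 j| <= m%:R / N.+1%:R].
  by have [x sx Hx] := simplex_approx (ltn0Sn N); exists x.
have [|x [sx clx]] := compact_simplex (F := u @ \oo) _.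
  by exists 0%N => // N _; case: (uP N).
exists x => //.
suff le i : S x * x 0 i <= g i x.
  have sum0 : \sum_i (g i x - S x * x 0 i) = 0.
    by rewrite sumrB -mulr_sumr sx.2 mulr1 subrr.
  move=> i; apply/eqP; rewrite -subr_eq0; apply/eqP; move: i (erefl true).
  by apply: psumr_eq0P => // i _; rewrite subr_ge0.
rewrite leNgt; apply/negP => lt.
have Sx0 : 0 <= S x by apply: sumr_ge0 => j _; apply: g_ge0.
have xi0 : 0 < x 0 i.
  rewrite lt_neqAle sx.1 andbT; apply: contraTneq lt => <-.
  by rewrite mulr0 -leNgt g_ge0.
have cS : S y @[y --> within simplex (nbhs x)] --> S x.
  by apply: cvg_sumr => j; apply: g_cont.
have cx : y 0 i @[y --> within simplex (nbhs x)] --> x 0 i.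
  exact: cvg_within_filter (@coord_continuous _ _ _ 0 i x).
have : \forall y \near within simplex (nbhs x), g i y < S y * y 0 i.
  have cd : S y * y 0 i - g i y @[y --> within simplex (nbhs x)] --> S x * x 0 i - g i x.
    by apply: cvgB; [exact: cvgM|exact: g_cont].
  have d0 : 0 < S x * x 0 i - g i x by rewrite subr_gt0.
  near=> y; rewrite -subr_gt0; near: y; exact: cvgr_gt cd _ d0.
rewrite near_withinE => /nbhs_ballP[d /= d0 Hd].
have [e [e0 e1 e2]] : exists e, [/\ 0 < e, e <= d / 2 & e <= x 0 i / 2].
  exists (Num.min (d / 2) (x 0 i / 2)); rewrite lt_min !divr_gt0 //.
  by rewrite !ge_min !lexx orbT.
have [N0 HN0] : exists N0, forall N, (N0 <= N)%N -> m%:R / N.+1%:R < e.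
  exists (Num.trunc (m%:R / e)) => N hN; rewrite ltr_pdivrMr ?ltr0n // mulrC -ltr_pdivrMr //.
  apply: lt_le_trans (truncnS_gt _) _; by rewrite ler_nat.
have [y [] ] : exists N, (N0 <= N)%N /\ ball x e (u N).
  have [] := clx (u @` [set N | (N0 <= N)%N]) (ball x e).
  - by exists N0 => // N hN; exists N.
  - exact: nbhsx_ballx.
  by move=> _ [[N hN <-] bN]; exists N.
move=> hy [_ bu]; have small := HN0 _ hy; have [_ /(_ i)[]] := uP y.
  have := bu 0 i; rewrite /ball /= ltr_norml => /andP[_ h1] h2.
  have h3 := le_lt_trans h2 small; lra.
move=> [z [sz Hz nz]]; have := Hd z _ sz; rewrite ltNge Hz => /(_ _)/negP; apply => //.
split=> // i' j; rewrite ord1 /ball /=.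
have := bu 0 j; rewrite /ball /= => h1; have h2 := le_lt_trans (nz j) small.
have := ler_normD (x 0 j - u y 0 j) (u y 0 j - z 0 j).
rewrite addrA subrK; lra.
Unshelve. all: by end_near. Qed.
End Simplex.
Arguments simplex {R m}.

(** * Schauder's theorem for a seminorm *)

Lemma invn_lt (R : realType) (e : R) : 0 < e ->
  exists k0, forall k, (k0 <= k)%N -> k.+1%:R^-1 < e.
Proof.
move=> e0; exists (Num.trunc e^-1) => k hk.
rewrite invf_plt ?posrE ?ltr0n //; apply: lt_le_trans (truncnS_gt _) _.
by rewrite ler_nat.
Qed.

Lemma common_delta (R : realType) (I : finType) (X : Type) (D : X -> R) (Q : I -> X -> Prop) :
  (forall i, exists2 d, 0 < d & forall x, D x < d -> Q i x) ->
  exists2 d, 0 < d & forall x, D x < d -> forall i, Q i x.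
Proof.
move=> H; have /choice[d dP] i : exists d, 0 < d /\ forall x, D x < d -> Q i x.
  by have [d d0 Hd] := H i; exists d.
exists (\big[Num.min/1]_i d i); first by apply: lt_bigmin => // i _; exact: (dP i).1.
move=> x Dx i; apply: (dP i).2; apply: lt_le_trans Dx _; exact: bigmin_le_cond.
Qed.

Section Seminorm.
Context {R : realType} {V : lmodType R} (W : set V) (N : V -> R).
Implicit Types x y z : V.

Definition subspace : Prop :=
  W 0 /\ forall (a : R) x y, W x -> W y -> W (a *: x + y).

Definition seminorm_on : Prop :=
  [/\ forall x, W x -> 0 <= N x,
      forall x y, W x -> W y -> N (x + y) <= N x + N y
    & forall (a : R) x, W x -> N (a *: x) = `|a| * N x].

Hypotheses (WL : subspace) (NS : seminorm_on).

Lemma subspaceD x y : W x -> W y -> W (x + y).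
Proof. by move=> Wx Wy; rewrite -[x]scale1r; apply: WL.2. Qed.

Lemma subspaceZ (a : R) x : W x -> W (a *: x).
Proof. by move=> Wx; rewrite -[_ *: _]addr0; apply: WL.2 => //; exact: WL.1. Qed.

Lemma subspaceB x y : W x -> W y -> W (x - y).
Proof. by move=> Wx Wy; rewrite addrC -scaleN1r; apply: WL.2. Qed.

Lemma seminorm0 : N 0 = 0.
Proof. by case: NS => _ _ /(_ 0 0 WL.1); rewrite scale0r normr0 mul0r. Qed.

Lemma seminormBC x y : W x -> W y -> N (x - y) = N (y - x).
Proof.
move=> Wx Wy; case: NS => _ _ NZ.
by rewrite -[x - y]opprB -[- (y - x)]scaleN1r NZ ?normrN1 ?mul1r //; apply: subspaceB.
Qed.

Lemma seminorm_triangle y x z : W x -> W y -> W z ->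
  N (x - z) <= N (x - y) + N (y - z).
Proof.
move=> Wx Wy Wz; case: NS => _ ND _.
by rewrite -(subrKA y); apply: ND; apply: subspaceB.
Qed.

Lemma seminorm_distD x y : W x -> W y -> N x <= N y + N (x - y).
Proof.
move=> Wx Wy; case: NS => _ ND _; rewrite -[in X in X <= _](subrK y x) addrC.
by apply: ND => //; apply: subspaceB.
Qed.

Lemma seminorm_sum (I : finType) (f : I -> V) : (forall i, W (f i)) ->
  N (\sum_i f i) <= \sum_i N (f i).
Proof.
case: NS => _ ND _ Wf.
suff : W (\sum_i f i) /\ N (\sum_i f i) <= \sum_i N (f i) by case.
elim/big_rec2: _ => [|i s y _ [Wy le]]; first by rewrite seminorm0; split=> //; exact: WL.1.
split; first exact: subspaceD.
by apply: le_trans (ND _ _ _ _) _ => //; rewrite lerD2l.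
Qed.

Definition cluster_pt (z : nat -> V) p :=
  forall e, 0 < e -> forall k0, exists2 k, (k0 <= k)%N & N (z k - p) < e.

Definition seq_precompact (A C : set V) := forall z : nat -> V,
  (forall k, A (z k)) -> exists2 p, C p & cluster_pt z p.

(** Without a finite net one could choose a sequence in [A] with mutual distances
    at least [e], which has no cluster point. *)
Lemma seq_precompact_net (A C : set V) e : A `<=` W -> C `<=` W -> 0 < e ->
  seq_precompact A C ->
  exists s : seq V, (forall y, y \in s -> A y) /\
    forall x, A x -> exists2 y, y \in s & N (x - y) < e.
Proof.
move=> AW CW e0 cmp; apply: contrapT => no.
have ex (s : seq V) : exists x, (forall y, y \in s -> A y) ->
    A x /\ forall y, y \in s -> e <= N (x - y).
  have [sA|] := pselect (forall y, y \in s -> A y); last by exists 0.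
  apply: contrapT => /forallNP H; apply: no; exists s; split=> // x Ax.
  apply: contrapT => H2; apply: (H x) => _; split=> // y ys.
  by rewrite leNgt; apply/negP => lt; apply: H2; exists y.
have [next nextP] := choice ex.
pose fix l k := if k is k'.+1 then next (l k') :: l k' else [::].
have lA k y : y \in l k -> A y.
  elim: k y => //= k IH y; rewrite inE => /orP[/eqP ->|/IH//].
  exact: (nextP _ IH).1.
have mem j d : next (l j) \in l (d + j.+1)%N.
  elim: d => [|d IH]; first by rewrite add0n /= inE eqxx.
  by rewrite addSn /= inE IH orbT.
have far j k : (j < k)%N -> e <= N (next (l k) - next (l j)).
  by move=> jk; apply: (nextP _ (lA k)).2; have := mem j (k - j.+1)%N; rewrite subnK.
have zA k : A (next (l k)) := (nextP _ (lA k)).1.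
have [p Cp clp] := cmp _ zA; have e2 : 0 < e / 2 by rewrite divr_gt0.
have [j _ Hj] := clp _ e2 0%N; have [k jk Hk] := clp _ e2 j.+1.
have := far _ _ jk; rewrite leNgt => /negP; apply.
apply: le_lt_trans (@seminorm_triangle p _ _ _ _ _) _; try by [apply: AW|apply: CW].
rewrite (seminormBC (x := p)); try by [apply: AW|apply: CW].
by rewrite [e]splitr ltrD.
Qed.

Section Schauder.
Variables (C : set V) (G : V -> V).
Hypotheses (CW : C `<=` W) (C_nonempty : C !=set0).
Hypothesis C_convex : forall m (l : 'rV[R]_m) (y : 'I_m -> V), simplex l ->
  (forall i, C (y i)) -> C (\sum_i l 0 i *: y i).
Hypothesis GC : forall x, C x -> C (G x).
Hypothesis G_cont : forall x, C x -> forall e, 0 < e -> exists2 d, 0 < d &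
  forall y, C y -> N (y - x) < d -> N (G y - G x) < e.
Hypothesis G_compact : seq_precompact (G @` C) C.

(** Schauder projection: a fixed point of [G] followed by the projection on the
    convex hull of a finite net is an approximate fixed point of [G]. *)
Lemma approx_fixpoint e : 0 < e -> exists2 x, C x & N (G x - x) <= e.
Proof.
move=> e0; case: (NS) => N0 ND NZ.
have GCW : G @` C `<=` W by move=> _ [x Cx <-]; apply/CW/GC.
have [s [sG net]] := seq_precompact_net GCW CW e0 G_compact.
pose y (i : 'I_(size s)) := nth 0 s i.
have Cy i : C (y i) by rewrite /y; have [x Cx <-] := sG _ (mem_nth 0 (ltn_ord i)); apply: GC.
have Wy i : W (y i) by apply: CW.
have s_gt0 : (0 < size s)%N.
  have [x Cx] := C_nonempty; have [|z] := net (G x); first by exists x.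
  by case: (s).
pose phi (l : 'rV[R]_(size s)) := \sum_i l 0 i *: y i.
have Cphi l : simplex l -> C (phi l) by move=> sl; apply: C_convex.
pose g i l := Num.max 0 (e - N (G (phi l) - y i)).
have g0 i l : simplex l -> 0 <= g i l by move=> _; rewrite le_max lexx.
have [l sl Hl] : exists2 l, simplex l & forall i, g i l = (\sum_i g i l) * l 0 i.
  apply: simplex_eigenvector => // i l sl.
  apply/cvgrPdist_lt => eps eps0.
  have [d d0 Hd] := G_cont (Cphi l sl) eps0.
  have near0 : \sum_i `|l' 0 i - l 0 i| * N (y i) @[l' --> within simplex (nbhs l)]
      --> \sum_(i < size s) (0 : R).
    apply: cvg_sumr => j; rewrite -(mul0r (N (y j))).
    apply: cvgM; last exact: cvg_cst.
    rewrite -(normr0 R); apply: cvg_norm; rewrite -(subrr (l 0 j)).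
    apply: cvgB; last exact: cvg_cst.
    exact: cvg_within_filter (@coord_continuous _ _ _ 0 j l).
  rewrite big1 // in near0.
  near=> l'.
  have sl' : simplex l' by near: l'; exact: near_withinT.
  have lt_d : N (phi l' - phi l) < d.
    rewrite /phi -sumrB; apply: le_lt_trans (seminorm_sum _) _ => [j|].
      by rewrite -scalerBl; apply: subspaceZ.
    under eq_bigr do rewrite -scalerBl NZ //.
    near: l'; exact: cvgr_lt near0 _ d0.
  have := Hd _ (Cphi _ sl') lt_d; set u := G (phi l'); set v := G (phi l) => uv.
  have Wu : W u by apply/CW/GC/Cphi.
  have Wv : W v by apply/CW/GC/Cphi.
  have h1 := seminorm_triangle Wu Wv (Wy i).
  have h2 := seminorm_triangle Wv Wu (Wy i).
  rewrite (seminormBC Wv Wu) in h2.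
  rewrite /g -/u -/v ltr_norml /Num.max.
  case: (ltP 0 (e - N (u - y i))) => ?; case: (ltP 0 (e - N (v - y i))) => ?;
    apply/andP; split; lra.
set S := \sum_i g i l in Hl.
have Cx := Cphi l sl; have WG : W (G (phi l)) by apply/CW/GC.
exists (phi l) => //.
have S0 : 0 < S.
  have [|z zs lt] := net (G (phi l)); first by exists (phi l).
  have zi : (index z s < size s)%N by rewrite index_mem.
  apply: lt_le_trans (_ : g (Ordinal zi) l <= _); last first.
    by rewrite /S (bigD1 (Ordinal zi)) //= lerDl sumr_ge0 // => j _; apply: g0.
  by rewrite /g /y /= nth_index // lt_max subr_gt0 lt orbT.
have -> : G (phi l) - phi l = \sum_i l 0 i *: (G (phi l) - y i).
  under eq_bigr do rewrite scalerBr.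
  by rewrite sumrB -scaler_suml sl.2 scale1r.
apply: le_trans (seminorm_sum _) _ => [i|]; first by apply/subspaceZ/subspaceB.
rewrite -[leRHS]mul1r -sl.2 mulr_suml; apply: ler_sum => i _.
rewrite NZ; last exact: subspaceB.
rewrite ger0_norm ?sl.1 //; case: (eqVneq (l 0 i) 0) => [->|li]; first by rewrite !mul0r.
have li0 : 0 < l 0 i by rewrite lt_neqAle eq_sym li sl.1.
rewrite ler_pM2l //; have : 0 < g i l by rewrite Hl mulr_gt0.
by rewrite /g lt_max ltxx /= subr_gt0 => /ltW.
Unshelve. all: by end_near. Qed.

Theorem schauder : exists2 x, C x & N (x - G x) = 0.
Proof.
case: (NS) => N0 ND NZ.
have ex k : exists x, C x /\ N (G x - x) <= k.+1%:R^-1.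
  by have [|x Cx Hx] := @approx_fixpoint k.+1%:R^-1; [rewrite invr_gt0|exists x].
have [x xP] := choice ex.
have [|p Cp clp] := G_compact (z := G \o x); first by move=> k; exists (x k) => //; exact: (xP k).1.
exists p => //; apply/eqP; rewrite eq_le N0 ?andbT; last by apply/subspaceB; apply: CW => //; exact: GC.
apply/ler_addgt0Pl => e e0; rewrite addr0.
have e2 : 0 < e / 2 by rewrite divr_gt0.
have [d d0 Hd] := G_cont Cp e2.
have [d2 d2le] : exists2 d2, 0 < d2 & d2 <= d / 2 /\ d2 <= e / 2.
  exists (Num.min (d / 2) (e / 2)); first by rewrite lt_min !divr_gt0.
  by rewrite !ge_min !lexx orbT.
move=> [d2d d2e]; have [k0 Hk0] := invn_lt d2le.
have [k kk Hk] := clp _ d2le k0.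
have [Cxk Hxk] := xP k.
have Wp : W p by apply: CW. have WGp : W (G p) by apply/CW/GC.
have Wx : W (x k) by apply: CW. have WGx : W (G (x k)) by apply/CW/GC.
have h1 := seminorm_triangle Wx WGx Wp; have h2 := le_lt_trans Hxk (Hk0 _ kk).
rewrite (seminormBC Wx WGx) in h1.
have /= h3 : N (x k - p) < d by move: Hk => /= Hk; lra.
have h4 := Hd _ Cxk h3; have h5 := seminorm_triangle Wp WGx WGp.
rewrite (seminormBC Wp WGx) in h5; move: Hk => /= Hk; lra.
Qed.

End Schauder.
End Seminorm.

(** * Compression of a cone *)

Section Compression.
Context {R : realType} {V : lmodType R} (W : set V) (N : V -> R).
Hypotheses (WL : subspace W) (NS : seminorm_on W N).
Variables (K : set V) (T : V -> V) (v0 : V) (rho1 rho2 : R).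
Implicit Types x y z : V.
Hypotheses (KW : K `<=` W)
  (KD : forall x y, K x -> K y -> K (x + y))
  (KZ : forall (a : R) x, 0 <= a -> K x -> K (a *: x))
  (Kv0 : K v0) (Nv0 : 0 < N v0) (rho1_gt0 : 0 < rho1) (rho12 : rho1 < rho2).

Definition cone_ball : set V := [set x | K x /\ N x <= rho2].
Local Notation C := cone_ball.

Hypotheses (TK : forall x, C x -> K (T x))
  (T_cont : forall x, C x -> forall e, 0 < e -> exists2 d, 0 < d &
     forall y, C y -> N (y - x) < d -> N (T y - T x) < e)
  (T_bounded : exists B, forall x, C x -> N (T x) <= B).

(** Contains all values of the modified operator used in the proof. *)
Definition hull : set V := [set z | exists (a b : R) x,
  [/\ C x, 0 <= a <= 1, 0 <= b <= rho1 & z = a *: T x + b *: v0]].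

Hypothesis T_compact : seq_precompact N hull K.

Lemma cone_ballW x : C x -> W x. Proof. by case=> /KW. Qed.

Lemma cone0 : K 0. Proof. by rewrite -(scale0r v0); apply: KZ. Qed.

Let N_ge0 x : W x -> 0 <= N x. Proof. by case: NS => H _ _; apply: H. Qed.
Let NZ (a : R) x : W x -> N (a *: x) = `|a| * N x. Proof. by case: NS => _ _; apply. Qed.
Let ND x y : W x -> W y -> N (x + y) <= N x + N y. Proof. by case: NS => _ H _; apply: H. Qed.
Let WT x : C x -> W (T x). Proof. by move=> /TK /KW. Qed.
Let Wv0 : W v0. Proof. exact: KW. Qed.

(** * The relative topology of the seminorm *)

Definition cone_nbhs x : set_system V :=
  filter_from [set d : R | 0 < d] (fun d => [set y | C y /\ N (y - x) < d]).

Lemma cone_nbhs_filter x : Filter (cone_nbhs x).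
Proof.
apply: filter_from_filter; first by exists 1; rewrite /= ltr01.
move=> d1 d2 /= d10 d20; exists (Num.min d1 d2); first by rewrite /= lt_min d10.
by move=> y [Cy]; rewrite lt_min => /andP[h1 h2]; split.
Qed.
Local Existing Instance cone_nbhs_filter.

Lemma cone_nbhs_in x : \forall y \near cone_nbhs x, C y.
Proof. by exists 1; rewrite /= ?ltr01 // => y []. Qed.


Definition vcvg (u : V -> V) x l := forall e, 0 < e -> \forall y \near cone_nbhs x, N (u y - l) < e.

Lemma vcvgP (u : V -> V) x l :
  (forall e, 0 < e -> exists2 d, 0 < d & forall y, C y -> N (y - x) < d -> N (u y - l) < e) <->
  vcvg u x l.
Proof.
split=> H e /H; first by case=> d d0 Hd; exists d => // y [Cy yd]; apply: Hd.
by case=> d d0 Hd; exists d => // y Cy yd; apply: Hd.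
Qed.

Section Limits.
Variables (x : V) (u : V -> V) (l : V).
Hypotheses (Wu : forall y, C y -> W (u y)) (Wl : W l) (ul : vcvg u x l).

Lemma vcvg_norm : N (u y) @[y --> cone_nbhs x] --> N l.
Proof.
apply/cvgrPdist_lt => e e0.
near=> y; have Cy : C y by near: y; exact: cone_nbhs_in.
have h : N (u y - l) < e by near: y; exact: ul.
have h1 := seminorm_distD WL NS (Wu Cy) Wl.
have h2 := seminorm_distD WL NS Wl (Wu Cy).
rewrite (seminormBC WL NS Wl (Wu Cy)) in h2.
by rewrite ltr_norml; apply/andP; split; lra.
Unshelve. all: by end_near. Qed.

Lemma vcvgZ (a : V -> R) (b : R) : a y @[y --> cone_nbhs x] --> b ->
  vcvg (fun y => a y *: u y) x (b *: l).
Proof.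
move=> ab e e0.
have c1 : `|a y - b| * (N (u y)) @[y --> cone_nbhs x] --> (0 : R).
  rewrite -(mul0r (N l)); apply: cvgM; last exact: vcvg_norm.
  rewrite -(normr0 R) -(subrr b); apply: cvg_norm; apply: cvgB => //; exact: cvg_cst.
have e2 : 0 < e / 2 by rewrite divr_gt0.
have eb : 0 < e / 2 / (`|b| + 1) by rewrite divr_gt0 // ltr_wpDl.
near=> y; have Cy : C y by near: y; exact: cone_nbhs_in.
have -> : a y *: u y - b *: l = (a y - b) *: u y + b *: (u y - l).
  by rewrite scalerBl scalerBr addrA subrK.
have Wuy := Wu Cy; have Wul : W (u y - l) by apply: (subspaceB WL).
apply: le_lt_trans (ND _ _) _; try exact: (subspaceZ WL).
rewrite !NZ // [e]splitr; apply: ltrD; first by near: y; apply: (cvgr_lt _ c1).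
have h : N (u y - l) < e / 2 / (`|b| + 1) by near: y; exact: ul.
move: h; rewrite ltr_pdivlMr ?ltr_wpDl // => h; apply: le_lt_trans h.
by rewrite mulrC ler_wpM2l ?N_ge0 // lerDl.
Unshelve. all: by end_near. Qed.
End Limits.

Lemma vcvgD x u1 l1 u2 l2 : (forall y, C y -> W (u1 y)) -> W l1 ->
  (forall y, C y -> W (u2 y)) -> W l2 -> vcvg u1 x l1 -> vcvg u2 x l2 ->
  vcvg (fun y => u1 y + u2 y) x (l1 + l2).
Proof.
move=> W1 Wl1 W2 Wl2 c1 c2 e e0; have e2 : 0 < e / 2 by rewrite divr_gt0.
near=> y; have Cy : C y by near: y; exact: cone_nbhs_in.
have -> : u1 y + u2 y - (l1 + l2) = (u1 y - l1) + (u2 y - l2) by rewrite opprD addrACA.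
apply: le_lt_trans (ND _ _) _; try by apply: (subspaceB WL) => //; auto.
by rewrite [e]splitr; apply: ltrD; near: y; [exact: c1|exact: c2].
Unshelve. all: by end_near. Qed.

Lemma vcvg_id x : vcvg id x x.
Proof. by apply/vcvgP => e e0; exists e. Qed.

Lemma vcvg_cst x l : W l -> vcvg (fun=> l) x l.
Proof.
move=> Wl e e0; near=> y; by rewrite subrr (seminorm0 WL NS).
Unshelve. all: by end_near. Qed.

Lemma vcvgT x p : C (p x) -> (forall y, C y -> C (p y)) -> vcvg p x (p x) ->
  vcvg (fun y => T (p y)) x (T (p x)).
Proof.
move=> Cpx Cp cp e e0; have [d d0 Hd] := T_cont Cpx e0.
near=> y; apply: Hd; last by near: y; exact: cp.
by apply: Cp; near: y; exact: cone_nbhs_in.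
Unshelve. all: by end_near. Qed.

Lemma cvg_maxr (F : set_system V) (FF : Filter F) (g : V -> R) (a l : R) :
  g y @[y --> F] --> l -> Num.max a (g y) @[y --> F] --> Num.max a l.
Proof.
move=> gl; apply/cvgrPdist_lt => e e0; move/cvgrPdist_lt: gl => /(_ e e0).
apply: filterS => y; rewrite !ltr_norml => /andP[h1 h2].
by rewrite /Num.max; case: (ltP a l) => ?; case: (ltP a (g y)) => ?; apply/andP; split; lra.
Qed.

Lemma cvg_minr (F : set_system V) (FF : Filter F) (g : V -> R) (a l : R) :
  g y @[y --> F] --> l -> Num.min (g y) a @[y --> F] --> Num.min l a.
Proof.
move=> gl; apply/cvgrPdist_lt => e e0; move/cvgrPdist_lt: gl => /(_ e e0).
apply: filterS => y; rewrite !ltr_norml => /andP[h1 h2].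
by rewrite /Num.min; case: (ltP l a) => ?; case: (ltP (g y) a) => ?; apply/andP; split; lra.
Qed.

(** * The modified operator *)

(** The weight [wt] vanishes where [N x = 0] and equals 1 outside the small ball,
    while [push] moves the points of the small ball radially to its sphere. Where
    [N x = 0] the convention [0^-1 = 0] makes [push x = 0], which is harmless
    because the weight vanishes there. *)
Let wt x : R := Num.min (N x) rho1 / rho1.
Let push x : V := (Num.max rho1 (N x) / N x) *: x.
Let S x : V := wt x *: T (push x) + ((1 - wt x) * rho1) *: v0.
Let cut x : R := rho2 / Num.max rho2 (N x).
Let G x : V := cut (S x) *: S x.

Let wt01 x : C x -> 0 <= wt x <= 1.
Proof.
move=> Cx; rewrite /wt divr_ge0 ?le_min ?N_ge0 ?(ltW rho1_gt0) //; last exact: cone_ballW.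
by rewrite ler_pdivrMr // mul1r ge_min lexx orbT.
Qed.

Let push_ge0 x : C x -> 0 <= Num.max rho1 (N x) / N x.
Proof.
move=> Cx; rewrite divr_ge0 ?N_ge0 ?le_max ?(ltW rho1_gt0) //; exact: cone_ballW.
Qed.

Let Npush x : C x -> N x != 0 -> N (push x) = Num.max rho1 (N x).
Proof.
move=> Cx n0; rewrite /push NZ ?ger0_norm ?push_ge0 //; last exact: cone_ballW.
by rewrite divfK.
Qed.

Let Cpush x : C x -> C (push x).
Proof.
move=> Cx; split; first by apply: KZ; [exact: push_ge0|case: Cx].
have [n0|n0] := eqVneq (N x) 0.
  by rewrite /push n0 invr0 mulr0 scale0r (seminorm0 WL NS) ltW // (lt_trans rho1_gt0).
rewrite Npush // ge_max ltW //=; by case: Cx.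
Qed.

Let KS x : C x -> K (S x).
Proof.
move=> Cx; have /andP[w0 w1] := wt01 Cx.
apply: KD; apply: KZ => //; first exact/TK/Cpush.
by rewrite mulr_ge0 ?subr_ge0 // ltW.
Qed.

Let cut01 x : 0 <= cut x <= 1.
Proof.
have r2 : 0 < rho2 by exact: lt_trans rho12.
have m0 : 0 < Num.max rho2 (N x) by rewrite lt_max r2.
by rewrite /cut divr_ge0 ?(ltW r2) ?(ltW m0) // ler_pdivrMr // mul1r le_max lexx.
Qed.

Let CG x : C x -> C (G x).
Proof.
move=> Cx; have r2 : 0 < rho2 by exact: lt_trans rho12.
have m0 : 0 < Num.max rho2 (N (S x)) by rewrite lt_max r2.
have /andP[c0 c1] := cut01 (S x); split; first by apply: KZ => //; exact: KS.
rewrite /G NZ; last by apply/KW/KS.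
rewrite ger0_norm // /cut mulrAC ler_pdivrMr // ler_pM2l //.
by rewrite le_max lexx orbT.
Qed.

(** Where [N x = 0] the map [push] is not continuous, but there the weight tends
    to zero and [T] is bounded. *)
Let S_cvg x : C x -> vcvg S x (S x).
Proof.
move=> Cx; have Wx := cone_ballW Cx; have cN : N y @[y --> cone_nbhs x] --> N x.
  by apply: (@vcvg_norm x id x) => //; [exact: cone_ballW|exact: vcvg_id].
have cw : wt y @[y --> cone_nbhs x] --> wt x.
  by apply: cvgM; [exact: cvg_minr|exact: cvg_cst].
have WTp y : C y -> W (T (push y)) by move=> Cy; apply/WT/Cpush.
have cv0 : vcvg (fun y => ((1 - wt y) * rho1) *: v0) x (((1 - wt x) * rho1) *: v0).
  apply: (@vcvgZ x (fun=> v0) v0) => //; first exact: vcvg_cst.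
  apply: cvgM; last exact: cvg_cst.
  by apply: cvgB => //; exact: cvg_cst.
have [n0|n0] := eqVneq (N x) 0; last first.
  apply: vcvgD cv0 => [y Cy||y _||].
  - by apply: (subspaceZ WL); exact: WTp.
  - by apply: (subspaceZ WL); exact: WTp.
  - exact: (subspaceZ WL).
  - exact: (subspaceZ WL).
  apply: vcvgZ => //; first exact: WTp.
  apply: vcvgT; [exact: Cpush|exact: Cpush|].
  apply: (@vcvgZ x id x) => //; [exact: cone_ballW|exact: vcvg_id|].
  by apply: cvgM; [exact: cvg_maxr|exact: cvgV].
have wx : wt x = 0 by rewrite /wt n0 min_l ?mul0r // ltW.
have [B HB] := T_bounded.
rewrite /S wx scale0r add0r; rewrite wx in cw cv0 *.
rewrite -[X in vcvg _ x X]add0r; apply: vcvgD cv0 => [y Cy||y _||].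
- by apply: (subspaceZ WL); exact: WTp.
- exact: WL.1.
- exact: (subspaceZ WL).
- exact: (subspaceZ WL).
move=> e e0; have cB : wt y * B @[y --> cone_nbhs x] --> (0 : R).
  by rewrite -(mul0r B); apply: cvgM => //; exact: cvg_cst.
near=> y; have Cy : C y by near: y; exact: cone_nbhs_in.
have /andP[w0 w1] := wt01 Cy.
rewrite subr0 NZ ?ger0_norm //; last exact: WTp.
apply: (@le_lt_trans _ _ (wt y * B)).
  by rewrite ler_wpM2l // HB //; exact: Cpush.
near: y; exact: cvgr_lt cB _ e0.
Unshelve. all: by end_near. Qed.

Let G_cvg x : C x -> vcvg G x (G x).
Proof.
move=> Cx; have r2 : 0 < rho2 by exact: lt_trans rho12.
have WS y : C y -> W (S y) by move=> /KS /KW.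
apply: vcvgZ => //; [exact: WS|exact: S_cvg|].
apply: cvgM; first exact: cvg_cst.
apply: cvgV; first by rewrite gt_eqF // lt_max r2.
by apply: cvg_maxr; apply: vcvg_norm => //; [exact: WS|exact: S_cvg].
Qed.

Let C_convex m (l : 'rV[R]_m) (y : 'I_m -> V) : simplex l ->
  (forall i, C (y i)) -> C (\sum_i l 0 i *: y i).
Proof.
move=> [l0 l1] Cy; have Wy i : W (y i) by exact: cone_ballW.
split.
  elim/big_ind: _ => [||i _]; [exact: cone0|exact: KD|].
  by apply: KZ => //; case: (Cy i).
apply: le_trans (seminorm_sum WL NS _) _ => [i|]; first exact: (subspaceZ WL).
rewrite -[leRHS]mul1r -l1 mulr_suml; apply: ler_sum => i _.
by rewrite NZ // ger0_norm // ler_wpM2l //; case: (Cy i).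
Qed.

Let G_compact : seq_precompact N (G @` C) C.
Proof.
move=> z Gz; have zh k : hull (z k).
  have [x Cx <-] := Gz k; have /andP[w0 w1] := wt01 Cx.
  have /andP[c0 c1] := cut01 (S x).
  exists (cut (S x) * wt x), (cut (S x) * ((1 - wt x) * rho1)), (push x); split.
  - exact: Cpush.
  - by rewrite mulr_ge0 //= mulr_ile1.
  - have w1' : 0 <= 1 - wt x <= 1 by rewrite subr_ge0 w1 gerBl.
    have /andP[w2 w3] := w1'; apply/andP; split.
      by rewrite mulr_ge0 // mulr_ge0 // ltW.
    by rewrite mulrA ler_piMl ?(ltW rho1_gt0) // mulr_ile1.
  - by rewrite /G {2}/S scalerDr !scalerA.
have [p Kp clp] := T_compact zh; exists p => //; split => //.
apply/ler_addgt0Pr => e e0; have [k _ Hk] := clp e e0 0%N.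
have Cz : C (z k) by have [x Cx <-] := Gz k; apply: CG.
have := seminorm_distD WL NS (KW Kp) (cone_ballW Cz).
rewrite (seminormBC WL NS (KW Kp) (cone_ballW Cz)).
case: Cz => _ h1 h2; lra.
Qed.

Hypothesis upper : forall x, K x -> N x = rho2 -> N (T x) <= rho2.
Hypothesis lower : forall x (m : R), K x -> N x = rho1 -> 0 < m ->
  N (x - (T x + m *: v0)) <> 0.

(** Inside the small ball the operator is replaced by its radial interpolation
    with [rho1 *: v0], which has no fixed point there by [lower]; outside the
    large ball it is cut off radially, which creates no fixed point by
    [upper]. *)
Theorem cone_compression : exists x, [/\ K x, rho1 <= N x <= rho2 & N (x - T x) = 0].
Proof.
have r2 : 0 < rho2 by exact: lt_trans rho12.
have C0 : C !=set0 by exists 0; split; [exact: cone0|rewrite (seminorm0 WL NS) ltW].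
have G_cont x : C x -> forall e, 0 < e -> exists2 d, 0 < d &
    forall y, C y -> N (y - x) < d -> N (G y - G x) < e.
  by move=> /G_cvg /vcvgP.
have [x Cx fx] := schauder WL NS cone_ballW C0 C_convex CG G_cont G_compact.
have Wx := cone_ballW Cx; have WS : W (S x) by apply/KW/KS.
have WG : W (G x) by apply/cone_ballW/CG.
have NG : N x = N (G x).
  have h1 := seminorm_distD WL NS Wx WG; have h2 := seminorm_distD WL NS WG Wx.
  rewrite (seminormBC WL NS WG Wx) in h2; apply/eqP; rewrite eq_le.
  by apply/andP; split; lra.
have outer : rho1 <= N x -> S x = T x.
  move=> le; have n0 : N x != 0 by rewrite gt_eqF // (lt_le_trans rho1_gt0).
  have w1 : wt x = 1 by rewrite /wt min_r // divff // gt_eqF.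
  have p1 : push x = x by rewrite /push max_r // divff // scale1r.
  by rewrite /S w1 p1 subrr mul0r scale0r addr0 scale1r.
have [gt|le] := ltP rho2 (N (S x)).
  have e : N x = rho2.
    rewrite NG /G NZ // /cut (max_r (ltW gt)) ger0_norm ?divr_ge0 ?(ltW r2) ?N_ge0 //.
    by rewrite divfK // gt_eqF // (lt_trans r2).
  have := gt; rewrite outer ?e ?(ltW rho12) // ltNge upper //; by case: Cx.
have GS : G x = S x by rewrite /G /cut (max_l le) divff ?gt_eqF // scale1r.
have [le1|lt1] := leP rho1 (N x).
  by exists x; split; [case: Cx|rewrite le1; case: Cx|rewrite -outer // -GS].
exfalso; have [n0|n0] := eqVneq (N x) 0.
  move: NG; rewrite GS /S /wt n0 min_l ?(ltW rho1_gt0) // mul0r scale0r add0r subr0 mul1r.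
  by rewrite NZ // gtr0_norm // => /esym/eqP; rewrite mulf_eq0 !gt_eqF.
have r0 : 0 < N x by rewrite lt_neqAle eq_sym n0 N_ge0.
have pE : push x = (rho1 / N x) *: x by rewrite /push max_l // ltW.
pose m := rho1 / N x * ((1 - wt x) * rho1).
have wE : wt x = N x / rho1 by rewrite /wt min_l // ltW.
have m0 : 0 < m.
  by rewrite /m wE !mulr_gt0 ?invr_gt0 // subr_gt0 ltr_pdivrMr // mul1r.
apply: (lower (x := push x) _ _ m0).
- by case: (Cpush Cx).
- by rewrite Npush // max_l // ltW.
have -> : push x - (T (push x) + m *: v0) = (rho1 / N x) *: (x - S x).
  rewrite scalerBr -pE /S scalerDr !scalerA -/m wE mulrA divfK ?gt_eqF //.
  by rewrite divff ?scale1r // gt_eqF.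
by move: fx; rewrite GS => fx; rewrite NZ ?fx ?mulr0 //; apply: (subspaceB WL).
Qed.

End Compression.

(** * Derivatives relative to the unit interval *)

Section UnitInterval.
Context {R : realType}.
Implicit Types (w g : R -> R) (t x y l e d : R).

Lemma I01E t : I01 t = (0 <= t <= 1) :> Prop.
Proof. by rewrite /I01 /= in_itv. Qed.

Lemma I01P t : I01 t <-> 0 <= t /\ t <= 1.
Proof. by rewrite I01E; split => [/andP|/andP]. Qed.

Definition cont01 g t := forall e, 0 < e -> exists2 d, 0 < d &
  forall x, I01 x -> `|x - t| < d -> `|g x - g t| < e.

(** Differentiability at [t] without division, so that [x = t] needs no exception. *)
Definition has_der01 w t l := forall e, 0 < e -> exists2 d, 0 < d &
  forall x, I01 x -> `|x - t| < d -> `|w x - w t - l * (x - t)| <= e * `|x - t|.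

Lemma cvg01P g t l : g x @[x --> within I01 (nbhs t)] --> l <->
  forall e, 0 < e -> exists2 d, 0 < d &
    forall x, I01 x -> `|x - t| < d -> `|g x - l| < e.
Proof.
split=> [/cvgrPdist_lt H e /H|H].
  rewrite near_withinE => /nbhs_ballP[d /= d0 Hd]; exists d => // x Ix xt.
  by rewrite distrC; apply: Hd => //; rewrite /ball /= distrC.
apply/cvgrPdist_lt => e /H[d d0 Hd]; rewrite near_withinE.
apply/nbhs_ballP; exists d => //= x; rewrite /ball /= => xt Ix.
by rewrite distrC; apply: Hd => //; rewrite distrC.
Qed.

Lemma continuous01P g : {within I01, continuous g} <->
  forall t, I01 t -> cont01 g t.
Proof.
split=> [/subspace_continuousP H t /H /cvg01P //|H].
by apply/subspace_continuousP => t It; apply/cvg01P/H.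
Qed.

Lemma I01_accum t d : I01 t -> 0 < d ->
  exists x, [/\ I01 x, x != t & `|x - t| < d].
Proof.
move=> /I01P[t0 t1] d0; pose e := Num.min (d / 2) (1 / 2).
have [e0 [ed e1]] : 0 < e /\ e <= d / 2 /\ e <= 1 / 2.
  by rewrite /e lt_min !ge_min !lexx orbT !divr_gt0.
have [th|th] := leP t (1 / 2).
  exists (t + e); split; first by apply/I01P; lra.
    by apply/eqP; lra.
  by rewrite addrAC subrr add0r gtr0_norm //; lra.
exists (t - e); split; first by apply/I01P; lra.
  by apply/eqP; lra.
by rewrite addrAC subrr add0r normrN gtr0_norm //; lra.
Qed.

Lemma dnbhs01_proper t : I01 t -> ProperFilter (within I01 t^').
Proof.
move=> It; split; last exact: within_filter.
rewrite /dnbhs /within /= => /nbhs_ballP[d /= d0 Hd].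
have [x [Ix xt xd]] := I01_accum It d0.
by apply: (Hd x) => //; rewrite /ball /= distrC.
Qed.

Lemma diffquot_cvgP w t l : has_der01 w t l <->
  diffquot01 w t @ within I01 t^' --> l.
Proof.
have quot x : x != t -> `|l - diffquot01 w t x| * `|x - t| = `|w x - w t - l * (x - t)|.
  move=> xt; rewrite -normrM distrC /diffquot01; congr (`|_|).
  by field; rewrite subr_eq0.
split=> [H|/cvgrPdist_le H e /H].
  apply/cvgrPdist_le => e /H[d d0 Hd].
  rewrite /dnbhs !near_withinE; apply/nbhs_ballP; exists d => //= x.
  rewrite /ball /= => xd xt Ix; have n0 : 0 < `|x - t| by rewrite normr_gt0 subr_eq0.
  by rewrite -(ler_pM2r n0) quot // Hd // distrC.
rewrite /dnbhs !near_withinE => /nbhs_ballP[d /= d0 Hd]; exists d => // x Ix xd.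
have [->|xt] := eqVneq x t; first by rewrite !subrr mulr0 subrr normr0 mulr0.
rewrite -quot // ler_wpM2r //; apply: Hd => //.
by rewrite /ball /= distrC.
Qed.

Lemma has_der01_derive w t l : I01 t -> has_der01 w t l ->
  derivable01 w t /\ derive01 w t = l.
Proof.
move=> It /diffquot_cvgP H; have FF := dnbhs01_proper It.
by split; [apply/cvg_ex; exists l|apply: cvg_lim].
Qed.

Lemma derivable01_has_der w t : derivable01 w t -> has_der01 w t (derive01 w t).
Proof. by move=> H; apply/diffquot_cvgP. Qed.

Lemma has_der01_cont w t l : has_der01 w t l -> cont01 w t.
Proof.
move=> H e e0; have [d d0 Hd] := H 1 ltr01.
have l1 : 0 < `|l| + 1 by rewrite ltr_wpDl.
exists (Num.min d (e / (`|l| + 1))) => [|x Ix].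
  by rewrite lt_min d0 divr_gt0.
rewrite lt_min ltr_pdivlMr // => /andP[xd xe]; apply: le_lt_trans xe.
have := Hd x Ix xd; have := ler_normD (w x - w t - l * (x - t)) (l * (x - t)).
rewrite subrK normrM mul1r => h1 h2; rewrite mulrDr mulr1 mulrC.
lra.
Qed.

Lemma has_der01_comb w1 w2 (a : R) t l1 l2 : has_der01 w1 t l1 -> has_der01 w2 t l2 ->
  has_der01 (fun x => a * w1 x + w2 x) t (a * l1 + l2).
Proof.
move=> H1 H2 e e0; have a1 : 0 < `|a| + 1 by rewrite ltr_wpDl.
have [|d1 d10 Hd1] := H1 (e / 2 / (`|a| + 1)); first by rewrite !divr_gt0.
have [|d2 d20 Hd2] := H2 (e / 2); first by rewrite divr_gt0.
exists (Num.min d1 d2) => [|x Ix]; first by rewrite lt_min d10.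
rewrite lt_min => /andP[/(Hd1 _ Ix) h1 /(Hd2 _ Ix) h2].
have -> : a * w1 x + w2 x - (a * w1 t + w2 t) - (a * l1 + l2) * (x - t) =
  a * (w1 x - w1 t - l1 * (x - t)) + (w2 x - w2 t - l2 * (x - t)) by ring.
apply: le_trans (ler_normD _ _) _; rewrite [e in leRHS]splitr mulrDl.
apply: lerD h2; rewrite normrM.
apply: le_trans (_ : (`|a| + 1) * (e / 2 / (`|a| + 1) * `|x - t|) <= _).
  by apply: ler_pM => //; rewrite lerDl.
by rewrite le_eqVlt; apply/orP; left; apply/eqP; field; rewrite gt_eqF.
Qed.

Lemma cont01_comb w1 w2 (a : R) t : cont01 w1 t -> cont01 w2 t ->
  cont01 (fun x => a * w1 x + w2 x) t.
Proof.
move=> H1 H2 e e0; have a1 : 0 < `|a| + 1 by rewrite ltr_wpDl.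
have [|d1 d10 Hd1] := H1 (e / 2 / (`|a| + 1)); first by rewrite !divr_gt0.
have [|d2 d20 Hd2] := H2 (e / 2); first by rewrite divr_gt0.
exists (Num.min d1 d2) => [|x Ix]; first by rewrite lt_min d10.
rewrite lt_min => /andP[/(Hd1 _ Ix) h1 /(Hd2 _ Ix) h2].
have -> : a * w1 x + w2 x - (a * w1 t + w2 t) =
  a * (w1 x - w1 t) + (w2 x - w2 t) by ring.
apply: le_lt_trans (ler_normD _ _) _; rewrite [e in ltRHS]splitr.
apply: ler_ltD h2; rewrite normrM; move: h1; rewrite ltr_pdivlMr // => /ltW.
by apply: le_trans; rewrite mulrC ler_wpM2l // lerDl.
Qed.

(** * The space of continuously differentiable functions *)

Lemma C1P w : C1 w <->
  (forall t, I01 t -> has_der01 w t (derive01 w t)) /\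
  (forall t, I01 t -> cont01 (derive01 w) t).
Proof.
split=> [[H /continuous01P Hc]|[H Hc]]; split=> //.
- by move=> t It; apply/derivable01_has_der/H.
- by move=> t It; have [] := has_der01_derive It (H t It).
- exact/continuous01P.
Qed.

Lemma C1_of_der w w' : (forall t, I01 t -> has_der01 w t (w' t)) ->
  (forall t, I01 t -> cont01 w' t) -> C1 w /\ forall t, I01 t -> derive01 w t = w' t.
Proof.
move=> H Hc; have E t (It : I01 t) := has_der01_derive It (H t It).
split=> [|t It]; last exact: (E t It).2.
split=> [t It|]; first exact: (E t It).1.
apply/continuous01P => t It e /(Hc t It)[d d0 Hd]; exists d => // x Ix xt.
by rewrite (E x Ix).2 (E t It).2; apply: Hd.
Qed.

Lemma C1_comb (a : R) w1 w2 : C1 w1 -> C1 w2 ->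
  C1 (fun x => a * w1 x + w2 x) /\ forall t, I01 t ->
    derive01 (fun x => a * w1 x + w2 x) t = a * derive01 w1 t + derive01 w2 t.
Proof.
move=> /C1P[H1 C1] /C1P[H2 C2]; apply: C1_of_der => t It.
  by apply: has_der01_comb; [exact: H1|exact: H2].
by apply: cont01_comb; [exact: C1|exact: C2].
Qed.

Lemma C1_cst (a : R) : C1 (fun=> a) /\ forall t, I01 t -> derive01 (fun=> a) t = 0.
Proof.
apply: (@C1_of_der _ (fun=> 0)) => t It e e0; exists 1 => // x Ix _.
  by rewrite subrr mul0r subrr normr0 mulr_ge0 // ltW.
by rewrite subrr normr0.
Qed.

Lemma cont01_bounded g : (forall t, I01 t -> cont01 g t) ->
  exists M, forall t, I01 t -> `|g t| <= M.
Proof.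
move=> /continuous01P gc.
have /compact_bounded[M [_ HM]] := continuous_compact gc (@segment_compact R 0 1).
exists (M + 1) => t It; apply: (HM (M + 1)); first by rewrite ltrDl.
by exists t.
Qed.

Definition bounded01 g := exists M, forall t, I01 t -> `|g t| <= M.

Lemma normoo_ge g t : bounded01 g -> I01 t -> `|g t| <= normoo g.
Proof.
move=> [M HM] It; apply: ub_le_sup; last by exists t.
by exists M => _ [x Ix <-]; apply: HM.
Qed.

Lemma I01_0 : I01 (0 : R). Proof. by apply/I01P. Qed.
Lemma normoo_le g M : (forall t, I01 t -> `|g t| <= M) -> normoo g <= M.
Proof.
move=> HM; apply: ge_sup => [|_ [x Ix <-]]; last exact: HM.
by exists `|g 0|; exists 0 => //; exact: I01_0.
Qed.

Lemma normoo_ge0 g : bounded01 g -> 0 <= normoo g.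
Proof. by move=> bg; exact: le_trans (normr_ge0 _) (normoo_ge bg I01_0). Qed.

Lemma C1_bounded w : C1 w -> bounded01 w /\ bounded01 (derive01 w).
Proof.
move=> /C1P[H Hc]; split; apply: cont01_bounded => // t It.
by apply: has_der01_cont; exact: H.
Qed.

Lemma normC1_ge w t : C1 w -> I01 t ->
  `|w t| <= normC1 w /\ `|derive01 w t| <= normC1 w.
Proof.
move=> /C1_bounded[b1 b2] It; rewrite /normC1 !le_max !normoo_ge // orbT.
by split.
Qed.

Lemma normC1_le w M : (forall t, I01 t -> `|w t| <= M /\ `|derive01 w t| <= M) ->
  normC1 w <= M.
Proof.
by move=> H; rewrite /normC1 ge_max !normoo_le // => t /H[].
Qed.

(** * Mean value inequality *)

Lemma I01_between x y z : I01 x -> I01 y -> x <= z -> z <= y -> I01 z.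
Proof. by move=> /I01P[x0 x1] /I01P[y0 y1] xz zy; apply/I01P; lra. Qed.

Lemma has_der01_is_derive w t l : 0 < t < 1 -> has_der01 w t l -> is_derive t 1 w l.
Proof.
move=> /andP[t0 t1] H.
have cv : h^-1 *: ((w \o shift t) (h *: 1) - w t) @[h --> 0^'] --> l.
  apply/cvgrPdist_le => e /H[d d0 Hd].
  rewrite /dnbhs near_withinE; apply/nbhs_ballP.
  exists (Num.min d (Num.min t (1 - t))); first by rewrite /= !lt_min d0 t0 subr_gt0.
  move=> h; rewrite /ball /= sub0r normrN !lt_min => /and3P[hd ht h1] hn0.
  have Ix : I01 (h + t).
    by move: ht h1; rewrite !ltr_norml => /andP[a1 a2] /andP[b1 b2]; apply/I01P; lra.
  have := Hd _ Ix; rewrite addrK => /(_ hd); rewrite [_ *: 1]mulr1 [_ *: _]mulrC.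
  have hp : 0 < `|h| by rewrite normr_gt0.
  move=> le; rewrite -(ler_pM2r hp) -normrM -[`|_ * h|]normrN; apply: le_trans le.
  by rewrite le_eqVlt; apply/orP; left; apply/eqP; congr (`|_|); field.
by apply: DeriveDef; [apply/cvg_ex; exists l|apply: cvg_lim].
Qed.

(** Differentiability is asked in the open interval alone, so that the inequality
    reaches up to the point [t = s], where a kernel may fail to be differentiable. *)
Lemma mean_value_le g g' x y (M : R) : I01 x -> I01 y -> x <= y ->
  (forall t, I01 t -> cont01 g t) ->
  (forall t, x < t < y -> has_der01 g t (g' t) /\ `|g' t| <= M) ->
  `|g y - g x| <= M * (y - x).
Proof.
move=> Ix Iy; rewrite le_eqVlt => /orP[/eqP <- _ _|xy gc Hg].
  by rewrite !subrr normr0 mulr0.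
have [c cxy ->] : exists2 c, c \in `]x, y[ & g y - g x = g' c * (y - x).
  apply: MVT => // [t|].
    rewrite in_itv /= => txy; apply: has_der01_is_derive; last exact: (Hg t txy).1.
    move: Ix Iy => /I01P[x0 x1] /I01P[y0 y1]; move/andP: txy => [tx ty]; lra.
  apply: (@continuous_subspaceW _ _ _ I01); last exact/continuous01P.
  by move=> t /=; rewrite in_itv /= => /andP[xt ty]; apply: (I01_between Ix Iy).
rewrite normrM (@ger0_norm _ (y - x)) ?subr_ge0 ?(ltW xy) //.
rewrite ler_wpM2r ?subr_ge0 ?(ltW xy) //.
by move: cxy; rewrite in_itv /= => /Hg[].
Qed.

(** Mean value inequality for [w] minus its linear part at [t]. *)
Lemma C1_taylor w e d x t : C1 w -> I01 x -> I01 t ->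
  (forall s, I01 s -> `|s - t| < d -> `|derive01 w s - derive01 w t| <= e) ->
  `|x - t| < d -> `|w x - w t - derive01 w t * (x - t)| <= e * `|x - t|.
Proof.
move=> /C1P[H Hc] Ix It He xd; pose a := - derive01 w t.
pose g := fun s => a * s + w s.
have gd s : I01 s -> has_der01 g s (a * 1 + derive01 w s).
  move=> Is; apply: has_der01_comb; last exact: H.
  by move=> e' e'0; exists 1 => // y _ _; rewrite mul1r subrr normr0 mulr_ge0 // ltW.
have gc s : I01 s -> cont01 g s by move=> /gd /has_der01_cont.
have -> : w x - w t - derive01 w t * (x - t) = g x - g t by rewrite /g /a; ring.
have [xt|/ltW tx] := leP x t.
  rewrite distrC (distrC x t) (@ger0_norm _ (t - x)) ?subr_ge0 //.
  apply: (@mean_value_le _ (fun s => a * 1 + derive01 w s)) => // s /andP[xs st].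
  have Is := I01_between Ix It (ltW xs) (ltW st).
  split; first exact: gd.
  rewrite mulr1 addrC; apply: He => //; apply: le_lt_trans xd.
  rewrite ler0_norm ?subr_le0 ?(ltW st) // ler0_norm ?subr_le0 //; lra.
rewrite (@ger0_norm _ (x - t)) ?subr_ge0 //.
apply: (@mean_value_le _ (fun s => a * 1 + derive01 w s)) => // s /andP[ts sx].
have Is := I01_between It Ix (ltW ts) (ltW sx).
split; first exact: gd.
rewrite mulr1 addrC; apply: He => //; apply: le_lt_trans xd.
rewrite ger0_norm ?subr_ge0 ?(ltW ts) // ger0_norm ?subr_ge0 //; lra.
Qed.

End UnitInterval.

(** * Families of C^1 functions and the Ascoli theorem *)

Section C1Families.
Context {R : realType} {n : nat}.
Implicit Types (u v p : 'I_n -> R -> R) (e : R).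

Definition C1n : set ('I_n -> R -> R) := [set u | forall i, C1 (u i)].

Lemma normC1n_ge u i t : C1n u -> I01 t ->
  `|u i t| <= normC1n u /\ `|derive01 (u i) t| <= normC1n u.
Proof.
move=> uC It; have [h1 h2] := normC1_ge (uC i) It.
have le : normC1 (u i) <= normC1n u by rewrite /normC1n; apply: le_bigmax.
by split; apply: le_trans le.
Qed.

Lemma normC1n_le u M : 0 <= M -> (forall i t, I01 t ->
  `|u i t| <= M /\ `|derive01 (u i) t| <= M) -> normC1n u <= M.
Proof.
move=> M0 H; rewrite /normC1n; apply: bigmax_le => // i _.
by apply: normC1_le => t; apply: H.
Qed.

Lemma normC1n_ge0 u : 0 <= normC1n u.
Proof. by rewrite /normC1n; apply: bigmax_ge_id. Qed.

Lemma C1n_comb (a : R) u v : C1n u -> C1n v -> C1n (a *: u + v) /\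
  forall i t, I01 t -> derive01 ((a *: u + v) i) t = a * derive01 (u i) t + derive01 (v i) t.
Proof.
move=> uC vC; split=> [i|i t]; first exact: (C1_comb a (uC i) (vC i)).1.
exact: (C1_comb a (uC i) (vC i)).2.
Qed.

Lemma C1n_subspace : subspace C1n.
Proof.
split=> [i|a u v uC vC]; first exact: (C1_cst 0).1.
exact: (C1n_comb a uC vC).1.
Qed.

Lemma derive_C1nD u v i t : C1n u -> C1n v -> I01 t ->
  derive01 ((u + v) i) t = derive01 (u i) t + derive01 (v i) t.
Proof.
by move=> uC vC It; rewrite -[u in LHS]scale1r (C1n_comb 1 uC vC).2 // mul1r.
Qed.

Lemma derive_C1nZ (a : R) u i t : C1n u -> I01 t ->
  derive01 ((a *: u) i) t = a * derive01 (u i) t.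
Proof.
move=> uC It; rewrite -[a *: u]addr0 (C1n_comb a uC C1n_subspace.1).2 //.
by rewrite (C1_cst 0).2 // addr0.
Qed.

Lemma derive_C1nB u v i t : C1n u -> C1n v -> I01 t ->
  derive01 ((u - v) i) t = derive01 (u i) t - derive01 (v i) t.
Proof.
move=> uC vC It; rewrite [u - v]addrC -scaleN1r (C1n_comb (-1) vC uC).2 //.
by rewrite mulN1r addrC.
Qed.

(** Only a seminorm, and only on C^1 families: it ignores the values outside the
    unit interval. *)
Lemma normC1n_seminorm : seminorm_on C1n normC1n.
Proof.
split=> [u _|u v uC vC|a u uC]; first exact: normC1n_ge0.
  apply: normC1n_le => [|i t It]; first by rewrite addr_ge0 ?normC1n_ge0.
  rewrite derive_C1nD //; have [h1 h2] := normC1n_ge i uC It.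
  have [h3 h4] := normC1n_ge i vC It.
  by split; apply: le_trans (ler_normD _ _) _; apply: lerD.
have le (b : R) v : C1n v -> normC1n (b *: v) <= `|b| * normC1n v.
  move=> vC; apply: normC1n_le => [|i t It]; first by rewrite mulr_ge0 ?normC1n_ge0.
  rewrite derive_C1nZ // !normrM; have [h1 h2] := normC1n_ge i vC It.
  by split; apply: ler_wpM2l.
apply/eqP; rewrite eq_le le //=; have [->|a0] := eqVneq a 0.
  by rewrite normr0 mul0r normC1n_ge0.
have auC : C1n (a *: u) by apply: (subspaceZ C1n_subspace).
have := le a^-1 _ auC; rewrite scalerA mulVf // scale1r normfV.
by rewrite -ler_pdivlMl ?normr_gt0 // invrK.
Qed.

Definition equibounded (A : set ('I_n -> R -> R)) :=
  exists B, forall u i t, A u -> I01 t -> `|u i t| <= B /\ `|derive01 (u i) t| <= B.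

Definition equiderivative (A : set ('I_n -> R -> R)) :=
  forall e, 0 < e -> exists2 d, 0 < d & forall u i x y, A u -> I01 x -> I01 y ->
    `|x - y| < d -> `|derive01 (u i) x - derive01 (u i) y| <= e.

Let idx : eqType := ('I_n * bool * R)%type.

(** Values and derivatives as one function; it is zero outside the unit interval
    in order to be bounded everywhere, as Tychonoff's theorem requires. *)
Definition jetfun u : idx -> R := fun q =>
  if `[< I01 q.2 >] then (if q.1.2 then derive01 (u q.1.1) else u q.1.1) q.2 else 0.

Lemma jetfunE u i (b : bool) t : I01 t ->
  jetfun u (i, b, t) = if b then derive01 (u i) t else u i t.
Proof. by move=> It; rewrite /jetfun /= asboolT //; case: b. Qed.

(** Tychonoff's theorem; the product topology gives closeness at finitely many
    indices at a time. *)
Lemma pointwise_cluster (z : nat -> idx -> R) (B : R) :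
  (forall k q, `|z k q| <= B) ->
  exists g : idx -> R, forall (s : seq idx) e k0, 0 < e ->
    exists2 k, (k0 <= k)%N & forall q, q \in s -> `|z k q - g q| < e.
Proof.
move=> zB.
have := @tychonoff idx (fun=> R) (fun=> `[- B, B]%classic) (fun=> @segment_compact R _ _).
move=> /(_ (z @ \oo) _)[].
  by exists 0%N => // k _ q /=; rewrite in_itv /= -ler_norml.
move=> g [_ clg]; exists g => s e k0 e0.
pose U : set (prod_topology (fun=> R : topologicalType)) :=
  [set f | forall q, q \in s -> `|f q - g q| < e].
have Uq q : nbhs (g : prod_topology (fun=> R : topologicalType)) (proj q @^-1` ball (g q) e).
  exact: (@proj_continuous idx (fun=> R : topologicalType) q g _ (nbhsx_ballx _ _ e0)).
have FF : Filter (nbhs (g : prod_topology (fun=> R : topologicalType))).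
  exact: (@nbhs_filter (prod_topology (fun=> R : topologicalType))).
have Ug : nbhs (g : prod_topology (fun=> R : topologicalType)) U.
  rewrite /U; elim: s {U} => [|q s IH]; first exact: (@filterE _ _ FF).
  refine (@filterS _ _ FF _ _ _ (@filterI _ _ FF _ _ (Uq q) IH)) => f [h1 h2] r.
  by rewrite inE => /orP[/eqP ->|/h2 //]; rewrite distrC.
have [_ [[k kk <-] Uk]] := clg (z @` [set k | (k0 <= k)%N]) U
  (ex_intro2 _ _ k0 Logic.I (fun k hk => ex_intro2 _ _ k hk erefl)) Ug.
by exists k.
Qed.

(** By Taylor's formula the common modulus of continuity of the derivatives gives
    inequalities between values at two points which persist for pointwise limits.
    They show that the limit of the derivatives is the derivative of the limit,
    and that closeness on a finite grid implies closeness in the C^1 norm. *)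
Theorem C1n_ascoli (A : set ('I_n -> R -> R)) : A `<=` C1n -> equibounded A ->
  equiderivative A -> seq_precompact normC1n A C1n.
Proof.
move=> AC [B AB] mod z zA.
have zB k q : `|jetfun (z k) q| <= Num.max B 0.
  rewrite le_max; case: q => [[i b] t]; rewrite /jetfun /=.
  case: asboolP => It; last by rewrite normr0 lexx orbT.
  by have [h1 h2] := AB _ i _ (zA k) It; case: b; rewrite ?h1 ?h2.
have [g gP] := pointwise_cluster zB.
pose p i t := g (i, false, t); pose p' i t := g (i, true, t).
have clos i t e : 0 < e -> I01 t -> forall x, I01 x -> forall k0, exists2 k, (k0 <= k)%N &
    [/\ `|z k i t - p i t| < e, `|z k i x - p i x| < e,
        `|derive01 (z k i) t - p' i t| < e & `|derive01 (z k i) x - p' i x| < e].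
  move=> e0 It x Ix k0.
  have [k kk Hk] := gP [:: (i, false, t); (i, false, x); (i, true, t); (i, true, x)] e k0 e0.
  exists k => //; split.
  - by have := Hk (i, false, t); rewrite jetfunE //; apply; rewrite !inE eqxx ?orbT.
  - by have := Hk (i, false, x); rewrite jetfunE //; apply; rewrite !inE eqxx ?orbT.
  - by have := Hk (i, true, t); rewrite jetfunE //; apply; rewrite !inE eqxx ?orbT.
  - by have := Hk (i, true, x); rewrite jetfunE //; apply; rewrite !inE eqxx ?orbT.
have modp e : 0 < e -> exists2 d, 0 < d & forall i x t, I01 x -> I01 t -> `|x - t| < d ->
   [/\ `|p' i x - p' i t| <= e, `|p i x - p i t - p' i t * (x - t)| <= e * `|x - t| &
     forall k, `|z k i x - z k i t - derive01 (z k i) t * (x - t)| <= e * `|x - t| /\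
       `|derive01 (z k i) x - derive01 (z k i) t| <= e].
  move=> e0; have [d d0 Hd] := mod e e0; exists d => // i x t Ix It xt.
  have zk k : `|z k i x - z k i t - derive01 (z k i) t * (x - t)| <= e * `|x - t| /\
       `|derive01 (z k i) x - derive01 (z k i) t| <= e.
    split; last exact: Hd.
    apply: (@C1_taylor _ _ _ d) => //; first exact: AC.
    by move=> s Is st; apply: Hd.
  split=> //.
    apply/ler_addgt0Pr => r r0; have r2 : 0 < r / 2 by rewrite divr_gt0.
    have [k _ [_ _ h3 h4]] := clos i t _ r2 It _ Ix 0%N; have [_ h] := zk k.
    move: h3 h4 h; rewrite !ltr_norml !ler_norml => /andP[? ?] /andP[? ?] /andP[? ?].
    apply/andP; split; lra.
  apply/ler_addgt0Pr => r r0; have r3 : 0 < r / 3 by rewrite divr_gt0.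
  have [k _ [h1 h2 h3 _]] := clos i t _ r3 It _ Ix 0%N; have [h _] := zk k.
  have xt1 : `|x - t| <= 1.
    by move: Ix It => /I01P[? ?] /I01P[? ?]; rewrite ler_norml; apply/andP; split; lra.
  have h5 : `|(derive01 (z k i) t - p' i t) * (x - t)| <= r / 3.
    by rewrite normrM -[leRHS]mulr1; apply: ler_pM => //; exact: ltW.
  have -> : p i x - p i t - p' i t * (x - t) =
     (z k i x - z k i t - derive01 (z k i) t * (x - t)) - (z k i x - p i x)
       + (z k i t - p i t) + (derive01 (z k i) t - p' i t) * (x - t) by ring.
  move: h h1 h2 h5; set E := e * _; rewrite !ltr_norml !ler_norml.
  move=> /andP[? ?] /andP[? ?] /andP[? ?] /andP[? ?]; apply/andP; split; lra.
have pd i : C1 (p i) /\ forall t, I01 t -> derive01 (p i) t = p' i t.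
  apply: C1_of_der => t It e e0.
    have [d d0 Hd] := modp e e0; exists d => // x Ix xt.
    by have [] := Hd i x t Ix It xt.
  have [|d d0 Hd] := modp (e / 2); first by rewrite divr_gt0.
  exists d => // x Ix xt; have [h _ _] := Hd i x t Ix It xt.
  by apply: le_lt_trans h _; rewrite ltr_pdivrMr // ltr_pMr // ltr1n.
have pC : C1n p by move=> i; exact: (pd i).1.
exists p => // e e0 k0; pose e6 := e / 6.
have e60 : 0 < e6 by rewrite divr_gt0.
have [d d0 Hd] := modp _ e60.
have [m Hm] := invn_lt d0; have M0 : 0 < m.+1%:R :> R by rewrite ltr0n.
pose gr j : R := j%:R / m.+1%:R.
have Igr j : (j <= m.+1)%N -> I01 (gr j).
  by move=> jm; apply/I01P; rewrite divr_ge0 // ler_pdivrMr // mul1r ler_nat.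
have near_gr t : I01 t -> exists2 j, (j <= m.+1)%N & `|t - gr j| < d.
  move=> /I01P[t0 t1]; exists (Num.trunc (t * m.+1%:R)).
    rewrite -(ler_nat R); apply: (@le_trans _ _ (t * m.+1%:R)).
      by rewrite truncn_le mulr_ge0.
    by rewrite ler_piMl.
  have tm0 : 0 <= t * m.+1%:R by rewrite mulr_ge0.
  apply: lt_le_trans (ltW (Hm m (leqnn m))).
  have -> : t - gr (Num.trunc (t * m.+1%:R)) = (t * m.+1%:R - (Num.trunc (t * m.+1%:R))%:R) / m.+1%:R.
    by rewrite /gr; field; rewrite gt_eqF.
  have /andP[h1 h2] := truncn_itv tm0.
  rewrite ger0_norm ?divr_ge0 ?subr_ge0 // ltr_pdivrMr // mulVf ?gt_eqF //.
  by rewrite ltrBlDl natr1.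
have [k kk Hk] := gP [seq (q.1, q.2, gr (val j)) | q <- enum [set: 'I_n * bool], j <- enum 'I_m.+2] e6 k0 e60.
exists k => //.
have zkC : C1n (z k) by apply: AC.
apply: le_lt_trans (_ : 5 / 6 * e < e); last lra.
apply: normC1n_le => [|i t It]; first lra.
rewrite derive_C1nB // (pd i).2 // -[(z k - p) i t]/(z k i t - p i t).
have [j jm tj] := near_gr t It.
have jin b : (i, b, gr j) \in [seq (q.1, q.2, gr (val j)) | q <- enum [set: 'I_n * bool], j <- enum 'I_m.+2].
  apply/allpairsP; exists ((i, b), Ordinal (jm : (j < m.+2)%N)); split=> //.
  - by rewrite mem_enum inE.
  - by rewrite mem_enum.
have := Hk _ (jin false); rewrite jetfunE; last exact: Igr.
have := Hk _ (jin true); rewrite jetfunE; last exact: Igr.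
rewrite -/(p i (gr j)) -/(p' i (gr j)).
have [a1 a2 /(_ k)[a3 a4]] := Hd i t (gr j) It (Igr j jm) tj.
have tj1 : `|t - gr j| <= 1.
  by have := Igr j jm; move: It => /I01P[? ?] /I01P[? ?]; rewrite ler_norml; apply/andP; split; lra.
move=> h1 h2.
have a5 : e6 * `|t - gr j| <= e6 by rewrite ler_piMr // ltW.
have a6 : `|(derive01 (z k i) (gr j) - p' i (gr j)) * (t - gr j)| <= e6.
  by rewrite normrM -[leRHS]mulr1; apply: ler_pM => //; exact: ltW.
have {}a2 := le_trans a2 a5; have {}a3 := le_trans a3 a5.
have E : z k i t - p i t = (z k i t - z k i (gr j) - derive01 (z k i) (gr j) * (t - gr j))
   - (p i t - p i (gr j) - p' i (gr j) * (t - gr j)) + (z k i (gr j) - p i (gr j))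
   + (derive01 (z k i) (gr j) - p' i (gr j)) * (t - gr j) by ring.
rewrite E; have ee : e = 6 * e6 by rewrite /e6; field.
rewrite ee; move: a1 a2 a3 a4 a6 h1 h2; clear E ee a5.
move: (z k i t - z k i (gr j) - derive01 (z k i) (gr j) * (t - gr j)) => X1.
move: (p i t - p i (gr j) - p' i (gr j) * (t - gr j)) => X2.
move: ((derive01 (z k i) (gr j) - p' i (gr j)) * (t - gr j)) => X3.
rewrite !ltr_norml !ler_norml.
move=> /andP[? ?] /andP[? ?] /andP[? ?] /andP[? ?] /andP[? ?] /andP[? ?] /andP[? ?].
split; apply/andP; split; lra.
Qed.

End C1Families.

(** * Integrals and dominated convergence *)

Section RealIntegrals.
Context d (T : measurableType d) (R : realType).
Variables (mu : {measure set T -> \bar R}) (D : set T).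
Hypothesis mD : measurable D.
Implicit Types f g Phi : T -> R.

Local Notation integ g := (mu.-integrable D (EFin \o g)).
Local Notation mfun g := (measurable_fun D g).
Local Notation Int g := (\int[mu]_(s in D) g s).

Lemma integrable_mfun g : integ g -> mfun g.
Proof. by move=> /measurable_int /measurable_EFinP. Qed.

Lemma integrable_dominated f Phi : mfun f -> integ Phi ->
  {ae mu, forall s, D s -> `|f s| <= Phi s} -> integ f.
Proof.
move=> mf /integrableP[mP iP] le; apply/integrableP; split; first exact/measurable_EFinP.
apply: le_lt_trans iP; apply: ae_ge0_le_integral => //.
- by apply: measurableT_comp => //; apply/measurable_EFinP.
- exact: measurableT_comp.
by apply: filterS le => s H Ds; rewrite /= lee_fin (le_trans (H Ds)) // ler_norm.
Qed.

Lemma le_Rintegral_ae f g : integ f -> integ g ->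
  {ae mu, forall s, D s -> f s <= g s} -> Int f <= Int g.
Proof.
move=> inf ing le; pose h s := Num.min (f s) (g s).
have mh : mfun h by apply: measurable_minr; exact: integrable_mfun.
have inh : integ h.
  apply: (@integrable_dominated _ (fun s => `|f s| + `|g s|)) => //.
    apply: (@eq_integrable _ _ _ mu D mD (fun s => `|(f s)%:E| + `|(g s)%:E|)%E) => //.
    by apply: integrableD => //; exact: integrable_abse.
  apply: aeW => s _; rewrite /h /Num.min; case: ltP => _; first by rewrite lerDl.
  by rewrite lerDr.
have -> : Int f = Int h.
  congr fine; apply: ae_eq_integral => //.
  - exact: measurable_int inf.
  - exact/measurable_EFinP.
  by apply: filterS le => s H Ds; rewrite /= /h min_l // H.
by apply: le_Rintegral => // s _; rewrite /h ge_min lexx orbT.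
Qed.

Lemma integrable_norm g : integ g -> integ (fun s => `|g s|).
Proof. by move=> /integrable_abse. Qed.

Lemma integrable_mul_bounded k g B : integ k -> mfun g ->
  (forall s, D s -> `|g s| <= B) -> integ (fun s => k s * g s).
Proof.
move=> ik mg gB; apply: (@integrable_dominated _ (fun s => B * `|k s|)).
- by apply: measurable_funM => //; exact: integrable_mfun.
- apply: (@eq_integrable _ _ _ mu D mD (fun s => B%:E * `|(k s)%:E|)%E) => //.
  by apply: integrableZl => //; exact: integrable_abse.
- by apply: aeW => s Ds; rewrite normrM mulrC ler_wpM2r // gB.
Qed.

Lemma Rintegral_mul_le k g B : integ k -> mfun g ->
  (forall s, D s -> `|g s| <= B) ->
  `|Int (fun s => k s * g s)| <= B * Int (fun s => `|k s|).
Proof.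
move=> ik mg gB; have ikg := integrable_mul_bounded ik mg gB.
apply: le_trans (le_normr_Rintegral mD ikg) _.
rewrite -RintegralZl //; last exact: integrable_norm.
apply: le_Rintegral => //; first exact: integrable_norm.
  have := integrableZl mD B (integrable_norm ik).
  by apply: eq_integrable.
by move=> s Ds; rewrite normrM mulrC ler_wpM2r // gB.
Qed.

Lemma Rintegral_dct (phi : nat -> T -> R) Phi : (forall m, mfun (phi m)) ->
  integ Phi -> (forall m, {ae mu, forall s, D s -> `|phi m s| <= Phi s}) ->
  {ae mu, forall s, D s -> phi ^~ s @ \oo --> (0 : R)} ->
  Int (fun s => `|phi m s|) @[m --> \oo] --> (0 : R).
Proof.
move=> mphi iPhi /ae_foralln le cv.
have [|||||_ H _] := @dominated_convergence _ _ _ mu D mD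
  (fun m s => (phi m s)%:E) (cst 0%E) (EFin \o Phi) => //.
- by move=> m; apply/measurable_EFinP.
- by apply: filterS cv => s H Ds; apply: cvg_EFin (H Ds); near=> m.
move/fine_cvgP: H => [_ H].
rewrite (_ : (fun m => _) = fine \o (fun m => \int[mu]_(s in D) `|(phi m s)%:E - cst 0%E s|)%E) //.
apply/funext => m /=; congr fine; apply: eq_integral => s _.
by rewrite subr0.
Unshelve. all: by end_near. Qed.

(** Were this false, there would be a sequence of parameters contradicting
    dominated convergence. *)
Lemma Rintegral_param_dct (A : set R) (phi : R -> T -> R) Phi t0 :
  (forall t, A t -> mfun (phi t)) -> integ Phi ->
  (forall t, A t -> {ae mu, forall s, D s -> `|phi t s| <= Phi s}) ->
  {ae mu, forall s, D s -> forall e, 0 < e -> exists2 dl, 0 < dl &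
     forall t, A t -> `|t - t0| < dl -> `|phi t s| <= e} ->
  forall e, 0 < e -> exists2 dl, 0 < dl &
     forall t, A t -> `|t - t0| < dl -> Int (fun s => `|phi t s|) < e.
Proof.
move=> mphi iPhi le cv e e0; apply: contrapT => no.
have ex m : exists t, [/\ A t, `|t - t0| < m.+1%:R^-1 & e <= Int (fun s => `|phi t s|)].
  apply: contrapT => /forallNP H; apply: no; exists m.+1%:R^-1; first by rewrite invr_gt0.
  by move=> t At tt; rewrite ltNge; apply/negP => le'; apply: (H t).
have [t tP] := choice ex.
have /cvgrPdist_lt/(_ e e0) : Int (fun s => `|phi (t m) s|) @[m --> \oo] --> (0 : R).
  apply: (@Rintegral_dct _ Phi) => //.
  - by move=> m; apply: mphi; have [] := tP m.
  - by move=> m; apply: le; have [] := tP m.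
  apply: filterS cv => s H Ds; apply/cvgrPdist_le => r r0.
  have [dl dl0 Hdl] := H Ds r r0; have [k0 Hk0] := invn_lt dl0.
  exists k0 => // m /= km; rewrite sub0r normrN; have [At tt _] := tP m.
  by apply: Hdl => //; apply: lt_trans tt (Hk0 _ km).
case=> m _ /(_ m (leqnn m)); rewrite sub0r normrN ger0_norm; last exact: Rintegral_ge0.
by rewrite ltNge; have [_ _ ->] := tP m.
Qed.

End RealIntegrals.

(** * Integral operators depending on a parameter *)

(** Heine's theorem for a pseudo-distance [q] on a compact set. *)
Lemma pseudodist_uniform (R : realType) (X : pseudoMetricType R) (A : set X)
    (q : X -> X -> R) : compact A ->
  (forall x y z, A x -> A y -> A z -> q x z <= q x y + q y z) ->
  (forall x y, A x -> A y -> q x y = q y x) ->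
  (forall t, A t -> forall e, 0 < e -> exists2 dl, 0 < dl &
     forall x, A x -> ball t dl x -> q x t < e) ->
  forall e, 0 < e -> exists2 dl, 0 < dl &
     forall x y, A x -> A y -> ball x dl y -> q x y < e.
Proof.
move=> /compact_near_coveringP cA qT qS qc e e0; have e2 : 0 < e / 2 by rewrite divr_gt0.
have [|r /= r0 Hr] := cA R (0 : R)^'+
  (fun dl t => forall y, A t -> A y -> ball t dl y -> q t y < e) _.
  move=> t At; have [dl dl0 Hdl] := qc t At _ e2.
  have dl2 : 0 < dl / 2 by rewrite divr_gt0.
  exists (ball t (dl / 2), [set r | 0 < r < dl / 2]).
    split; first exact: nbhsx_ballx.
    have : \forall r \near (0 : R)^'+, 0 < r < dl / 2.
      near=> r; apply/andP; split; near: r; [exact: nbhs_right_gt|exact: nbhs_right_lt].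
    by [].
  move=> [x r] [/= bx /andP[r0 rd]] y Ax Ay xy.
  have h1 : q x t < e / 2.
    apply: Hdl => //; apply: le_ball bx.
    by rewrite ler_pdivrMr // ler_peMr ?ler1n // ltW.
  have h2 : q y t < e / 2.
    apply: Hdl => //; rewrite [dl]splitr; apply: ball_triangle bx _.
    by apply: le_ball xy; exact: ltW.
  have := qT x t y Ax At Ay; rewrite (qS t y) //; lra.
have r2 : 0 < r / 2 by rewrite divr_gt0.
exists (r / 2) => // x y Ax Ay xy; apply: (Hr (r / 2)) => //.
by rewrite /= sub0r normrN gtr0_norm //; lra.
Unshelve. all: by end_near. Qed.

Section KernelOperator.
Context d (T : measurableType d) (R : realType).
Variables (mu : {measure set T -> \bar R}) (D : set T).
Hypothesis mD : measurable D.

Local Notation integ g := (mu.-integrable D (EFin \o g)).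
Local Notation mfun g := (measurable_fun D g).
Local Notation Int g := (\int[mu]_(s in D) g s).
Implicit Types g : T -> R.

Definition kint (k : R -> T -> R) g (t : R) : R := Int (fun s => k t s * g s).

Variables (k dk : R -> T -> R) (Phi0 Phi1 : T -> R).
Hypotheses
  (mk : forall t, I01 t -> mfun (k t))
  (mdk : forall t, I01 t -> mfun (dk t))
  (iPhi0 : integ Phi0) (iPhi1 : integ Phi1)
  (kle : forall t, I01 t -> {ae mu, forall s, D s -> `|k t s| <= Phi0 s})
  (dkle : forall t, I01 t -> {ae mu, forall s, D s -> `|dk t s| <= Phi1 s})
  (klip : forall t t0, I01 t -> I01 t0 ->
     {ae mu, forall s, D s -> `|k t s - k t0 s| <= Phi1 s * `|t - t0|})
  (kder : forall t, I01 t -> {ae mu, forall s, D s -> has_der01 (k ^~ s) t (dk t s)})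
  (dkcont : forall t, I01 t -> {ae mu, forall s, D s -> cont01 (dk ^~ s) t}).

Lemma integrable_k t : I01 t -> integ (k t).
Proof. by move=> It; apply: integrable_dominated iPhi0 (kle It) => //; exact: mk. Qed.

Lemma integrable_dk t : I01 t -> integ (dk t).
Proof. by move=> It; apply: integrable_dominated iPhi1 (dkle It) => //; exact: mdk. Qed.

Lemma integrableBr f g : integ f -> integ g -> integ (fun s => f s - g s).
Proof. by move=> inf ing; have := integrableB mD inf ing; apply: eq_integrable. Qed.

Lemma integrableZr (a : R) f : integ f -> integ (fun s => a * f s).
Proof. by move=> inf; have := integrableZl mD a inf; apply: eq_integrable. Qed.

Lemma Int_k_le t : I01 t -> Int (fun s => `|k t s|) <= Int Phi0.
Proof.
move=> It; apply: le_Rintegral_ae => //; last exact: kle.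
exact/integrable_norm/integrable_k.
Qed.

Lemma Int_dk_le t : I01 t -> Int (fun s => `|dk t s|) <= Int Phi1.
Proof.
move=> It; apply: le_Rintegral_ae => //; last exact: dkle.
exact/integrable_norm/integrable_dk.
Qed.

Lemma kintB (k1 : R -> T -> R) g1 g2 B1 B2 t : integ (k1 t) -> mfun g1 -> mfun g2 ->
  (forall s, D s -> `|g1 s| <= B1) -> (forall s, D s -> `|g2 s| <= B2) ->
  kint k1 (fun s => g1 s - g2 s) t = kint k1 g1 t - kint k1 g2 t.
Proof.
move=> ik m1 m2 b1 b2; rewrite /kint -RintegralB //.
- by apply: eq_Rintegral => s _; rewrite mulrBr.
- exact: integrable_mul_bounded b1.
- exact: integrable_mul_bounded b2.
Qed.

Section Source.
Variables (g : T -> R) (B : R).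
Hypotheses (mg : mfun g) (gB : forall s, D s -> `|g s| <= B).

Hypothesis B0 : 0 <= B.

(** Differentiation under the integral sign: the error quotients are dominated
    by twice [Phi1] and tend to zero almost everywhere. *)
Lemma kint_has_der t0 : I01 t0 -> has_der01 (kint k g) t0 (kint dk g t0).
Proof.
move=> It0 e e0.
pose phi t s := if t == t0 then 0 else (t - t0)^-1 * (k t s - k t0 s) - dk t0 s.
have mphi t : I01 t -> mfun (phi t).
  move=> It; rewrite /phi; case: eqP => _; first exact: measurable_cst.
  apply: measurable_funB; last exact: mdk.
  by apply: measurable_funM => //; apply: measurable_funB; exact: mk.
have i2 : integ (fun s => 2 * Phi1 s) by apply: integrableZr.
have le2 t : I01 t -> {ae mu, forall s, D s -> `|phi t s| <= 2 * Phi1 s}.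
  move=> It; apply: filterS2 (klip It It0) (dkle It0) => s h1 h2 Ds.
  have {}h1 := h1 Ds; have {}h2 := h2 Ds; have P0 := le_trans (normr_ge0 _) h2.
  rewrite /phi; case: eqP => [_|/eqP tt]; first by rewrite normr0 mulr_ge0.
  have n0 : 0 < `|t - t0| by rewrite normr_gt0 subr_eq0.
  have h3 : `|(t - t0)^-1 * (k t s - k t0 s)| <= Phi1 s.
    by rewrite normrM normfV mulrC ler_pdivrMr.
  apply: le_trans (ler_normB _ _) _; lra.
have cv : {ae mu, forall s, D s -> forall e, 0 < e -> exists2 dl, 0 < dl &
     forall t, I01 t -> `|t - t0| < dl -> `|phi t s| <= e}.
  apply: filterS (kder It0) => s H Ds r r0; have [dl dl0 Hdl] := H Ds r r0.
  exists dl => // t It tt; rewrite /phi; case: eqP => [_|/eqP n]; first by rewrite normr0 ltW.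
  have n0 : 0 < `|t - t0| by rewrite normr_gt0 subr_eq0.
  rewrite -(ler_pM2r n0) -normrM; apply: le_trans (Hdl t It tt).
  rewrite le_eqVlt; apply/orP; left; apply/eqP; congr (`|_|).
  by field; rewrite subr_eq0.
have eB : 0 < e / (B + 1) by rewrite divr_gt0 // ltr_wpDl.
have [dl dl0 Hdl] := Rintegral_param_dct mD mphi i2 le2 cv eB.
exists dl => // t It tt.
have [->|n] := eqVneq t t0; first by rewrite !subrr mulr0 subrr normr0 mulr0.
have n0 : 0 < `|t - t0| by rewrite normr_gt0 subr_eq0.
have ik := integrable_mul_bounded mD (integrable_k It) mg gB.
have ik0 := integrable_mul_bounded mD (integrable_k It0) mg gB.
have idk := integrable_mul_bounded mD (integrable_dk It0) mg gB.
have iphi := integrable_dominated mD (mphi t It) i2 (le2 t It).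
have -> : kint k g t - kint k g t0 - kint dk g t0 * (t - t0) =
   (t - t0) * Int (fun s => phi t s * g s).
  have E1 : kint k g t - kint k g t0 = Int (fun s => k t s * g s - k t0 s * g s).
    by rewrite RintegralB.
  have E2 : kint dk g t0 * (t - t0) = Int (fun s => (t - t0) * (dk t0 s * g s)).
    by rewrite RintegralZl // mulrC.
  rewrite E1 E2 -RintegralB //; [|exact: integrableBr|exact: integrableZr].
  rewrite -RintegralZl //; last exact: (integrable_mul_bounded mD iphi mg gB).
  apply: eq_Rintegral => s _; rewrite /phi (negbTE n); field.
  by rewrite subr_eq0.
rewrite normrM mulrC ler_pM2r //.
apply: le_trans (Rintegral_mul_le mD iphi mg gB) _.
have := Hdl t It tt; set X := Rintegral _ _ _; rewrite ltr_pdivlMr ?ltr_wpDl // => /ltW h.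
have X0 : 0 <= X by apply: Rintegral_ge0.
nra.
Qed.

Lemma kint_dk_lip x y : I01 x -> I01 y ->
  `|kint dk g x - kint dk g y| <= B * Int (fun s => `|dk x s - dk y s|).
Proof.
move=> Ix Iy; have ix := integrable_mul_bounded mD (integrable_dk Ix) mg gB.
have iy := integrable_mul_bounded mD (integrable_dk Iy) mg gB.
rewrite /kint -RintegralB //.
under eq_Rintegral do rewrite -mulrBl.
apply: (@Rintegral_mul_le _ _ _ mu D mD (fun s => dk x s - dk y s)) => //.
by apply: integrableBr; exact: integrable_dk.
Qed.

End Source.

(** At a fixed time this is dominated convergence; compactness makes it uniform. *)
Lemma dk_modulus e : 0 < e -> exists2 dl, 0 < dl & forall x y, I01 x -> I01 y ->
  `|x - y| < dl -> Int (fun s => `|dk x s - dk y s|) < e.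
Proof.
have iB x y : I01 x -> I01 y -> integ (fun s => dk x s - dk y s).
  by move=> Ix Iy; apply: integrableBr; exact: integrable_dk.
apply: (@pseudodist_uniform R R I01) => [|x y z Ix Iy Iz|x y Ix Iy|t It].
- exact: segment_compact.
- rewrite -RintegralD //; try by apply/integrable_norm/iB.
  apply: le_Rintegral => //; first exact/integrable_norm/iB.
    have := integrableD mD (integrable_norm (iB x y Ix Iy)) (integrable_norm (iB y z Iy Iz)).
    by apply: eq_integrable.
  by move=> s _; apply: le_trans (ler_normD _ _); rewrite subrKA.
- by apply: eq_Rintegral => s _; rewrite distrC.
suff H e1 : 0 < e1 -> exists2 dl, 0 < dl & forall x, I01 x -> `|x - t| < dl ->
    Int (fun s => `|dk x s - dk t s|) < e1.
  move=> e1 /H[dl dl0 Hdl]; exists dl => // x Ix; rewrite /ball /= distrC.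
  exact: Hdl.
move: e1; apply: (@Rintegral_param_dct _ _ _ mu D mD I01 (fun x s => dk x s - dk t s)
  (fun s => 2 * Phi1 s)) => //.
- by move=> x Ix; apply: measurable_funB; exact: mdk.
- exact: integrableZr.
- move=> x Ix; apply: filterS2 (dkle Ix) (dkle It) => s h1 h2 Ds.
  by apply: le_trans (ler_normB _ _) _; have := h1 Ds; have := h2 Ds; lra.
- apply: filterS (dkcont It) => s H Ds r r0; have [dl dl0 Hdl] := H Ds r r0.
  by exists dl => // x Ix xt; apply/ltW/Hdl.
Qed.

End KernelOperator.

(** * Kernels with a jump of the derivative on the diagonal *)

Section LebesgueInterval.
Context {R : realType}.
Implicit Types (k : R -> R -> R) (Phi g : R -> R) (a b t : R).

Local Notation LT := (caratheodory_type (R := R) (wlength idfun)^*%mu).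

#[global] Instance leb_ae_filter : Filter (nbhs (almost_everywhere (@leb R))).
Proof. exact: ae_filter_ringOfSetsType. Qed.

Lemma leb_measurable_borel (A : set R) : measurable A -> measurable (A : set LT).
Proof. exact: sub_caratheodory. Qed.

Lemma leb_measurable_itv (i : interval R) : measurable ([set` i] : set LT).
Proof. by apply: leb_measurable_borel; exact: measurable_itv. Qed.

Lemma leb_measurable_I01 : measurable (I01 : set LT).
Proof. exact: leb_measurable_itv. Qed.

Lemma cont01_measurable g : (forall t, I01 t -> cont01 g t) -> lebesgue_measurable g.
Proof.
move=> /continuous01P gc _ Y mY; apply: leb_measurable_borel.
by apply: (subspace_continuous_measurable_fun _ gc) => //; exact: measurable_itv.
Qed.

Lemma leb_set1 t : leb [set t] = 0%E.
Proof.
have := lebesgue_measure_set1 t; rewrite /lebesgue_measure /=.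
rewrite /lebesgue_stieltjes_measure /completed_lebesgue_measure /=.
rewrite /completed_lebesgue_stieltjes_measure /completed_measure_extension.
by rewrite /measure_extension.
Qed.

Lemma ae_neq t : {ae leb, forall s, I01 s -> s != t}.
Proof.
exists [set t]; split; [|exact: leb_set1|].
  rewrite -set_itv1; exact: leb_measurable_itv.
by move=> s /= H; apply: contrapT => st; apply: H => _; apply/eqP.
Qed.

Lemma kernel_has_der k Phi t : kernel_derivative k Phi -> I01 t ->
  {ae leb, forall s, I01 s -> has_der01 (k ^~ s) t (dkernel k t s)}.
Proof.
move=> [H _ _ _ _] It; apply: filterS (ae_neq t) => s st Is.
apply: derivable01_has_der; apply: (H s Is t It _).1.
by rewrite eq_sym; apply: st.
Qed.

Lemma dkernel_cont k Phi t : kernel_derivative k Phi -> I01 t ->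
  {ae leb, forall s, I01 s -> cont01 (dkernel k ^~ s) t}.
Proof.
move=> [H _ _ _ _] It; apply: filterS (ae_neq t) => s st Is.
apply/cvg01P; apply: (H s Is t It _).2.
by rewrite eq_sym; apply: st.
Qed.

Lemma rat_dense_I01 t e : I01 t -> 0 < e -> exists q : rat, I01 (ratr q : R) /\ `|ratr q - t| < e.
Proof.
move=> /I01P[t0 t1] e0.
have lt : Num.max 0 (t - e) < Num.min 1 (t + e).
  by rewrite gt_max !lt_min ltr01; apply/andP; split; apply/andP; split; lra.
have [q] := rat_in_itvoo lt; rewrite in_itv /= gt_max lt_min => /andP[/andP[q0 qe] /andP[q1 qe2]].
exists q; split; first by apply/I01P; split; exact: ltW.
by rewrite ltr_norml; apply/andP; split; lra.
Qed.

(** The bound on the derivative holds almost everywhere for each time; it is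
    made uniform in time by passing through the rationals. *)
Lemma dkernel_le_uniform k Phi : kernel_derivative k Phi ->
  {ae leb, forall s, I01 s -> forall t, I01 t -> t != s -> `|dkernel k t s| <= Phi s}.
Proof.
move=> [H _ _ _ le].
have : {ae leb, forall s, forall m, if unpickle m is Some q then
    I01 (ratr q : R) -> I01 s -> `|dkernel k (ratr q) s| <= Phi s else True}.
  apply: ae_foralln => m; case: (unpickle m) => [q|]; last exact: aeW.
  have [Iq|Iq] := pselect (I01 (ratr q : R)); last by apply: aeW => s /Iq.
  by apply: filterS (le _ Iq) => s h _ Is; apply: h.
apply: filterS => s Hs Is t It ts.
have [_ /cvg01P Hc] := H s Is t It ts.
apply/ler_addgt0Pr => e e0; have [d d0 Hd] := Hc e e0.
have [q [Iq qt]] := rat_dense_I01 It d0.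
have := Hs (pickle q); rewrite pickleK => /(_ Iq Is) h1.
have := Hd _ Iq qt; rewrite distrC => h2.
have := ler_normD (dkernel k t s - dkernel k (ratr q) s) (dkernel k (ratr q) s).
by rewrite subrK; lra.
Qed.

(** The mean value inequality is applied on both sides of the jump [t = s] of the
    derivative; [k] itself is continuous there for almost every [s]. *)
Lemma kernel_lipschitz k Phi t t0 : kernel_continuous k -> kernel_derivative k Phi ->
  I01 t -> I01 t0 ->
  {ae leb, forall s, I01 s -> `|k t s - k t0 s| <= Phi s * `|t - t0|}.
Proof.
move=> [_ kc] kd.
wlog tt : t t0 / t0 <= t.
  move=> W It It0; have [le|/ltW le] := leP t0 t; first exact: W.
  by apply: filterS (W _ _ le It0 It) => s h Is; rewrite distrC (distrC t); apply: h.
move=> It It0; apply: filterS2 kc (dkernel_le_uniform kd) => s h1 h2 Is.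
have {h1}/continuous01P kc1 := h1 Is; have {}h2 := h2 Is.
have [H _ _ _ _] := kd.
have mv x y : I01 x -> I01 y -> x <= y -> (forall u, x < u < y -> u != s) ->
    `|k y s - k x s| <= Phi s * (y - x).
  move=> Ix Iy xy us.
  apply: (@mean_value_le _ (k ^~ s) (dkernel k ^~ s)) => // u uxy.
  have Iu : I01 u by move: uxy => /andP[/ltW xu /ltW uy]; apply: (I01_between Ix Iy).
  split; last by apply: h2 => //; apply: us.
  by apply/derivable01_has_der; apply: (H s Is u Iu (us u uxy)).1.
rewrite (@ger0_norm _ (t - t0)) ?subr_ge0 //.
have [st|st] := leP s t0.
  by apply: mv => // u /andP[u0 _]; rewrite gt_eqF // (le_lt_trans st).
have [st'|st'] := leP t s.
  by apply: mv => // u /andP[_ u0]; rewrite lt_eqF // (lt_le_trans u0).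
have h3 : `|k s s - k t0 s| <= Phi s * (s - t0).
  by apply: mv => //; [exact: ltW|move=> u /andP[_ u1]; rewrite lt_eqF].
have h4 : `|k t s - k s s| <= Phi s * (t - s).
  by apply: mv => //; [exact: ltW|move=> u /andP[u1 _]; rewrite gt_eqF].
have := ler_normD (k t s - k s s) (k s s - k t0 s); rewrite subrKA.
have -> : Phi s * (t - t0) = Phi s * (t - s) + Phi s * (s - t0) by ring.
lra.
Qed.

Section Cone.
Variables (k : R -> R -> R) (Phi : R -> R) (a b ct : R).
Hypotheses (kc : kernel_continuous k) (kb : kernel_bounds k Phi a b ct).
Hypotheses (a0 : 0 <= a) (ab : a <= b) (b1 : b <= 1) (ct01 : 0 < ct <= 1).
Variables (g : R -> R) (B : R).
Hypotheses (mg : lebesgue_measurable g) (gB : forall s, I01 s -> `|g s| <= B).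
Hypothesis g0 : forall s, I01 s -> 0 <= g s.

Local Notation L := (kint (leb : {measure set LT -> \bar R}) I01 k g).

Lemma ab_I01 t : `[a, b]%classic t -> I01 t.
Proof.
rewrite /= in_itv /= => /andP[h1 h2]; apply/I01P.
by split; [exact: le_trans a0 h1|exact: le_trans h2 b1].
Qed.

Let ik t (It : I01 t) : leb.-integrable I01 (EFin \o k t).
Proof.
have [iP le _] := kb; apply: (integrable_k leb_measurable_I01 _ iP le) => //.
by case: kc.
Qed.

Let ikg t (It : I01 t) : leb.-integrable I01 (EFin \o (fun s => k t s * g s)).
Proof. exact: (integrable_mul_bounded leb_measurable_I01 (ik It) mg gB). Qed.

(** For almost every [s], [k t s >= ct * Phi s >= ct * `|k tau s|]. *)
Lemma kint_cone t tau : `[a, b]%classic t -> I01 tau -> ct * `|L tau| <= L t.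
Proof.
move=> abt Itau; have It := ab_I01 abt; have [iP le ge] := kb.
have /andP[ct0 ct1] := ct01; rewrite -(gtr0_norm ct0) -normrM.
rewrite /kint -RintegralZl //; [|exact: leb_measurable_I01|exact: ikg].
apply: le_trans (le_normr_Rintegral leb_measurable_I01 _) _.
  by apply: (integrableZr leb_measurable_I01); exact: ikg.
apply: le_Rintegral_ae => //; first exact: leb_measurable_I01.
- apply: integrable_norm; apply: (integrableZr leb_measurable_I01); exact: ikg.
- exact: ikg.
apply: filterS2 (le _ Itau) (ge _ abt) => s h1 h2 Is.
rewrite !normrM (ger0_norm (g0 Is)) gtr0_norm // mulrA ler_wpM2r ?g0 //.
by apply: le_trans (h2 Is); rewrite ler_pM2l // h1.
Qed.

Lemma kernel_ge0 t : `[a, b]%classic t -> {ae leb, forall s, I01 s -> 0 <= k t s}.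
Proof.
move=> abt; have [_ le ge] := kb; have It := ab_I01 abt.
apply: filterS2 (le _ It) (ge _ abt) => s h1 h2 Is.
apply: le_trans (h2 Is); have /andP[ct0 _] := ct01; apply: mulr_ge0; first exact: ltW.
exact: le_trans (normr_ge0 _) (h1 Is).
Qed.

Lemma Rintegral_ge0_ae (D : set LT) (h : R -> R) : measurable D ->
  leb.-integrable D (EFin \o h) -> {ae leb, forall s, D s -> 0 <= h s} ->
  0 <= \int[leb]_(s in D) h s.
Proof.
move=> mD ih h0.
have := @le_Rintegral_ae _ LT R leb D mD (cst 0) h (integrable0 _ _) ih h0.
by rewrite Rintegral_cst // mul0r.
Qed.

(** The part of the integral outside [[a, b]] can be dropped because [k t] is
    nonnegative almost everywhere. *)
Lemma kint_lower (m : R) t : `[a, b]%classic t ->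
  (forall s, `[a, b]%classic s -> m <= g s) -> 0 <= m ->
  m * inv_M k a b <= L t.
Proof.
move=> abt gm m0; have It := ab_I01 abt.
have mab : measurable (`[a, b]%classic : set LT) by exact: leb_measurable_itv.
have abI : I01 `&` `[a, b]%classic = `[a, b]%classic :> set R.
  by apply: setIidr => s; exact: ab_I01.
have ikab u : `[a, b]%classic u -> leb.-integrable `[a, b]%classic (EFin \o k u).
  move=> abu; apply: (integrableS leb_measurable_I01) => //; first by move=> s; exact: ab_I01.
  by apply: ik; exact: ab_I01.
have Mle : inv_M k a b <= \int[leb]_(s in `[a, b]) k t s.
  apply: ge_inf; last by exists t.
  exists 0 => _ [u abu <-]; apply: Rintegral_ge0_ae => //; first exact: ikab.
  by apply: filterS (kernel_ge0 abu) => s h /ab_I01; apply: h.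
apply: le_trans (ler_wpM2l m0 Mle) _.
rewrite -RintegralZl //; last exact: ikab.
apply: (@le_trans _ _ (\int[leb]_(s in `[a, b]) (k t s * g s))).
  apply: le_Rintegral_ae => //.
  - by apply: integrableZr => //; exact: ikab.
  - apply: (integrableS leb_measurable_I01) => //; first by move=> s; exact: ab_I01.
    exact: ikg.
  - apply: filterS (kernel_ge0 abt) => s h abs.
    by rewrite mulrC ler_wpM2l ?gm ?h //; exact: ab_I01.
have mDab : measurable (I01 `\` `[a, b]%classic : set LT).
  by apply: measurableD => //; exact: leb_measurable_I01.
have abU : `[a, b]%classic `|` (I01 `\` `[a, b]%classic) = I01 :> set R.
  by apply: setDUK => s; exact: ab_I01.
rewrite /kint -{1}abU Rintegral_setU //; last 2 first.
- by rewrite abU; exact: ikg.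
- by rewrite disj_set2E setDIK.
rewrite lerDl; apply: Rintegral_ge0_ae => //.
  by apply: (integrableS leb_measurable_I01) => //; exact: ikg.
apply: filterS (kernel_ge0 abt) => s h [Is _].
by rewrite mulr_ge0 ?h ?g0.
Qed.

End Cone.
End LebesgueInterval.

(** * The cone, the boxes and the jets *)

Section ConeK.
Context {R : realType} {n : nat}.
Variables (a b c : 'I_n -> R).
Hypotheses (ab01 : forall i, [/\ 0 <= a i, a i <= b i & b i <= 1])
  (c01 : forall i, 0 < c i <= 1).
Implicit Types (u v p : 'I_n -> R -> R).

Local Notation K := (coneK a b c).
Local Notation N := normC1n.

Lemma ab_sub i t : `[a i, b i]%classic t -> I01 t.
Proof. by have [h1 h2 h3] := ab01 i; apply: ab_I01. Qed.

Lemma coneK_C1n u : K u -> C1n u.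
Proof. by move=> Ku i; case: (Ku i). Qed.

Lemma coneK_bounded u i : K u -> bounded01 (u i).
Proof. by move=> /coneK_C1n uC; have [] := C1_bounded (uC i). Qed.

Lemma coneKD u v : K u -> K v -> K (u + v).
Proof.
move=> Ku Kv i; split; first by apply: (subspaceD C1n_subspace (coneK_C1n Ku) (coneK_C1n Kv)).
move=> t abt; have [_ /(_ t abt) hu] := Ku i; have [_ /(_ t abt) hv] := Kv i.
apply: le_trans (lerD hu hv); rewrite -mulrDr ler_wpM2l //.
  by have /andP[/ltW] := c01 i.
apply: normoo_le => s Is; apply: le_trans (ler_normD _ _) _.
by apply: lerD; apply: normoo_ge => //; exact: coneK_bounded.
Qed.

Lemma coneKZ (r : R) u : 0 <= r -> K u -> K (r *: u).
Proof.
move=> r0 Ku i; split; first by apply: (subspaceZ C1n_subspace r (coneK_C1n Ku)).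
move=> t abt; have [_ /(_ t abt) hu] := Ku i.
apply: (@le_trans _ _ (r * (c i * normoo (u i)))); last by rewrite ler_wpM2l.
rewrite mulrCA ler_wpM2l //; first by have /andP[/ltW] := c01 i.
apply: normoo_le => s Is; rewrite normrM ger0_norm // ler_wpM2l //.
by apply: normoo_ge => //; exact: coneK_bounded.
Qed.

Definition one_fam : 'I_n -> R -> R := fun _ _ => 1.

(** The constant 1 is the direction in which the lower estimate is tested. *)
Lemma coneK_one : K one_fam.
Proof.
move=> i; split; first exact: (C1_cst 1).1.
move=> t _; have /andP[c0 c1] := c01 i; rewrite -[leRHS]mulr1.
apply: ler_pM => //; first exact: ltW.
  by apply: normoo_ge0; exists 1 => s _; rewrite normr1.
by apply: normoo_le => s _; rewrite normr1.
Qed.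

Lemma normC1n_one : (0 < n)%N -> N one_fam = 1.
Proof.
move=> n0; apply/eqP; rewrite eq_le; apply/andP; split.
  apply: normC1n_le => // i t It; rewrite (C1_cst 1).2 // normr0 normr1.
  by split.
have oneC : C1n one_fam by move=> i; exact: (C1_cst 1).1.
by have [] := normC1n_ge (Ordinal n0) oneC I01_0; rewrite /one_fam normr1.
Qed.

(** The inequality that defines the cone involves only values and sup norms, hence
    passes to limits in the C^1 norm. *)
Lemma coneK_closed p : C1n p -> (forall e, 0 < e -> exists2 u, K u & N (u - p) < e) -> K p.
Proof.
move=> pC cl i; split=> [|t abt]; first exact: pC.
have It := ab_sub abt; have /andP[c0 c1] := c01 i.
apply/ler_addgt0Pr => e e0; have e2 : 0 < e / 2 by rewrite divr_gt0.
have [u Ku lt] := cl _ e2; have uC := coneK_C1n Ku.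
have near s : I01 s -> `|u i s - p i s| <= e / 2.
  move=> Is; have [h _] := normC1n_ge i (subspaceB C1n_subspace uC pC) Is.
  exact: le_trans h (ltW lt).
have bu := coneK_bounded i Ku.
have h1 : normoo (p i) <= normoo (u i) + e / 2.
  apply: normoo_le => s Is; have := near s Is; rewrite distrC => h.
  have := ler_normD (p i s - u i s) (u i s); rewrite subrK.
  have := normoo_ge bu Is; lra.
have [_ /(_ t abt) h2] := Ku i.
have := near t It; rewrite ler_norml => /andP[h3 h4].
have h5 : c i * normoo (p i) <= c i * normoo (u i) + c i * (e / 2).
  by rewrite -mulrDr ler_wpM2l // ltW.
have h6 : c i * (e / 2) <= e / 2 by rewrite ler_piMl // ltW.
lra.
Qed.

(** A point of the sphere is a limit of its radial contractions, and itself lies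
    outside the open ball. *)
Lemma bdKP rho u : 0 < rho -> bdK K rho u <-> K u /\ N u = rho.
Proof.
move=> r0; have NS := @normC1n_seminorm R n; have WL := @C1n_subspace R n.
have [_ _ NZ] := NS.
split=> [[[Ku cl1] [_ cl2]]|[Ku Nu]].
  split=> //; apply/eqP; rewrite eq_le; have uC := coneK_C1n Ku; apply/andP; split.
    apply/ler_addgt0Pr => e /cl1[v [Kv Nv] d].
    have vC := coneK_C1n Kv; have h := seminorm_distD WL NS uC vC.
    rewrite (seminormBC WL NS uC vC) in h.
    by apply/ltW/(le_lt_trans h)/ltrD.
  apply/ler_addgt0Pr => e /cl2[v [Kv nv] d]; have vC := coneK_C1n Kv.
  have Nv : rho <= N v by rewrite leNgt; apply/negP => lt; apply: nv.
  have h := seminorm_distD WL NS vC uC.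
  by apply: (le_trans Nv); apply: (le_trans h); rewrite lerD2l; exact: ltW.
have uC := coneK_C1n Ku; split; split=> // e e0.
  pose d := Num.min (1 / 2) (e / (2 * rho)).
  have [d0 [d1 de]] : 0 < d /\ d <= 1 / 2 /\ d <= e / (2 * rho).
    by rewrite /d lt_min !ge_min !lexx orbT !divr_gt0 ?mulr_gt0.
  exists ((1 - d) *: u).
    split; first by apply: coneKZ => //; lra.
    rewrite NZ // Nu ger0_norm; [nra|lra].
  have -> : distC1n ((1 - d) *: u) u = N ((- d) *: u).
    rewrite -[LHS]/(N ((1 - d) *: u - u)); congr N.
    by rewrite -{2}(scale1r u) -scalerBl addrAC subrr add0r.
  rewrite NZ // Nu normrN gtr0_norm //.
  move: de; rewrite ler_pdivlMr ?mulr_gt0 //; nra.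
exists u; first by split=> // -[_]; rewrite Nu ltxx.
by rewrite -[distC1n u u]/(N (u - u)) subrr (seminorm0 WL NS).
Qed.

Section Functional.
Variables (h : ('I_n -> R -> R) -> R) (rho : R).
Hypotheses (ah : admissible_functional K h) (rho0 : 0 < rho).

Lemma bounded_functional r : exists M, forall u, K u -> N u <= r -> h u <= M.
Proof.
have [_ _ bh] := ah; have [||M HM] := bh [set u | K u /\ N u <= r].
- by move=> u [].
- by exists r => u [].
by exists M => u Ku Nu; apply: le_trans (ler_norm _) (HM u _).
Qed.

Lemma sup_bdK_ge u : K u -> N u = rho -> h u <= sup_bdK K h rho.
Proof.
move=> Ku Nu; have [M HM] := bounded_functional rho.
apply: ub_le_sup; last by exists u => //; apply/bdKP.
by exists M => _ [v /(bdKP _ rho0)[Kv Nv] <-]; apply: HM => //; rewrite Nv.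
Qed.

Lemma inf_bdK_le u : K u -> N u = rho -> inf_bdK K h rho <= h u.
Proof.
move=> Ku Nu; have [h0 _ _] := ah.
apply: ge_inf; last by exists u => //; apply/bdKP.
by exists 0 => _ [v /(bdKP _ rho0)[Kv _] <-]; apply: h0.
Qed.

Lemma inf_bdK_ge0 : (0 < n)%N -> 0 <= inf_bdK K h rho.
Proof.
move=> n0; have [h0 _ _] := ah; have [_ _ NZ] := @normC1n_seminorm R n.
apply: lb_le_inf; last by move=> _ [v /(bdKP _ rho0)[Kv _] <-]; apply: h0.
exists (h (rho *: one_fam)); exists (rho *: one_fam) => //; apply/bdKP => //.
split; first by apply: coneKZ; [exact: ltW|exact: coneK_one].
rewrite NZ ?normC1n_one // ?mulr1 ?gtr0_norm //.
exact/coneK_C1n/coneK_one.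
Qed.

End Functional.
End ConeK.

Section Nonlinear.
Context {R : realType} {n : nat}.
Variable f : R -> 'rV[R]_(n + n) -> R -> R.
Hypothesis fN : nonlinearity f.

Local Notation X := (R * 'rV[R]_(n + n) * R)%type.
Local Notation F := (fun p : X => f p.1.1 p.1.2 p.2).

Lemma boxI_compact (rho wlo whi : R) : compact (boxI rho wlo whi : set X).
Proof.
have -> : boxI rho wlo whi = ((I01 `*` [set v : 'rV[R]_(n + n) | forall j, `[- rho, rho]%classic (v ord0 j)])
    `*` `[wlo, whi]%classic) :> set X.
  apply/seteqP; split => -[[t x] w] /=.
    move=> [It xj wv]; split; last by rewrite /= in_itv.
    by split=> // j; rewrite /= in_itv; exact: xj.
  by move=> [[It xj] wv]; split.
apply: compact_setX; last exact: segment_compact.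
apply: compact_setX; first exact: segment_compact.
apply: (@rV_compact R (n + n) (fun=> `[- rho, rho]%classic)) => _.
exact: segment_compact.
Qed.

Lemma boxI_within (rho whi : R) : {within (boxI rho 0 whi : set X), continuous F}.
Proof.
apply: continuous_subspaceW fN.1 => p [It _ /andP[w0 _]].
by split.
Qed.

Lemma nonlinearity_bounded (rho whi : R) : exists B, forall p, boxI rho 0 whi p -> F p <= B.
Proof.
have /compact_bounded[M [_ HM]] := continuous_compact (@boxI_within rho whi) (@boxI_compact rho 0 whi).
exists (M + 1) => p bp; apply: le_trans (ler_norm _) _.
by apply: (HM (M + 1)); [rewrite ltrDl|exists p].
Qed.

Lemma boxI_sub (rho wlo whi : R) : 0 <= wlo -> boxI rho wlo whi `<=` (boxI rho 0 whi : set X).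
Proof. by move=> w0 p [It xj /andP[h1 h2]]; split=> //; rewrite (le_trans w0 h1). Qed.

Lemma fover_ge (rho wlo whi : R) p : 0 <= wlo -> boxI rho wlo whi p -> F p <= fover f rho wlo whi.
Proof.
move=> w0 bp; have [B HB] := nonlinearity_bounded rho whi.
apply: ub_le_sup; last by exists p.
by exists B => _ [q bq <-]; apply: HB; exact: (boxI_sub w0).
Qed.

Lemma nonlinearity_uniform (rho whi e : R) : 0 < e -> exists2 d, 0 < d &
  forall p q, boxI rho 0 whi p -> boxI rho 0 whi q -> ball p d q -> `|F p - F q| < e.
Proof.
move: e; apply: (@pseudodist_uniform R X (boxI rho 0 whi) (fun p q => `|F p - F q|)).
- exact: boxI_compact.
- by move=> x y z _ _ _; apply: le_trans (ler_normD _ _); rewrite subrKA.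
- by move=> x y _ _; rewrite distrC.
move=> p bp e e0.
have /subspace_continuousP/(_ p bp)/cvgrPdist_lt/(_ e e0) := @boxI_within rho whi.
rewrite near_withinE => /nbhs_ballP[d /= d0 Hd]; exists d => // q bq pq.
by rewrite distrC; apply: Hd.
Qed.

End Nonlinear.

Section Jets.
Context {R : realType} {n : nat}.
Implicit Types (u v : 'I_n -> R -> R).

Lemma jet_cases (P : R -> Prop) u t :
  (forall i, P (u i t)) -> (forall i, P (derive01 (u i) t)) -> forall j, P (jet u t 0 j).
Proof.
move=> h1 h2 j; rewrite -(fintype.splitK j); case: (fintype.split j) => i /=.
  by rewrite /jet row_mxEl mxE.
by rewrite /jet row_mxEr mxE.
Qed.

Lemma jet_lshift u t i : jet u t 0 (lshift n i) = u i t.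
Proof. by rewrite /jet row_mxEl mxE. Qed.

Lemma jet_le u t rho j : C1n u -> I01 t -> normC1n u <= rho -> - rho <= jet u t 0 j <= rho.
Proof.
move=> uC It Nu; rewrite -ler_norml; move: j.
by apply: (jet_cases (P := fun x => `|x| <= rho)) => i;
  have [h1 h2] := normC1n_ge i uC It; apply: le_trans Nu.
Qed.

Lemma jet_dist u v t j : C1n u -> C1n v -> I01 t ->
  `|jet u t 0 j - jet v t 0 j| <= normC1n (u - v).
Proof.
move=> uC vC It; have bC := subspaceB C1n_subspace uC vC.
rewrite -(fintype.splitK j); case: (fintype.split j) => i /=; rewrite /jet ?row_mxEl ?row_mxEr !mxE.
  by have [] := normC1n_ge i bC It.
by rewrite -derive_C1nB //; have [] := normC1n_ge i bC It.
Qed.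

Lemma jet_cont u t : C1n u -> I01 t -> forall e, 0 < e -> exists2 d, 0 < d &
  forall s, I01 s -> `|s - t| < d -> forall j, `|jet u t 0 j - jet u s 0 j| < e.
Proof.
move=> uC It e e0.
have cont (g : R -> R) : cont01 g t -> exists2 d, 0 < d &
    forall s, `|s - t| < d -> I01 s -> `|g t - g s| < e.
  by move=> /(_ e e0)[d d0 Hd]; exists d => // s st Is; rewrite distrC; apply: Hd.
have ex (j : 'I_(n + n)) : exists2 d, 0 < d &
    forall s, `|s - t| < d -> I01 s -> `|jet u t 0 j - jet u s 0 j| < e.
  rewrite -(fintype.splitK j); case: (fintype.split j) => i /=.
    have [|d d0 Hd] := cont (u i).
      by have /C1P[H _] := uC i; apply: has_der01_cont (H t It).
    by exists d => // s st Is; rewrite /jet !row_mxEl !mxE; apply: Hd.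
  have [|d d0 Hd] := cont (derive01 (u i)); first by have /C1P[_ H] := uC i; exact: H.
  by exists d => // s st Is; rewrite /jet !row_mxEr !mxE; apply: Hd.
have [d d0 Hd] := common_delta ex.
by exists d => // s Is st j; apply: (Hd s st j Is).
Qed.

End Jets.

(** * The operator of the system *)

Lemma has_der01_sum (R : realType) (I : Type) (r : seq I) (al : I -> R) (g : I -> R -> R) (g' : I -> R) t :
  (forall j, has_der01 (g j) t (g' j)) ->
  has_der01 (fun x => \sum_(j <- r) al j * g j x) t (\sum_(j <- r) al j * g' j).
Proof.
move=> H; elim: r => [|j r IH].
  move=> e e0; exists 1 => // x _ _; rewrite !big_nil subrr mul0r subrr normr0.
  by rewrite mulr_ge0 // ltW.
rewrite big_cons (_ : (fun x => _) = fun x => al j * g j x + \sum_(j <- r) al j * g j x).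
  exact: has_der01_comb.
by apply/funext => x; rewrite big_cons.
Qed.

Section Hammerstein.
Context {R : realType} {n : nat}.
Variables (k : 'I_n -> R -> R -> R) (a b ct : 'I_n -> R) (Phi0 Phi1 : 'I_n -> R -> R)
  (f : 'I_n -> R -> 'rV[R]_(n + n) -> R -> R)
  (gamma : 'I_n -> 'I_2 -> R -> R) (cg : 'I_n -> 'I_2 -> R)
  (lambda : 'I_n -> R) (eta : 'I_n -> 'I_2 -> R)
  (h : 'I_n -> 'I_2 -> ('I_n -> R -> R) -> R)
  (w : 'I_n -> ('I_n -> R -> R) -> R).

Local Notation c := (fun i => Num.min (ct i) (Num.min (cg i 0) (cg i 1))).
Local Notation K := (coneK a b c).
Local Notation N := (@normC1n R n).

Hypotheses
  (n_ge1 : (1 <= n)%N)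
  (kc : forall i, kernel_continuous (k i))
  (ab01 : forall i, [/\ 0 <= a i, a i <= b i & b i <= 1])
  (ct01 : forall i, 0 < ct i <= 1)
  (kb : forall i, kernel_bounds (k i) (Phi0 i) (a i) (b i) (ct i))
  (kd : forall i, kernel_derivative (k i) (Phi1 i))
  (fN : forall i, nonlinearity (f i))
  (gC : forall i j, C1 (gamma i j))
  (cg01 : forall i j, 0 < cg i j <= 1)
  (g_ge : forall i j t, `[a i, b i]%classic t ->
     cg i j * normoo (gamma i j) <= gamma i j t)
  (lambda_ge0 : forall i, 0 <= lambda i)
  (eta_ge0 : forall i j, 0 <= eta i j)
  (ah : forall i j, admissible_functional K (h i j))
  (aw : forall i, admissible_functional K (w i)).
Implicit Types (u v : 'I_n -> R -> R).

Lemma cone_const01 i : 0 < c i <= 1.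
Proof.
have /andP[h1 h2] := ct01 i; have /andP[h3 h4] := cg01 i 0.
have /andP[h5 h6] := cg01 i 1.
by rewrite !lt_min h1 h3 h5 /= ge_min h2.
Qed.

Lemma cone_const_le i (j : 'I_2) : c i <= ct i /\ c i <= cg i j.
Proof.
split; first by rewrite ge_min lexx.
have : j = 0 \/ j = 1 by case: j => [[|[|]] // p]; [left|right]; apply: val_inj.
by case=> ->; rewrite !ge_min lexx ?orbT.
Qed.

Local Notation KC1 := (@coneK_C1n R n a b c _).
Local Notation LT := (caratheodory_type (R := R) (wlength idfun)^*%mu).
Local Notation lebm := (leb : {measure set LT -> \bar R}).

Definition source i u (s : R) : R := f i s (jet u s) (w i u).

Definition hamm u : 'I_n -> R -> R := fun i t =>
  lambda i * \int[leb]_(s in I01) (k i t s * f i s (jet u s) (w i u))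
  + \sum_(j < 2) eta i j * gamma i j t * h i j u.

Definition dhamm u : 'I_n -> R -> R := fun i t =>
  lambda i * kint lebm I01 (dkernel (k i)) (source i u) t
  + \sum_(j < 2) (eta i j * h i j u) * derive01 (gamma i j) t.

Lemma hammE u i t : hamm u i t = lambda i * kint lebm I01 (k i) (source i u) t
  + \sum_(j < 2) (eta i j * h i j u) * gamma i j t.
Proof. by congr (_ + _); apply: eq_bigr => j _; rewrite mulrAC. Qed.

(** * The source term *)

Lemma source_box u i s rho W : K u -> N u <= rho -> w i u <= W -> I01 s ->
  boxI rho 0 W (s, jet u s, w i u).
Proof.
move=> Ku Nu wW Is; split=> //= [j|]; first by apply: jet_le => //; exact: KC1.
by have [w0 _ _] := aw i; rewrite w0.
Qed.

Lemma source_ge0 u i s : K u -> I01 s -> 0 <= source i u s.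
Proof.
move=> Ku Is; have [w0 _ _] := aw i.
by apply: (fN i).2 => //; apply: w0.
Qed.

Lemma source_cont u i s : K u -> I01 s -> cont01 (source i u) s.
Proof.
move=> Ku Is e e0; have uC := KC1 Ku.
have [d d0 Hd] := nonlinearity_uniform (fN i) (N u) (w i u) e0.
have [d1 d10 Hd1] := jet_cont uC Is d0.
exists (Num.min d d1); first by rewrite lt_min d0.
move=> x Ix; rewrite lt_min => /andP[xd xd1]; rewrite distrC.
apply: (Hd (s, jet u s, w i u) (x, jet u x, w i u)); try exact: source_box.
split; last exact: ballxx.
split=> /=; first by rewrite /ball /= distrC.
by split=> // i' j; rewrite ord1 /ball /=; apply: Hd1.
Qed.

Lemma source_measurable u i : K u -> lebesgue_measurable (source i u).
Proof. by move=> Ku; apply: cont01_measurable => s; apply: source_cont. Qed.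

Lemma source_bounded rho : exists B : 'I_n -> R, forall i, 0 <= B i /\
  forall u s, K u -> N u <= rho -> I01 s -> `|source i u s| <= B i.
Proof.
suff /choice[B HB] : forall i, exists B, 0 <= B /\ forall u s, K u -> N u <= rho ->
    I01 s -> `|source i u s| <= B by exists B.
move=> i; have [W HW] := bounded_functional (aw i) rho.
have [B HB] := nonlinearity_bounded (fN i) rho W.
exists (Num.max 0 B); split=> [|u s Ku Nu Is]; first by rewrite le_max lexx.
rewrite ger0_norm ?source_ge0 // le_max.
by rewrite (HB (s, jet u s, w i u)) ?orbT //; apply: source_box => //; exact: HW.
Qed.

Lemma functional_bounded rho : exists H : 'I_n -> 'I_2 -> R, forall i j, 0 <= H i j /\
  forall u, K u -> N u <= rho -> h i j u <= H i j.
Proof.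
have ex (ij : 'I_n * 'I_2) : exists M, 0 <= M /\ forall u, K u -> N u <= rho -> h ij.1 ij.2 u <= M.
  have [M HM] := bounded_functional (ah ij.1 ij.2) rho.
  exists (Num.max 0 M); split=> [|u Ku Nu]; first by rewrite le_max lexx.
  by rewrite le_max HM ?orbT.
have [H HP] := choice ex.
by exists (fun i j => H (i, j)) => i j; exact: (HP (i, j)).
Qed.

Lemma h_ge0 u i j : K u -> 0 <= h i j u.
Proof. by move=> Ku; have [H _ _] := ah i j; apply: H. Qed.

(** * Kernel facts in the form required by the general integral operator *)

Let mI := @leb_measurable_I01 R.
Let mk i t (It : I01 t) : lebesgue_measurable (k i t) := (kc i).1 t It.
Let mdk i t (It : I01 t) : lebesgue_measurable (dkernel (k i) t).
Proof. by have [_ _ H _ _] := kd i; apply: H. Qed.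
Let iPhi0 i : L1 (Phi0 i). Proof. by have [H _ _] := kb i. Qed.
Let iPhi1 i : L1 (Phi1 i). Proof. by have [_ _ _ H _] := kd i. Qed.
Let kle i t (It : I01 t) : {ae leb, forall s, I01 s -> `|k i t s| <= Phi0 i s}.
Proof. by have [_ H _] := kb i; apply: H. Qed.
Let dkle i t (It : I01 t) : {ae leb, forall s, I01 s -> `|dkernel (k i) t s| <= Phi1 i s}.
Proof. by have [_ _ _ _ H] := kd i; apply: H. Qed.
Let klip i t t0 (It : I01 t) (It0 : I01 t0) :
  {ae leb, forall s, I01 s -> `|k i t s - k i t0 s| <= Phi1 i s * `|t - t0|}.
Proof. exact: kernel_lipschitz (kc i) (kd i) It It0. Qed.
Let kder i t (It : I01 t) := kernel_has_der (kd i) It.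
Let dkcont i t (It : I01 t) := dkernel_cont (kd i) It.

Let Ik i t : R := \int[leb]_(s in I01) `|k i t s|.
Let Idk i t : R := \int[leb]_(s in I01) `|dkernel (k i) t s|.
Let Ikle i t : I01 t -> 0 <= Ik i t <= \int[leb]_(s in I01) Phi0 i s.
Proof.
move=> It; apply/andP; split; first by apply: Rintegral_ge0.
exact: (@Int_k_le _ LT R lebm I01 mI (k i) (Phi0 i) (@mk i) (iPhi0 i) (@kle i) t It).
Qed.
Let Idkle i t : I01 t -> 0 <= Idk i t <= \int[leb]_(s in I01) Phi1 i s.
Proof.
move=> It; apply/andP; split; first by apply: Rintegral_ge0.
exact: (@Int_dk_le _ LT R lebm I01 mI (dkernel (k i)) (Phi1 i) (@mdk i) (iPhi1 i) (@dkle i) t It).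
Qed.

Lemma hamm_has_der u i t : K u -> I01 t -> has_der01 (hamm u i) t (dhamm u i t).
Proof.
move=> Ku It; rewrite (_ : hamm u i = fun t => lambda i * kint lebm I01 (k i) (source i u) t
  + \sum_(j < 2) (eta i j * h i j u) * gamma i j t); last by apply/funext => x; rewrite hammE.
have [B HB] := source_bounded (N u); have [B0 HBi] := HB i.
apply: has_der01_comb.
  apply: (@kint_has_der _ LT R lebm I01 mI (k i) (dkernel (k i)) (Phi0 i) (Phi1 i)
     (@mk i) (@mdk i) (iPhi0 i) (iPhi1 i) (@kle i) (@dkle i)
     (@klip i) (kder i) (source i u) (B i)) => //; first exact: source_measurable.
  by move=> s Is; apply: HBi.
by apply: has_der01_sum => j; have /C1P[H _] := gC i j; apply: H.
Qed.

(** * Uniform modulus of continuity of the derivatives *)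

(** Up to a constant factor, this bounds the increment of the derivatives of all
    [hamm u] with [u] in a given ball. *)
Definition osc (x y : R) : R := \sum_(i < n) (\int[leb]_(s in I01) `|dkernel (k i) x s - dkernel (k i) y s|
  + \sum_(j < 2) `|derive01 (gamma i j) x - derive01 (gamma i j) y|).

Let osc_int_ge0 i x y : 0 <= \int[leb]_(s in I01) `|dkernel (k i) x s - dkernel (k i) y s|.
Proof. by apply: Rintegral_ge0 => s _; exact: normr_ge0. Qed.

Let osc_der_ge0 i x y : 0 <= \sum_(j < 2) `|derive01 (gamma i j) x - derive01 (gamma i j) y|.
Proof. by apply: sumr_ge0 => j _; exact: normr_ge0. Qed.

Lemma osc_ge0 x y : 0 <= osc x y.
Proof. by apply: sumr_ge0 => i _; exact: addr_ge0 (osc_int_ge0 i x y) (osc_der_ge0 i x y). Qed.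

Lemma osc_uniform e : 0 < e -> exists2 d, 0 < d & forall x y, I01 x -> I01 y ->
  `|x - y| < d -> osc x y < e.
Proof.
have ID i x y : I01 x -> I01 y ->
    leb.-integrable I01 (EFin \o (fun s => dkernel (k i) x s - dkernel (k i) y s)).
  move=> Ix Iy; apply: (integrableBr mI);
  exact: (@integrable_dk _ LT R lebm I01 mI (dkernel (k i)) (Phi1 i) (@mdk i) (iPhi1 i) (@dkle i)).
move: e; apply: (@pseudodist_uniform R R I01 osc) => [|x y z Ix Iy Iz|x y Ix Iy|t It].
- exact: segment_compact.
- rewrite /osc -big_split /=; apply: ler_sum => i _; rewrite addrACA; apply: lerD.
    rewrite -RintegralD //; try exact/integrable_norm/ID.
    apply: le_Rintegral => //; first exact/integrable_norm/ID.
      have := integrableD mI (integrable_norm (ID i x y Ix Iy)) (integrable_norm (ID i y z Iy Iz)).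
      by apply: eq_integrable.
    by move=> s _; apply: le_trans (ler_normD _ _); rewrite subrKA.
  by rewrite -big_split /=; apply: ler_sum => j _; apply: le_trans (ler_normD _ _); rewrite subrKA.
- rewrite /osc; apply: eq_bigr => i _.
  have -> : \sum_(j < 2) `|derive01 (gamma i j) x - derive01 (gamma i j) y| =
            \sum_(j < 2) `|derive01 (gamma i j) y - derive01 (gamma i j) x|.
    by apply: eq_bigr => j _; rewrite distrC.
  by under eq_Rintegral do rewrite distrC.
have : osc x t @[x --> within I01 (nbhs t)] --> \sum_(i < n) ((0 : R) + \sum_(j < 2) (0 : R)).
  apply: cvg_sumr => i; apply: cvgD.
    apply/cvg01P => e e0.
    have [d d0 Hd] := @dk_modulus _ LT R lebm I01 mI (dkernel (k i)) (Phi1 i)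
      (@mdk i) (iPhi1 i) (@dkle i) (dkcont i) e e0.
    exists d => // x Ix xt; rewrite subr0 ger0_norm; last by apply: Rintegral_ge0.
    exact: Hd.
  apply: cvg_sumr => j; apply/cvg01P => e e0.
  have /C1P[_ H] := gC i j; have [d d0 Hd] := H t It e e0.
  by exists d => // x Ix xt; rewrite subr0 normr_id; apply: Hd.
rewrite big1 => [|i _]; last by rewrite big1 ?addr0.
move=> /cvg01P H e /H[d d0 Hd]; exists d => // x Ix xt.
apply: le_lt_trans (Hd x Ix _); first by rewrite subr0 ler_norm.
by move: xt; rewrite /ball /= distrC.
Qed.

Lemma dhamm_osc rho : exists2 M, 0 <= M & forall u i x y, K u -> N u <= rho ->
  I01 x -> I01 y -> `|dhamm u i x - dhamm u i y| <= M * osc x y.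
Proof.
have [B HB] := source_bounded rho; have [H HH] := functional_bounded rho.
pose M := \sum_(i < n) (lambda i * B i + \sum_(j < 2) eta i j * H i j).
have M1 i : 0 <= lambda i * B i by rewrite mulr_ge0 //; exact: (HB i).1.
have M2 i j : 0 <= eta i j * H i j by rewrite mulr_ge0 //; exact: (HH i j).1.
have Mi i : lambda i * B i + \sum_(j < 2) eta i j * H i j <= M.
  rewrite /M [leRHS](bigD1 i) //= lerDl; apply: sumr_ge0 => l _.
  by rewrite addr_ge0 // sumr_ge0.
have M0 : 0 <= M by apply: sumr_ge0 => i _; rewrite addr_ge0 // sumr_ge0.
exists M => // u i x y Ku Nu Ix Iy.
have [B0 HBi] := HB i.
have h1 : `|kint lebm I01 (dkernel (k i)) (source i u) x - kint lebm I01 (dkernel (k i)) (source i u) y|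
   <= B i * \int[leb]_(s in I01) `|dkernel (k i) x s - dkernel (k i) y s|.
  apply: (@kint_dk_lip _ LT R lebm I01 mI (dkernel (k i)) (Phi1 i) (@mdk i) (iPhi1 i)
    (@dkle i) (source i u) (B i)) => //; first exact: source_measurable.
  by move=> s Is; apply: HBi.
pose q := \int[leb]_(s in I01) `|dkernel (k i) x s - dkernel (k i) y s|.
have q0 : 0 <= q by exact: osc_int_ge0.
pose g := \sum_(j < 2) `|derive01 (gamma i j) x - derive01 (gamma i j) y|.
have g0 : 0 <= g by exact: osc_der_ge0.
have qg : q + g <= osc x y.
  rewrite /osc [leRHS](bigD1 i) //= -/q -/g lerDl; apply: sumr_ge0 => l _.
  exact: addr_ge0 (osc_int_ge0 l x y) (osc_der_ge0 l x y).
apply: le_trans (ler_wpM2l M0 qg).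
have -> : dhamm u i x - dhamm u i y =
   lambda i * (kint lebm I01 (dkernel (k i)) (source i u) x - kint lebm I01 (dkernel (k i)) (source i u) y)
   + \sum_(j < 2) (eta i j * h i j u) * (derive01 (gamma i j) x - derive01 (gamma i j) y).
  rewrite /dhamm opprD addrACA mulrBr; congr (_ + _); rewrite -sumrB.
  by apply: eq_bigr => j _; rewrite mulrBr.
apply: le_trans (ler_normD _ _) _; rewrite [leRHS]mulrDr; apply: lerD.
  rewrite normrM (ger0_norm (lambda_ge0 i)).
  apply: le_trans (ler_wpM2l (lambda_ge0 i) h1) _; rewrite mulrA ler_wpM2r //.
  by apply: le_trans (Mi i); rewrite lerDl sumr_ge0.
apply: le_trans (ler_norm_sum _ _ _) _; rewrite /g mulr_sumr; apply: ler_sum => j _.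
have eh0 : 0 <= eta i j * h i j u by rewrite mulr_ge0 ?h_ge0.
rewrite normrM ger0_norm // ler_wpM2r //.
apply: (@le_trans _ _ (eta i j * H i j)).
  by rewrite ler_wpM2l //; apply: (HH i j).2.
apply: le_trans (Mi i); rewrite (bigD1 j) //= addrCA lerDl addr_ge0 //.
by apply: sumr_ge0.
Qed.

Lemma hamm_C1 u i : K u -> C1 (hamm u i) /\ forall t, I01 t -> derive01 (hamm u i) t = dhamm u i t.
Proof.
move=> Ku; apply: C1_of_der => t It; first exact: hamm_has_der.
move=> e e0; have [M M0 HM] := dhamm_osc (N u).
have M1 : 0 < M + 1 by rewrite ltr_wpDl.
have [d d0 Hd] := osc_uniform (divr_gt0 e0 M1); exists d => // x Ix xt.
apply: le_lt_trans (HM u i x t Ku (lexx _) Ix It) _.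
have := Hd x t Ix It xt; rewrite ltr_pdivlMr // => lt; apply: le_lt_trans lt.
by rewrite mulrC ler_wpM2l ?osc_ge0 // lerDl.
Qed.

Lemma hamm_C1n u : K u -> C1n (hamm u).
Proof. by move=> Ku i; exact: (hamm_C1 i Ku).1. Qed.

(** * Invariance of the cone *)

Lemma gammaK u i t tau : K u -> `[a i, b i]%classic t -> I01 tau ->
  c i * `|\sum_(j < 2) (eta i j * h i j u) * gamma i j tau| <=
  \sum_(j < 2) (eta i j * h i j u) * gamma i j t.
Proof.
move=> Ku abt Itau; have /andP[c0 c1] := cone_const01 i.
apply: le_trans (ler_wpM2l (ltW c0) (ler_norm_sum _ _ _)) _.
rewrite mulr_sumr; apply: ler_sum => j _.
have eh0 : 0 <= eta i j * h i j u by rewrite mulr_ge0 ?h_ge0.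
rewrite normrM ger0_norm // mulrCA ler_wpM2l //.
have [bg _] := C1_bounded (gC i j).
apply: le_trans (g_ge j abt); apply: ler_pM => //; first exact: ltW.
  exact: (cone_const_le i j).2.
exact: normoo_ge.
Qed.

Lemma hamm_K u : K u -> K (hamm u).
Proof.
move=> Ku i; split; first exact: hamm_C1n.
move=> t abt; have /andP[c0 c1] := cone_const01 i.
have [ai0 abi bi1] := ab01 i; have [B HB] := source_bounded (N u); have [B0 HBi] := HB i.
rewrite -ler_pdivlMl //; apply: normoo_le => tau Itau; rewrite ler_pdivlMl //.
rewrite !hammE; apply: le_trans (ler_wpM2l (ltW c0) (ler_normD _ _)) _.
rewrite mulrDr; apply: lerD; last exact: gammaK.
rewrite normrM (ger0_norm (lambda_ge0 i)) mulrCA ler_wpM2l //.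
apply: (@le_trans _ _ (ct i * `|kint lebm I01 (k i) (source i u) tau|)).
  by rewrite ler_wpM2r //; exact: (cone_const_le i 0).1.
apply: (@kint_cone R (k i) (Phi0 i) (a i) (b i) (ct i) (kc i) (kb i) ai0 bi1 (ct01 i)
  (source i u) (B i)) => //.
- exact: source_measurable.
- by move=> s Is; apply: HBi.
- by move=> s Is; apply: source_ge0.
Qed.


(** * Bounds and continuity *)

Let ik i t : I01 t -> leb.-integrable I01 (EFin \o k i t).
Proof.
exact: (@integrable_k _ LT R lebm I01 mI (k i) (Phi0 i) (@mk i) (iPhi0 i) (@kle i) t).
Qed.

Let idk i t : I01 t -> leb.-integrable I01 (EFin \o dkernel (k i) t).
Proof.
exact: (@integrable_dk _ LT R lebm I01 mI (dkernel (k i)) (Phi1 i) (@mdk i) (iPhi1 i) (@dkle i) t).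
Qed.

Lemma hamm_term_le (kk : R -> R -> R) (gg : 'I_2 -> R -> R) (G H : 'I_2 -> R) i u t B Q :
  K u -> leb.-integrable I01 (EFin \o kk t) ->
  \int[leb]_(s in I01) `|kk t s| <= Q -> 0 <= B ->
  (forall s, I01 s -> `|source i u s| <= B) ->
  (forall j, `|gg j t| <= G j) -> (forall j, h i j u <= H j) ->
  `|lambda i * kint lebm I01 kk (source i u) t + \sum_(j < 2) (eta i j * h i j u) * gg j t|
  <= lambda i * B * Q + \sum_(j < 2) eta i j * G j * H j.
Proof.
move=> Ku ikk kQ B0 sB gG hH; apply: le_trans (ler_normD _ _) _; apply: lerD.
  rewrite normrM (ger0_norm (lambda_ge0 i)) -mulrA ler_wpM2l //.
  apply: le_trans (Rintegral_mul_le mI ikk (source_measurable i Ku) sB) _.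
  by rewrite ler_wpM2l.
apply: le_trans (ler_norm_sum _ _ _) _; apply: ler_sum => j _.
have h0 := h_ge0 i j Ku.
rewrite normrM ger0_norm ?mulr_ge0 // -!mulrA ler_wpM2l // mulrC.
by apply: ler_pM.
Qed.

Lemma hamm_term_dist (kk : R -> R -> R) (gg : 'I_2 -> R -> R) (G : 'I_2 -> R) i u v t e Q :
  K u -> K v -> leb.-integrable I01 (EFin \o kk t) ->
  \int[leb]_(s in I01) `|kk t s| <= Q -> 0 <= e ->
  (forall s, I01 s -> `|source i v s - source i u s| <= e) ->
  (forall j, `|gg j t| <= G j) -> (forall j, `|h i j v - h i j u| <= e) ->
  `|(lambda i * kint lebm I01 kk (source i v) t + \sum_(j < 2) (eta i j * h i j v) * gg j t)
   - (lambda i * kint lebm I01 kk (source i u) t + \sum_(j < 2) (eta i j * h i j u) * gg j t)|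
  <= e * (lambda i * Q + \sum_(j < 2) eta i j * G j).
Proof.
move=> Ku Kv ikk kQ e0 se gG he.
have [Bu HBu] := source_bounded (N u); have [Bv HBv] := source_bounded (N v).
have su s : I01 s -> `|source i u s| <= Bu i by move=> Is; apply: (HBu i).2.
have sv s : I01 s -> `|source i v s| <= Bv i by move=> Is; apply: (HBv i).2.
have mu' := source_measurable i Ku; have mv' := source_measurable i Kv.
have -> : (lambda i * kint lebm I01 kk (source i v) t + \sum_(j < 2) (eta i j * h i j v) * gg j t)
   - (lambda i * kint lebm I01 kk (source i u) t + \sum_(j < 2) (eta i j * h i j u) * gg j t)
  = lambda i * kint lebm I01 kk (fun s => source i v s - source i u s) t
   + \sum_(j < 2) eta i j * (h i j v - h i j u) * gg j t.
  rewrite (@kintB _ LT R lebm I01 mI kk (source i v) (source i u) (Bv i) (Bu i) t ikk mv' mu' sv su).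
  rewrite opprD addrACA mulrBr; congr (_ + _); rewrite -sumrB.
  by apply: eq_bigr => j _; rewrite mulrBr mulrBl.
apply: le_trans (ler_normD _ _) _; rewrite [leRHS]mulrDr; apply: lerD.
  rewrite normrM (ger0_norm (lambda_ge0 i)) mulrCA ler_wpM2l //.
  apply: le_trans (Rintegral_mul_le mI ikk _ se) _; first exact: measurable_funB.
  by rewrite ler_wpM2l.
apply: le_trans (ler_norm_sum _ _ _) _; rewrite mulr_sumr; apply: ler_sum => j _.
rewrite !normrM (ger0_norm (eta_ge0 i j)) -[leLHS]mulrA [leRHS]mulrCA ler_wpM2l //.
exact: ler_pM.
Qed.

Let P01 i : R := \int[leb]_(s in I01) Phi0 i s + \int[leb]_(s in I01) Phi1 i s.
Let Ik_le i t : I01 t -> Ik i t <= P01 i.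
Proof.
move=> It; have /andP[_ h1] := Ikle i It; have /andP[h2 h3] := Idkle i It.
by apply: le_trans h1 _; rewrite lerDl (le_trans h2 h3).
Qed.
Let Idk_le i t : I01 t -> Idk i t <= P01 i.
Proof.
move=> It; have /andP[h0 h1] := Ikle i It; have /andP[h2 h3] := Idkle i It.
by apply: le_trans h3 _; rewrite lerDr (le_trans h0 h1).
Qed.
Let P01_ge0 i : 0 <= P01 i.
Proof. by apply: le_trans (Ik_le i I01_0); have /andP[] := Ikle i I01_0. Qed.

Let G_ge i j t : I01 t -> `|gamma i j t| <= normC1 (gamma i j) /\
  `|derive01 (gamma i j) t| <= normC1 (gamma i j).
Proof. exact: normC1_ge. Qed.
Let G_ge0 i j : 0 <= normC1 (gamma i j).
Proof. by have [h1 _] := G_ge i j I01_0; apply: le_trans h1. Qed.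

Lemma hamm_bounded rho : exists M, forall u, K u -> N u <= rho -> N (hamm u) <= M.
Proof.
have [B HB] := source_bounded rho; have [H HH] := functional_bounded rho.
pose t i := lambda i * B i * P01 i + \sum_(j < 2) eta i j * normC1 (gamma i j) * H i j.
have t0 i : 0 <= t i.
  rewrite addr_ge0 ?mulr_ge0 ?(HB i).1 //; apply: sumr_ge0 => j _.
  by rewrite !mulr_ge0 // (HH i j).1.
exists (\sum_i t i) => u Ku Nu; apply: normC1n_le => [|i x Ix].
  by apply: sumr_ge0.
have ti : t i <= \sum_i t i by rewrite [leRHS](bigD1 i) //= lerDl sumr_ge0.
have B0 := (HB i).1; have sB s : I01 s -> `|source i u s| <= B i.
  by move=> Is; apply: (HB i).2.
have hH j : h i j u <= H i j by apply: (HH i j).2.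
rewrite (hamm_C1 i Ku).2 // hammE; split; apply: le_trans ti.
  apply: (@hamm_term_le (k i) (gamma i) (fun j => normC1 (gamma i j)) (H i) i u x (B i) (P01 i)) => //.
  - exact: ik.
  - exact: Ik_le.
  - by move=> j; have [] := G_ge i j Ix.
apply: (@hamm_term_le (dkernel (k i)) (fun j => derive01 (gamma i j))
  (fun j => normC1 (gamma i j)) (H i) i u x (B i) (P01 i)) => //.
- exact: idk.
- exact: Idk_le.
- by move=> j; have [] := G_ge i j Ix.
Qed.

Lemma source_near rho i u e : K u -> N u <= rho -> 0 < e -> exists2 d, 0 < d &
  forall v, N (v - u) < d -> K v -> N v <= rho ->
    forall s, I01 s -> `|source i v s - source i u s| <= e.
Proof.
move=> Ku Nu e0; have [W HW] := bounded_functional (aw i) rho.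
have [d d0 Hd] := nonlinearity_uniform (fN i) rho W e0.
have [_ wc _] := aw i; have [d1 d10 Hd1] := wc u Ku d d0.
exists (Num.min d d1); first by rewrite lt_min d0.
move=> v; rewrite lt_min => /andP[vd vd1] Kv Nv s Is; apply/ltW.
apply: (Hd (s, jet v s, w i v) (s, jet u s, w i u)).
- by apply: source_box => //; apply: HW.
- by apply: source_box => //; apply: HW.
split=> /=; last by rewrite /ball /=; apply: Hd1.
split=> /=; first exact: ballxx.
split=> // i' j; rewrite ord1 /ball /=.
by apply: le_lt_trans vd; apply: jet_dist => //; exact: KC1.
Qed.

Lemma hamm_cont rho u : K u -> N u <= rho -> forall e, 0 < e -> exists2 d, 0 < d &
  forall v, K v -> N v <= rho -> N (v - u) < d -> N (hamm v - hamm u) < e.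
Proof.
move=> Ku Nu e e0.
pose t i := lambda i * P01 i + \sum_(j < 2) eta i j * normC1 (gamma i j).
have t0 i : 0 <= t i.
  by rewrite addr_ge0 ?mulr_ge0 //; apply: sumr_ge0 => j _; rewrite mulr_ge0.
have A0 : 0 <= \sum_i t i by apply: sumr_ge0.
have ti i : t i <= \sum_i t i by rewrite [leRHS](bigD1 i) //= lerDl sumr_ge0.
move: (\sum_i t i) A0 ti => A A0 ti; have A1 : 0 < A + 1 by rewrite ltr_wpDl.
pose r := e / (A + 1); have r0 : 0 < r by rewrite divr_gt0.
have [d1 d10 Hd1] := common_delta (fun i => source_near i Ku Nu r0).
have hnear (ij : 'I_n * 'I_2) : exists2 d, 0 < d & forall v, N (v - u) < d -> K v ->
    `|h ij.1 ij.2 v - h ij.1 ij.2 u| <= r.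
  have [_ hc _] := ah ij.1 ij.2; have [d d0 Hd] := hc u Ku r r0.
  by exists d => // v vd Kv; apply/ltW/Hd.
have [d2 d20 Hd2] := common_delta hnear.
exists (Num.min d1 d2) => [|v Kv Nv]; first by rewrite lt_min d10.
rewrite lt_min => /andP[/Hd1 {}Hd1 /Hd2 {}Hd2].
apply: (@le_lt_trans _ _ (r * A)); last first.
  by rewrite /r mulrAC ltr_pdivrMr // ltr_pM2l // ltrDl.
apply: normC1n_le => [|i x Ix]; first by rewrite mulr_ge0 // ltW.
rewrite derive_C1nB ?(hamm_C1 i Ku).2 ?(hamm_C1 i Kv).2 //; try exact: hamm_C1n.
rewrite -[(hamm v - hamm u) i x]/(hamm v i x - hamm u i x) !hammE.
have ri : r * t i <= r * A by rewrite ler_wpM2l // ltW.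
have sd := Hd1 i Kv Nv; have hd j : `|h i j v - h i j u| <= r := Hd2 (i, j) Kv.
split; apply: le_trans ri.
  apply: (@hamm_term_dist (k i) (gamma i) (fun j => normC1 (gamma i j)) i u v x r (P01 i)) => //.
  - exact: ik.
  - exact: Ik_le.
  - exact: ltW.
  - by move=> j; have [] := G_ge i j Ix.
apply: (@hamm_term_dist (dkernel (k i)) (fun j => derive01 (gamma i j))
  (fun j => normC1 (gamma i j)) i u v x r (P01 i)) => //.
- exact: idk.
- exact: Idk_le.
- exact: ltW.
- by move=> j; have [] := G_ge i j Ix.
Qed.

(** The hull has bounded values and derivatives, and its derivatives share the
    modulus of continuity given by [osc]. *)
Lemma hamm_hull_precompact rho1 rho2 :
  seq_precompact N (hull N K hamm one_fam rho1 rho2) K.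
Proof.
move=> z zh.
have oneC : C1n one_fam := KC1 (coneK_one a b cone_const01).
have hC : hull N K hamm one_fam rho1 rho2 `<=` C1n.
  move=> _ [al [be [x [[Kx _] _ _ ->]]]].
  apply: (subspaceD C1n_subspace); apply: (subspaceZ C1n_subspace) => //.
  exact: hamm_C1n.
have hK : hull N K hamm one_fam rho1 rho2 `<=` K.
  move=> _ [al [be [x [[Kx _] /andP[al0 _] /andP[be0 _] ->]]]].
  exact: (coneKD cone_const01 (coneKZ cone_const01 al0 (hamm_K Kx)) (coneKZ cone_const01 be0 (coneK_one a b cone_const01))).
have [_ ND NZ] := @normC1n_seminorm R n.
have [p pC clp] : exists2 p, C1n p & cluster_pt N z p.
  apply: (@C1n_ascoli R n (hull N K hamm one_fam rho1 rho2)) => //.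
    have [M HM] := hamm_bounded rho2; exists (M + rho1) => y i t hy It.
    have [h1 h2] := normC1n_ge i (hC _ hy) It.
    suff le : N y <= M + rho1 by split; apply: le_trans le.
    move: hy => [al [be [x [[Kx Nx] /andP[al0 al1] /andP[be0 be1] ->]]]].
    have hxC := hamm_C1n Kx.
    apply: le_trans (ND _ _ _ _) _; try exact: (subspaceZ C1n_subspace).
    rewrite !NZ // normC1n_one // !ger0_norm // mulr1; apply: lerD => //.
    by apply: le_trans (HM x Kx Nx); rewrite ler_piMl // normC1n_ge0.
  move=> e e0; have [M M0 HM] := dhamm_osc rho2.
  have M1 : 0 < M + 1 by rewrite ltr_wpDl.
  have [d d0 Hd] := osc_uniform (divr_gt0 e0 M1); exists d => // y i s t.
  move=> [al [be [x [[Kx Nx] /andP[al0 al1] /andP[be0 be1] ->]]]] Is It st.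
  have hxC := hamm_C1n Kx.
  have dE q : I01 q -> derive01 ((al *: hamm x + be *: one_fam) i) q = al * dhamm x i q.
    move=> Iq; rewrite derive_C1nD ?derive_C1nZ //; try exact: (subspaceZ C1n_subspace).
    by rewrite (hamm_C1 i Kx).2 // (C1_cst 1).2 // mulr0 addr0.
  rewrite !dE // -mulrBr normrM ger0_norm //.
  apply: (@le_trans _ _ `|dhamm x i s - dhamm x i t|); first by rewrite ler_piMl.
  apply: le_trans (HM x i s t Kx Nx Is It) _.
  have := Hd s t Is It st; rewrite ltr_pdivlMr // => lt; apply: le_trans (ltW lt).
  by rewrite mulrC ler_wpM2l ?osc_ge0 // lerDl.
exists p => //; apply: (coneK_closed ab01 cone_const01) => // e e0.
have [m _ Hm] := clp e e0 0%N; exists (z m) => //.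
exact: hK.
Qed.


(** * The boundary estimates *)

Lemma inv_m_ge i t : I01 t -> Ik i t <= inv_m (k i) 0 /\ Idk i t <= inv_m (k i) 1.
Proof.
move=> It; split; apply: ub_le_sup; try by exists t.
  by exists (P01 i) => _ [x Ix <-]; exact: Ik_le.
by exists (P01 i) => _ [x Ix <-]; exact: Idk_le.
Qed.

Lemma boundary_box i u s rho : 0 < rho -> K u -> N u = rho -> I01 s ->
  boxI rho (inf_bdK K (w i) rho) (sup_bdK K (w i) rho) (s, jet u s, w i u).
Proof.
move=> r0 Ku Nu Is; split=> //= [j|]; first by apply: jet_le; rewrite ?Nu //; exact: KC1.
by rewrite (inf_bdK_le cone_const01 (aw i) r0 Ku Nu) (sup_bdK_ge cone_const01 (aw i) r0 Ku Nu).
Qed.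

(** On the sphere the source is at most the maximum of [f] over the box, and each
    functional is at most its supremum. *)
Lemma hamm_upper rho : 0 < rho -> (forall (i : 'I_n) (l : 'I_2),
    lambda i * fover (f i) rho (inf_bdK K (w i) rho) (sup_bdK K (w i) rho) * inv_m (k i) l
      + \sum_(j < 2) eta i j * normoo (iter l derive01 (gamma i j)) * sup_bdK K (h i j) rho
    <= rho) -> forall u, K u -> N u = rho -> N (hamm u) <= rho.
Proof.
move=> r0 up u Ku Nu; apply: normC1n_le => [|i x Ix]; first exact: ltW.
have w0 : 0 <= inf_bdK K (w i) rho by apply: (inf_bdK_ge0 cone_const01 (aw i) r0 n_ge1).
pose B := fover (f i) rho (inf_bdK K (w i) rho) (sup_bdK K (w i) rho).
have sB s : I01 s -> `|source i u s| <= B.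
  move=> Is; rewrite ger0_norm ?source_ge0 //.
  exact: (fover_ge (fN i) w0 (boundary_box i r0 Ku Nu Is)).
have B0 : 0 <= B by apply: le_trans (sB 0 I01_0); exact: normr_ge0.
have hH j : h i j u <= sup_bdK K (h i j) rho by exact: (sup_bdK_ge cone_const01 (ah i j) r0 Ku Nu).
have [m0 m1] := inv_m_ge i Ix.
rewrite (hamm_C1 i Ku).2 // hammE; split.
  apply: le_trans (up i ord0).
  apply: (@hamm_term_le (k i) (gamma i) (fun j => normoo (gamma i j))
    (fun j => sup_bdK K (h i j) rho) i u x B (inv_m (k i) 0)) => //; first exact: ik.
  by move=> j; apply: normoo_ge => //; have [] := C1_bounded (gC i j).
apply: le_trans (up i (Ordinal (isT : (1 < 2)%N))).
apply: (@hamm_term_le (dkernel (k i)) (fun j => derive01 (gamma i j))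
  (fun j => normoo (derive01 (gamma i j))) (fun j => sup_bdK K (h i j) rho) i u x B
  (inv_m (k i) 1)) => //; first exact: idk.
by move=> j; apply: normoo_ge => //; have [] := C1_bounded (gC i j).
Qed.

Lemma coneK_ge0 i u t : K u -> `[a i, b i]%classic t -> 0 <= u i t.
Proof.
move=> Ku abt; have [uC /(_ t abt)] := Ku i; apply: le_trans.
have /andP[c0 _] := cone_const01 i; have [bu _] := C1_bounded uC.
by rewrite mulr_ge0 ?normoo_ge0 // ltW.
Qed.

Lemma boundary_boxJ i u s rho : 0 < rho -> K u -> N u = rho -> `[a i, b i]%classic s ->
  boxJ i (a i) (b i) rho (inf_bdK K (w i) rho) (sup_bdK K (w i) rho) (s, jet u s, w i u).
Proof.
move=> r0 Ku Nu abs; have Is := ab_sub ab01 abs.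
have [_ /= bj bw] := boundary_box i r0 Ku Nu Is; split=> //= j.
have /andP[h1 ->] := bj j; rewrite andbT /theta; case: eqP => [->|_].
  by rewrite mul0r jet_lshift coneK_ge0.
by rewrite mulN1r.
Qed.

Lemma inv_M_ge0 i : 0 <= inv_M (k i) (a i) (b i).
Proof.
have [ai0 abi bi1] := ab01 i.
apply: lb_le_inf.
  by exists (\int[leb]_(s in `[a i, b i]) k i (a i) s); exists (a i) => //; rewrite /= in_itv /= lexx.
move=> _ [t abt <-].
have mab := @leb_measurable_itv R `[a i, b i].
apply: Rintegral_ge0_ae => //.
  apply: (integrableS mI) => //; first by move=> s; apply: (ab_sub ab01).
  by apply: ik; apply: (ab_sub ab01 abt).
apply: filterS (kernel_ge0 (kb i) ai0 bi1 (ct01 i) abt) => s H abs.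
by apply: H; exact: (ab_sub ab01 abs).
Qed.

Lemma hamm_lower_int i u t m : K u -> `[a i, b i]%classic t -> 0 <= m ->
  (forall s, `[a i, b i]%classic s -> m <= source i u s) ->
  lambda i * (m * inv_M (k i) (a i) (b i)) + \sum_(j < 2) eta i j * cg i j * normoo (gamma i j) * h i j u
   <= hamm u i t.
Proof.
move=> Ku abt m0 ms; have [ai0 abi bi1] := ab01 i; rewrite hammE; apply: lerD.
  rewrite ler_wpM2l //; have [B HB] := source_bounded (N u).
  apply: (@kint_lower R (k i) (Phi0 i) (a i) (b i) (ct i) (kc i) (kb i) ai0 bi1 (ct01 i)
    (source i u) (B i)) => //.
  - exact: source_measurable.
  - by move=> s Is; apply: (HB i).2.
  - by move=> s Is; apply: source_ge0.
apply: ler_sum => j _.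
have -> : eta i j * cg i j * normoo (gamma i j) * h i j u =
  (eta i j * h i j u) * (cg i j * normoo (gamma i j)) by ring.
by apply: ler_wpM2l; [rewrite mulr_ge0 ?h_ge0|exact: g_ge].
Qed.

(** Let [mn] be the infimum of [u i] over [[a i, b i]]. There the source is at
    least [dt i * mn] and the functionals at least [d i j * mn], so that
    [hamm u i >= mn] by the condition on the coefficients; an equation
    [u = hamm u + m] would give [mn >= mn + m]. *)
Lemma hamm_lower_slope rho (dt : 'I_n -> R) (d : 'I_n -> 'I_2 -> R) : 0 < rho ->
  (forall i, 0 <= dt i) -> (forall i j, 0 <= d i j) ->
  (forall i p, boxJ i (a i) (b i) rho (inf_bdK K (w i) rho) (sup_bdK K (w i) rho) p ->
     dt i * p.1.2 0 (lshift n i) <= f i p.1.1 p.1.2 p.2) ->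
  (forall i j u, bdK K rho u -> d i j * normoo (u i) <= h i j u) ->
  (forall i, 1 <= lambda i * dt i * ct i * inv_M (k i) (a i) (b i)
                 + \sum_(j < 2) eta i j * cg i j * d i j * normoo (gamma i j)) ->
  forall u m, K u -> N u = rho -> 0 < m ->
  ~ forall i t, I01 t -> u i t = hamm u i t + m.
Proof.
move=> r0 dt0 d0 fJ hJ one u m Ku Nu m0 ueq.
pose i := Ordinal n_ge1; have [ai0 abi bi1] := ab01 i.
pose A := [set u i t | t in `[a i, b i]].
have aa : `[a i, b i]%classic (a i) by rewrite /= in_itv /= lexx.
have A0 : A !=set0 by exists (u i (a i)); exists (a i).
have Alb : has_lbound A by exists 0 => _ [t abt <-]; exact: coneK_ge0.
pose mn := inf A; have mn_le t : `[a i, b i]%classic t -> mn <= u i t.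
  by move=> abt; apply: ge_inf => //; exists t.
have mn0 : 0 <= mn by apply: lb_le_inf => // _ [t abt <-]; exact: coneK_ge0.
suff : mn + m <= mn by rewrite gerDl leNgt m0.
apply: lb_le_inf => // _ [t abt <-]; have It := ab_sub ab01 abt.
rewrite ueq // lerD2r.
have ms s : `[a i, b i]%classic s -> dt i * mn <= source i u s.
  move=> abs; apply: le_trans (fJ i _ (boundary_boxJ r0 Ku Nu abs)).
  by rewrite /= jet_lshift ler_wpM2l // mn_le.
have dm0 : 0 <= dt i * mn by rewrite mulr_ge0.
apply: le_trans (hamm_lower_int Ku abt dm0 ms).
have [bu _] := C1_bounded (KC1 Ku i).
have mnu : mn <= normoo (u i).
  by apply: le_trans (mn_le _ aa) _; apply: le_trans (ler_norm _) _; apply: normoo_ge => //; exact: (ab_sub ab01 aa).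
rewrite -[leLHS]mul1r; apply: le_trans (ler_wpM2r mn0 (one i)) _.
rewrite mulrDl; apply: lerD.
  have /andP[ct0 ct1] := ct01 i; have M0 := inv_M_ge0 i.
  have -> : lambda i * dt i * ct i * inv_M (k i) (a i) (b i) * mn =
     ct i * (lambda i * (dt i * mn * inv_M (k i) (a i) (b i))) by ring.
  by rewrite ler_piMl // !mulr_ge0.
rewrite mulr_suml; apply: ler_sum => j _.
have /andP[cg0 cg1] := cg01 i j.
have [bg _] := C1_bounded (gC i j); have G0 := normoo_ge0 bg.
have -> : eta i j * cg i j * d i j * normoo (gamma i j) * mn =
  eta i j * cg i j * normoo (gamma i j) * (d i j * mn) by ring.
rewrite ler_wpM2l //; first by rewrite !mulr_ge0 // ltW.
apply: le_trans (hJ i j u _); last by apply/(bdKP a b cone_const01).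
by rewrite ler_wpM2l.
Qed.

(** Otherwise [u] would take at [a i] a value of at least [rho + m], more than its
    norm [rho]. *)
Lemma hamm_lower_value rho i : 0 < rho ->
  rho <= lambda i * funder (f i) i (a i) (b i) rho (inf_bdK K (w i) rho) (sup_bdK K (w i) rho)
           * inv_M (k i) (a i) (b i)
         + \sum_(j < 2) eta i j * cg i j * normoo (gamma i j) * inf_bdK K (h i j) rho ->
  forall u m, K u -> N u = rho -> 0 < m ->
  ~ forall i t, I01 t -> u i t = hamm u i t + m.
Proof.
move=> r0 lo u m Ku Nu m0 ueq; have [ai0 abi bi1] := ab01 i.
have aa : `[a i, b i]%classic (a i) by rewrite /= in_itv /= lexx.
have Ia := ab_sub ab01 aa.
have w0 : 0 <= inf_bdK K (w i) rho by apply: (inf_bdK_ge0 cone_const01 (aw i) r0 n_ge1).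
pose J := boxJ i (a i) (b i) rho (inf_bdK K (w i) rho) (sup_bdK K (w i) rho).
have f0 p : J p -> 0 <= f i p.1.1 p.1.2 p.2.
  move=> [abp _ /andP[wp _]]; apply: (fN i).2; first exact: (ab_sub ab01 abp).
  exact: le_trans wp.
pose m1 := funder (f i) i (a i) (b i) rho (inf_bdK K (w i) rho) (sup_bdK K (w i) rho).
have m1s s : `[a i, b i]%classic s -> m1 <= source i u s.
  move=> abs; apply: ge_inf; last by exists (s, jet u s, w i u) => //; exact: boundary_boxJ.
  by exists 0 => _ [p Jp <-]; exact: f0.
have m10 : 0 <= m1.
  apply: lb_le_inf; last by move=> _ [p Jp <-]; exact: f0.
  by exists (source i u (a i)); exists (a i, jet u (a i), w i u) => //; exact: boundary_boxJ.
have h1 := hamm_lower_int Ku aa m10 m1s.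
have [h2 _] := normC1n_ge i (KC1 Ku) Ia.
have h3 : rho <= hamm u i (a i).
  apply: le_trans lo _; apply: le_trans h1; apply: lerD; first by rewrite mulrA.
  apply: ler_sum => j _; have /andP[cg0 cg1] := cg01 i j.
  have [bg _] := C1_bounded (gC i j); have G0 := normoo_ge0 bg.
  rewrite ler_wpM2l //; first by rewrite !mulr_ge0 // ltW.
  exact: (inf_bdK_le cone_const01 (ah i j) r0 Ku Nu).
have := ueq i (a i) Ia; have := ler_norm (u i (a i)); rewrite Nu in h2; lra.
Qed.

Lemma hamm_solution rho1 rho2 : 0 < rho1 -> rho1 < rho2 ->
  (forall u, K u -> N u = rho2 -> N (hamm u) <= rho2) ->
  (forall u m, K u -> N u = rho1 -> 0 < m -> ~ forall i t, I01 t -> u i t = hamm u i t + m) ->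
  exists u, [/\ K u, rho1 <= N u <= rho2 & forall i t, I01 t -> u i t = hamm u i t].
Proof.
move=> r10 r12 up lo.
have oneK := coneK_one a b cone_const01.
have N1 : 0 < N one_fam by rewrite normC1n_one.
have TK u : cone_ball N K rho2 u -> K (hamm u) by move=> [Ku _]; exact: hamm_K.
have Tc u : cone_ball N K rho2 u -> forall e, 0 < e -> exists2 d, 0 < d &
    forall v, cone_ball N K rho2 v -> N (v - u) < d -> N (hamm v - hamm u) < e.
  move=> [Ku Nu] e e0; have [d d0 Hd] := hamm_cont Ku Nu e0.
  by exists d => // v [Kv Nv]; apply: Hd.
have Tb : exists B, forall u, cone_ball N K rho2 u -> N (hamm u) <= B.
  by have [M HM] := hamm_bounded rho2; exists M => u [Ku Nu]; apply: HM.
have lo' u m : K u -> N u = rho1 -> 0 < m -> N (u - (hamm u + m *: one_fam)) <> 0.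
  move=> Ku Nu m0 z0; apply: (lo u m Ku Nu m0) => i t It.
  have dC : C1n (u - (hamm u + m *: one_fam)).
    apply: (subspaceB C1n_subspace); first exact: KC1.
    apply: (subspaceD C1n_subspace); first exact: hamm_C1n.
    by apply: (subspaceZ C1n_subspace); exact: KC1.
  have [] := normC1n_ge i dC It; rewrite z0 normr_le0 subr_eq0 => /eqP -> _.
  by rewrite -[LHS]/(hamm u i t + m * 1) mulr1.
have [u [Ku Nu fu]] := @cone_compression R _ C1n N C1n_subspace normC1n_seminorm
  K hamm one_fam rho1 rho2 (@coneK_C1n R n a b c) (coneKD cone_const01) (coneKZ cone_const01) oneK N1 r10 r12
  TK Tc Tb (@hamm_hull_precompact rho1 rho2) up lo'.
exists u; split=> // i t It.
have [] := normC1n_ge i (subspaceB C1n_subspace (KC1 Ku) (hamm_C1n Ku)) It.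
by rewrite fu normr_le0 subr_eq0 => /eqP.
Qed.

End Hammerstein.

Theorem theorem2p5 (R : realType) (n : nat) (n_ge1 : (1 <= n)%N)
  (k : 'I_n -> R -> R -> R)
  (a b ct : 'I_n -> R) (Phi0 Phi1 : 'I_n -> R -> R)
  (f : 'I_n -> R -> 'rV[R]_(n + n) -> R -> R)
  (gamma : 'I_n -> 'I_2 -> R -> R) (cg : 'I_n -> 'I_2 -> R)
  (lambda : 'I_n -> R) (eta : 'I_n -> 'I_2 -> R)
  (h : 'I_n -> 'I_2 -> ('I_n -> R -> R) -> R)
  (w : 'I_n -> ('I_n -> R -> R) -> R) :
  let c := fun i => Num.min (ct i) (Num.min (cg i 0) (cg i 1)) in
  let K := coneK a b c in
  let fbar := fun i rho =>
    fover (f i) rho (inf_bdK K (w i) rho) (sup_bdK K (w i) rho) in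
  let J := fun i rho =>
    boxJ i (a i) (b i) rho (inf_bdK K (w i) rho) (sup_bdK K (w i) rho) in
  let flow := fun i rho =>
    funder (f i) i (a i) (b i) rho (inf_bdK K (w i) rho) (sup_bdK K (w i) rho) in
  let upper_condition := fun rho => forall (i : 'I_n) (l : 'I_2),
    lambda i * fbar i rho * inv_m (k i) l
      + \sum_(j < 2) eta i j * normoo (iter l derive01 (gamma i j))
                     * sup_bdK K (h i j) rho
    <= rho in
  forall
  (C1_ : forall i, kernel_continuous (k i))
  (C2_ab : forall i, [/\ 0 <= a i, a i <= b i & b i <= 1])
  (C2_ct : forall i, 0 < ct i <= 1)
  (C2_k : forall i, kernel_bounds (k i) (Phi0 i) (a i) (b i) (ct i))
  (C3_ : forall i, kernel_derivative (k i) (Phi1 i))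
  (C4_ : forall i, nonlinearity (f i))
  (C5_gamma : forall i j, C1 (gamma i j))
  (C5_cg : forall i j, 0 < cg i j <= 1)
  (C5_ge : forall i j t, `[a i, b i]%classic t ->
     cg i j * normoo (gamma i j) <= gamma i j t)
  (C6_lambda : forall i, 0 <= lambda i)
  (C6_eta : forall i j, 0 <= eta i j)
  (C7_ : forall i j, admissible_functional K (h i j))
  (C8_ : forall i, admissible_functional K (w i))
  (rho1 rho2 : R) (rho1_gt0 : 0 < rho1) (rho12 : rho1 < rho2),
  ((exists (dt : 'I_n -> R) (d : 'I_n -> 'I_2 -> R),
      [/\ (forall i, 0 <= dt i) /\ (forall i j, 0 <= d i j),
          forall i p, J i rho1 p ->
            dt i * p.1.2 0 (lshift n i) <= f i p.1.1 p.1.2 p.2,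
          forall i j u, bdK K rho1 u -> d i j * normoo (u i) <= h i j u
        & forall i, 1 <= lambda i * dt i * ct i * inv_M (k i) (a i) (b i)
                         + \sum_(j < 2) eta i j * cg i j * d i j
                                        * normoo (gamma i j)])
   /\ upper_condition rho2)
  \/
  ((exists i0 : 'I_n,
      rho1 <= lambda i0 * flow i0 rho1 * inv_M (k i0) (a i0) (b i0)
              + \sum_(j < 2) eta i0 j * cg i0 j * normoo (gamma i0 j)
                             * inf_bdK K (h i0 j) rho1)
   /\ upper_condition rho2) ->
  exists u, [/\ K u, rho1 <= normC1n u <= rho2 &
    forall i t, I01 t ->
      u i t = lambda i * \int[leb]_(s in I01) (k i t s * f i s (jet u s) (w i u))
              + \sum_(j < 2) eta i j * gamma i j t * h i j u].
Proof.
move=> c K fbar J flow upper_condition C1_ C2_ab C2_ct C2_k C3_ C4_ C5_gamma C5_cg C5_ge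
  C6_lambda C6_eta C7_ C8_ rho1 rho2 rho1_gt0 rho12 H.
have rho2_gt0 := lt_trans rho1_gt0 rho12.
have up : upper_condition rho2 by case: H => -[].
have below u m : K u -> normC1n u = rho1 -> 0 < m ->
    ~ forall i t, I01 t -> u i t = hamm k f gamma lambda eta h w u i t + m.
  case: H => [[[dt [d [[dt0 d0] fJ hJ one]]] _]|[[i0 lo] _]].
    exact: (hamm_lower_slope n_ge1 C1_ C2_ab C2_ct C2_k C4_ C5_gamma C5_cg C5_ge
      C6_lambda C6_eta C7_ C8_ rho1_gt0 dt0 d0 fJ hJ one).
  exact: (hamm_lower_value n_ge1 C1_ C2_ab C2_ct C2_k C4_ C5_gamma C5_cg C5_ge
    C6_lambda C6_eta C7_ C8_ rho1_gt0 lo).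
exact: (hamm_solution n_ge1 C1_ C2_ab C2_ct C2_k C3_ C4_ C5_gamma C5_cg C5_ge
  C6_lambda C6_eta C7_ C8_ rho1_gt0 rho12
  (hamm_upper n_ge1 C1_ C2_ct C2_k C3_ C4_ C5_gamma C5_cg C6_lambda C6_eta C7_ C8_
     rho2_gt0 up) below).
Qed.
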